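(* Let $d\ge1$, $q\ge2$ be integers, $\beta>0$, $p=1-e^{-\beta}$, and suppose strong spatial mixing (SSM) holds for the $q$-state Potts model on $\mathbb{Z}^d$ at inverse temperature $\beta$. Then there exists a constant $\delta>0$ such that for every $n$-vertex cube $V=\{0,\dots,\ell\}^d$, with $\nu$ the Edwards-Sokal joint measure on $V$ (free boundary condition) with parameters $p,q$, and for all $f:\Omega_J\to\mathbb{R}_+$, $$\mathrm{Ent}_\nu(P_{\rm local}f)\le\Big(1-\frac{\delta}{n}\Big)\mathrm{Ent}_\nu(f).$$ Moreover, the mixing time of the local dynamics satisfies $T_{\rm mix}(P_{\rm local})=O(n\log n)$ (the constants $\delta$ and the one implicit in $O(\cdot)$ do not depend on $n$).
   Context: **Potts model.** Let $V=\{0,1,\dots,\ell\}^d\subset\mathbb{Z}^d$, $\mathbb{E}$ the set of nearest-neighbor edges of $\mathbb{Z}^d$ with both endpoints in $V$, $\Omega=\{1,\dots,q\}^V$, $D(\sigma)=\{\{v,w\}\in\mathbb{E}:\sigma_v\ne\sigma_w\}$, $M(\sigma)=\mathbb{E}\setminus D(\sigma)$. The internal boundary $\partial V\subseteq V$ is the set of vertices of $V$ adjacent to at least one vertex of $\mathbb{Z}^d\setminus V$. A boundary condition is a map $\psi:U^\psi\to\{1,\dots,q\}$ with $U^\psi\subseteq\partial V$, and $\mu^\psi(\sigma)=\frac1{Z^\psi}e^{-\beta|D(\sigma)|}$ if $\sigma$ agrees with $\psi$ on $U^\psi$, $0$ otherwise. **SSM.** For $a,b>0$ let $\mathcal{C}(V,a,b)$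 be the property that for all $B\subset V$, all $u\in\partial V$ and any pair of boundary conditions $\psi,\psi_u$ on $\partial V$ that differ only in the spin of $u$, $\|\mu^\psi_B-\mu^{\psi_u}_B\|_{TV}\le b\,e^{-a\,\mathrm{dist}(u,B)}$, where $\mu_B^\psi$ denotes the marginal on $B$ and $\mathrm{dist}(u,B)=\min_{v\in B}\|u-v\|_1$. SSM holds if there exist $a,b>0$ such that $\mathcal{C}(V,a,b)$ holds for every cube $V\subset\mathbb{Z}^d$. **Joint measure.** On $\Omega_J=\Omega\times\{0,1\}^{\mathbb{E}}$ (pairs $(\sigma,A)$, $A\subseteq\mathbb{E}$), $\nu(\sigma,A)=\frac1{Z_J}p^{|A|}(1-p)^{|\mathbb{E}|-|A|}\mathbf{1}(A\subseteq M(\sigma))$. **Local dynamics.** $P_{\rm local}=\frac1{2|V|}\sum_{v\in V}Q_v+\frac1{2|\mathbb{E}|}\sum_{e\in\mathbb{E}}W_e$, where $Q_v$ is the heat-bath update at $v$ (replace the spin of $v$ by a sample from its conditional law under $\nu$ given all other spins and all edges: uniform in $\{1,\dots,q\}$ if $v$ is isolated in $(V,A)$, unchanged otherwise), and $W_e$ is the heat-bath update at $e$ (replace the state of $e$ by a sample from its conditional law under $\nu$ given all spins and all other edges: if $e\in M(\sigma)$, include $e$ with probability $p$ and exclude it otherwise; if $e\notin M(\sigma)$, $e$ is excluded). The chain is considered on the support $\{(\sigma,A):A\subseteq M(\sigma)\}$ of $\nu$. **Entropy.** $\mathrm{Ent}_\nu(f)=\nu[f\log(f/\nu[f])]$, with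 $0\log0=0$. **Mixing time.** For an ergodic chain $P$ on a finite state space $\Gamma$ with stationary distribution $\pi$, $T_{\rm mix}(P)=\max_{x\in\Gamma}\min\{t\ge0:\|P^t(x,\cdot)-\pi\|_{TV}\le 1/4\}$, with $\|\cdot\|_{TV}$ total variation distance. *)

(* Defs.v *)
From HB Require Import structures.
From mathcomp Require Import all_boot all_order all_algebra.
From mathcomp Require Import all_classical all_reals all_analysis.

Set Implicit Arguments.
Unset Strict Implicit.
Unset Printing Implicit Defensive.

Import Order.TTheory GRing.Theory Num.Theory.
Local Open Scope ring_scope.

(* ---- Finite probability and Markov kernels ---- *)

Definition tv_dist (R : realType) (T : finType) (mu nu : T -> R) : R :=
  2^-1 * \sum_x `|mu x - nu x|.

Definition expect (R : realType) (T : finType) (mu f : T -> R) : R :=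
  \sum_x mu x * f x.

(* The convention 0 log 0 = 0 is automatic, as [ln 0 = 0]; when
   [expect mu f = 0], [f] vanishes wherever [mu] does not and the sum is 0. *)
Definition entropy (R : realType) (T : finType) (mu f : T -> R) : R :=
  expect mu (fun x => f x * ln (f x / expect mu f)).

Definition kernel_app (R : realType) (T : finType)
    (P : T -> T -> R) (f : T -> R) : T -> R :=
  fun x => \sum_y P x y * f y.

Fixpoint kernel_pow (R : realType) (T : finType)
    (P : T -> T -> R) (t : nat) : T -> T -> R :=
  fun x y => if t is t'.+1 then \sum_z P x z * kernel_pow P t' z y
             else (x == y)%:R.

(* Valued in the extended reals so that a chain that fails to mix from some
   starting state gets [+oo], the infimum of the empty set; otherwise the
   infimum is over a nonempty set of naturals, hence a minimum. *)
Definition mixing_time (R : realType) (T : finType)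
    (P : T -> T -> R) (pi : T -> R) : \bar R :=
  ereal_sup [set ereal_inf [set (t%:R)%:E | t in
    [set t : nat | tv_dist (kernel_pow P t x) pi <= 4^-1]]
    | x in [set: T]]%classic.

(* Resampling from [mu] conditioned on the [sim]-class of the current state.
   Rows at states whose class is [mu]-null are zero; they play no role. *)
Definition heat_bath (R : realType) (T : finType)
    (mu : T -> R) (sim : rel T) : T -> T -> R :=
  fun x y => if sim x y then mu y / \sum_(z | sim x z) mu z else 0.

(* ---- The cube {0, ..., l}^d in Z^d ---- *)

Definition site (d : nat) := {ffun 'I_d -> int}.

Definition l1dist (d : nat) (x y : site d) : nat :=
  (\sum_i `|x i - y i|)%N.

Definition vertex (d l : nat) := {ffun 'I_d -> 'I_l.+1}.

Definition to_site (d l : nat) (v : vertex d l) : site d :=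
  [ffun i => (v i : nat)%:Z].

Definition vdist (d l : nat) (v w : vertex d l) : nat :=
  l1dist (to_site v) (to_site w).

(* Two vertices of the cube are at distance at most [d * l], so this is the
   minimum whenever [B] is nonempty. *)
Definition set_dist (d l : nat) (u : vertex d l) (B : {set vertex d l}) : nat :=
  \big[minn/(d * l)%N]_(v in B) vdist u v.

(* Unordered nearest-neighbour pairs *)
Definition is_edge (d l : nat) (e : {set vertex d l}) : bool :=
  [exists v, exists w, (vdist v w == 1%N) && (e == [set v; w])].

Definition edge (d l : nat) := {e : {set vertex d l} | is_edge e}.

(* Vertices having a neighbour in Z^d outside the cube *)
Definition int_boundary (d l : nat) : {set vertex d l} :=
  [set v | `[< exists z : site d,
      l1dist (to_site v) z = 1%N /\ (forall w : vertex d l, z <> to_site w) >]].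

(* ---- Potts model and strong spatial mixing ---- *)

Definition spins (d l q : nat) := {ffun vertex d l -> 'I_q}.

Definition disagree (d l q : nat) (s : spins d l q) : {set edge d l} :=
  [set e : edge d l | [exists v in val e, exists w in val e, s v != s w]].

Definition mono (d l q : nat) (s : spins d l q) : {set edge d l} :=
  ~: disagree s.

(* Partial spin assignments; a boundary condition is one whose domain is
   contained in the internal boundary. *)
Definition partial_spins (d l q : nat) := {ffun vertex d l -> option 'I_q}.

Definition bdom (d l q : nat) (psi : partial_spins d l q) : {set vertex d l} :=
  [set v | psi v != None].

Definition is_bc (d l q : nat) (psi : partial_spins d l q) : bool :=
  bdom psi \subset int_boundary d l.

Definition agrees (d l q : nat) (psi : partial_spins d l q) (s : spins d l q) :
    bool :=
  [forall v in bdom psi, psi v == Some (s v)].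

Definition potts_weight (R : realType) (d l q : nat) (beta : R)
    (psi : partial_spins d l q) (s : spins d l q) : R :=
  if agrees psi s then expR (- beta * #|disagree s|%:R) else 0.

Definition potts (R : realType) (d l q : nat) (beta : R)
    (psi : partial_spins d l q) (s : spins d l q) : R :=
  potts_weight beta psi s / \sum_t potts_weight beta psi t.

Definition marginal (R : realType) (d l q : nat) (mu : spins d l q -> R)
    (B : {set vertex d l}) (t : {ffun {v | v \in B} -> 'I_q}) : R :=
  \sum_(s : spins d l q | [ffun v : {v | v \in B} => s (val v)] == t) mu s.

(* The two boundary conditions share an arbitrary domain inside the internal
   boundary (the other boundary vertices being free) and may differ only in
   the spin they give to [u].  For empty [B] the inequality is trivial. *)
Definition spatial_mixing (R : realType) (d l q : nat) (beta a b : R) : Prop :=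
  forall (B : {set vertex d l}) (u : vertex d l)
         (psi psi_u : partial_spins d l q),
    u \in int_boundary d l -> is_bc psi -> is_bc psi_u ->
    bdom psi = bdom psi_u -> (forall v, v != u -> psi v = psi_u v) ->
    tv_dist (marginal (potts beta psi) (B := B))
            (marginal (potts beta psi_u) (B := B))
      <= b * expR (- a * (set_dist u B)%:R).

(* Cubes with a corner at the origin suffice, by translation invariance. *)
Definition SSM (R : realType) (d q : nat) (beta : R) : Prop :=
  exists a b : R, [/\ 0 < a, 0 < b &
    forall l : nat, spatial_mixing d l q beta a b].

(* ---- Edwards-Sokal joint measure and local dynamics ---- *)

Definition joint (d l q : nat) : Type := (spins d l q * {set edge d l})%type.

Definition admissible (d l q : nat) (x : joint d l q) : bool :=
  x.2 \subset mono x.1.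

Definition es_weight (R : realType) (d l q : nat) (p : R) (x : joint d l q) :
    R :=
  p ^+ #|x.2| * (1 - p) ^+ (#|{: edge d l}| - #|x.2|) * (admissible x)%:R.

Definition es (R : realType) (d l q : nat) (p : R) (x : joint d l q) : R :=
  es_weight p x / \sum_(y : joint d l q) es_weight p y.

Definition same_off_vertex (d l q : nat) (v : vertex d l) : rel (joint d l q) :=
  fun x y => (x.2 == y.2) && [forall w, (w != v) ==> (x.1 w == y.1 w)].

Definition same_off_edge (d l q : nat) (e : edge d l) : rel (joint d l q) :=
  fun x y => (x.1 == y.1) && [forall g, (g != e) ==> ((g \in x.2) == (g \in y.2))].

Definition vertex_update (R : realType) (d l q : nat) (p : R) (v : vertex d l) :
    joint d l q -> joint d l q -> R :=
  heat_bath (es p) (same_off_vertex v).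

Definition edge_update (R : realType) (d l q : nat) (p : R) (e : edge d l) :
    joint d l q -> joint d l q -> R :=
  heat_bath (es p) (same_off_edge e).

Definition local_dynamics (R : realType) (d l q : nat) (p : R)
    (x y : joint d l q) : R :=
  (2 * #|{: vertex d l}|%:R)^-1 * (\sum_(v : vertex d l) vertex_update p v x y)
  + (2 * #|{: edge d l}|%:R)^-1 * (\sum_(e : edge d l) edge_update p e x y).

(* The chain itself lives on the support of the joint measure. *)
Definition joint_support (d l q : nat) := {x : joint d l q | admissible x}.

Definition local_chain (R : realType) (d l q : nat) (p : R)
    (x y : joint_support d l q) : R :=
  local_dynamics p (val x) (val y).

Definition es_support (R : realType) (d l q : nat) (p : R)
    (x : joint_support d l q) : R :=
  es p (val x).

(* Main.v *)
Require Import Defs.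
From HB Require Import structures.
From mathcomp Require Import all_boot all_order all_algebra.
From mathcomp Require Import all_classical all_reals all_analysis.
From mathcomp Require Import ring lra zify.
(* Restores the names that [classical_sets] shadows. *)
From mathcomp Require Import fintype finset.

Set Implicit Arguments.
Unset Strict Implicit.
Unset Printing Implicit Defensive.

Import Order.TTheory GRing.Theory Num.Theory.
Local Open Scope ring_scope.

(** Let h be the density of the change of measure caused, inside a block, by
    flipping one outer spin.  Conditioned on the outside of nested cubes around
    that spin, h is a reverse martingale whose increments strong spatial mixing
    bounds by a summable sequence.  Hence a block average E_T f depends on the
    outer spin only through the gradients of f, up to a factor summable in the
    distance; the same holds for sqrt (E_T f^2), given a uniform spectral gap.
    A suitably weighted average over all translates of a block of side L then
    contracts the total gradient, since a site is rarely on the boundary of the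
    block.  Iterating it gives the spectral gap; with sqrt f in place of f, it
    gives a log-Sobolev inequality for the Potts measure that is uniform in the
    cube.

    The joint measure is the image of the Potts measure times Bernoulli(p)
    percolation om under (s, om) |-> (s, {e in M(s) | om e = 1}).  Tensorization
    of entropy for the percolation, and the Potts log-Sobolev inequality for the
    conditional expectation of f given s, yield approximate tensorization of
    entropy for the joint measure: a spin flip there costs only a constant
    because all the edges at a vertex are closed with probability bounded
    below.  By convexity of entropy this is entropy decay for the average of the
    updates, and Pinsker's inequality gives the mixing time. *)

(** * Conditional expectation, variance and entropy *)

(** Strong spatial mixing speaks only of spins frozen on the internal boundary of a cube. Every set
    of free spins is therefore a [region]: a part of a cube whose other vertices are frozen. Its
    faces may be free where they lie on faces of the ambient cube, and blocks and nested cubes are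
    cut out so as to be regions again.

    The gradient of [sqrt (E_T f^2)] brings in variances of [f] on the nested cubes, so a gap
    uniform over all regions must come first. It is reached through sup-norm oscillations, whose
    estimate needs no gap.

    Only translates inside the large cube are available, and near its faces few of them cover a
    given site. The weights repair this; the block side is a square [K^2] so that an extreme
    position of weight [K] is balanced by the number of its competitors, and being within [m] of an
    inner face has relative weight of order [(1 + m) / K].

    One averaging step contracts only by [1 - 1 / (2 Ztot)], where [Ztot] grows with the volume.
    Nothing is lost: for the gap the same [1 / Ztot] multiplies the Dirichlet form, and for the
    log-Sobolev inequality only the fixed point of the iteration survives. *)

Section ConditionalExpectation.
Variables (R : realType) (X : finType) (w : X -> R).
Hypothesis w_gt0 : forall x, 0 < w x.

(** The conditioning is given by a relation and an unnormalised weight, so that one calculus serves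
    block averages ([eqoff S]), heat-bath updates and plain means ([anyrel]). *)
Definition cE (sim : rel X) (f : X -> R) (x : X) : R :=
  (\sum_(y | sim x y) w y * f y) / \sum_(y | sim x y) w y.

Definition cVar (sim : rel X) (f : X -> R) (x : X) : R :=
  cE sim (fun y => f y ^+ 2) x - cE sim f x ^+ 2.

Definition cEnt (sim : rel X) (f : X -> R) (x : X) : R :=
  cE sim (fun y => f y * ln (f y)) x - cE sim f x * ln (cE sim f x).

Section Fixed.
Variable sim : rel X.
Hypothesis simE : equivalence_rel sim.

Lemma sim_refl x : sim x x.
Proof. by case: (simE x x x). Qed.

Lemma sim_congr x y : sim x y -> sim x =1 sim y.
Proof. by move=> xy z; case: (simE x y z) => _; apply. Qed.

Lemma sim_sym x y : sim x y -> sim y x.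
Proof. by move=> xy; rewrite -(sim_congr xy) sim_refl. Qed.

Lemma sim_weight_gt0 x : 0 < \sum_(y | sim x y) w y.
Proof.
rewrite (bigD1 x) ?sim_refl //= ltr_pwDl // sumr_ge0 // => y _.
exact: ltW.
Qed.

Lemma cE_eq f g x : (forall y, sim x y -> f y = g y) -> cE sim f x = cE sim g x.
Proof. by move=> fg; rewrite /cE (eq_bigr _ (fun y xy => congr1 _ (fg y xy))). Qed.

Lemma cE_class f x y : sim x y -> cE sim f x = cE sim f y.
Proof.
move=> xy; rewrite /cE; congr (_ / _); apply: eq_bigl => z; exact: sim_congr.
Qed.

Lemma cE_le f g x : (forall y, sim x y -> f y <= g y) -> cE sim f x <= cE sim g x.
Proof.
move=> fg; rewrite ler_pM2r ?invr_gt0 ?sim_weight_gt0 //.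
by apply: ler_sum => y xy; rewrite ler_pM2l // fg.
Qed.

Lemma cED f g x : cE sim (fun y => f y + g y) x = cE sim f x + cE sim g x.
Proof.
rewrite /cE -mulrDl -big_split; congr (_ / _).
by apply: eq_bigr => y _; rewrite mulrDr.
Qed.

Lemma cE_pull f g x : (forall y, sim x y -> f y = f x) ->
  cE sim (fun y => f y * g y) x = f x * cE sim g x.
Proof.
move=> fx; rewrite /cE mulrA mulr_sumr; congr (_ / _).
by apply: eq_bigr => y xy; rewrite fx // mulrCA.
Qed.

Lemma cEZ c f x : cE sim (fun y => c * f y) x = c * cE sim f x.
Proof. exact: (cE_pull (f := fun=> c)). Qed.

Lemma cEN f x : cE sim (fun y => - f y) x = - cE sim f x.
Proof. by rewrite -mulN1r -cEZ; apply: cE_eq => y _; rewrite mulN1r. Qed.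

Lemma cEB f g x : cE sim (fun y => f y - g y) x = cE sim f x - cE sim g x.
Proof. by rewrite cED cEN. Qed.

Lemma cE_cst c x : cE sim (fun=> c) x = c.
Proof. by rewrite /cE -mulr_suml mulrC mulKf // gt_eqF ?sim_weight_gt0. Qed.

Lemma cE_inv f x : (forall y, sim x y -> f y = f x) -> cE sim f x = f x.
Proof. by move=> fx; rewrite (cE_eq (g := fun=> f x)) ?cE_cst. Qed.

Lemma cE_sum (I : Type) (r : seq I) (P : pred I) (F : I -> X -> R) x :
  cE sim (fun y => \sum_(i <- r | P i) F i y) x = \sum_(i <- r | P i) cE sim (F i) x.
Proof.
elim: r => [|i r IH].
  rewrite big_nil -[RHS](cE_cst 0 x); apply: cE_eq => y _; by rewrite big_nil.
rewrite big_cons -IH; case: (boolP (P i)) => Pi; last first.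
  by apply: cE_eq => y _; rewrite big_cons (negPf Pi).
by rewrite -cED; apply: cE_eq => y _; rewrite big_cons Pi.
Qed.

Lemma cE_ge0 f x : (forall y, sim x y -> 0 <= f y) -> 0 <= cE sim f x.
Proof. by move=> f0; rewrite -(cE_cst 0 x); apply: cE_le. Qed.

Lemma cE_gt0 f x : (forall y, sim x y -> 0 < f y) -> 0 < cE sim f x.
Proof.
move=> f0; rewrite divr_gt0 ?sim_weight_gt0 //.
rewrite (bigD1 x) ?sim_refl //= ltr_pwDl ?mulr_gt0 ?f0 ?sim_refl //.
by rewrite sumr_ge0 // => y /andP[xy _]; rewrite mulr_ge0 // ltW // f0.
Qed.

Lemma cE_eq0 f x : (forall y, sim x y -> 0 <= f y) -> cE sim f x = 0 ->
  forall y, sim x y -> f y = 0.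
Proof.
move=> f0 /eqP; rewrite mulf_eq0 invr_eq0 (gt_eqF (sim_weight_gt0 x)) orbF.
move=> e0 y xy; move: e0; rewrite psumr_eq0; last first.
  by move=> z xz; rewrite mulr_ge0 ?f0 // ltW.
by move=> /allP/(_ y (mem_index_enum _)); rewrite xy mulf_eq0 (gt_eqF (w_gt0 y)) => /eqP.
Qed.

Lemma cE_ge_weight f x y c : (forall y, sim x y -> 0 <= f y) -> sim x y ->
  c * (\sum_(z | sim x z) w z) <= w y -> c * f y <= cE sim f x.
Proof.
move=> f0 xy cw; rewrite ler_pdivlMr ?sim_weight_gt0 // mulrAC.
apply: (@le_trans _ _ (w y * f y)); first by rewrite ler_wpM2r ?f0.
by rewrite (bigD1 y) //= lerDl sumr_ge0 // => z /andP[xz _]; rewrite mulr_ge0 ?f0 // ltW.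
Qed.

Lemma cE_norm f x : `|cE sim f x| <= cE sim (fun y => `|f y|) x.
Proof.
rewrite ler_norml -cEN; apply/andP; split; apply: cE_le => y _.
  by rewrite -lerN2 opprK -normrN ler_norm.
exact: ler_norm.
Qed.

Lemma cVarE f x : cVar sim f x = cE sim (fun y => (f y - cE sim f x) ^+ 2) x.
Proof.
rewrite /cVar; set m := cE sim f x.
rewrite [RHS](cE_eq (g := fun y => (f y ^+ 2 - (2 * m) * f y) + m ^+ 2)); last by move=> y _; ring.
by rewrite cED cEB cEZ cE_cst -/m; ring.
Qed.

Lemma cVar_ge0 f x : 0 <= cVar sim f x.
Proof. by rewrite cVarE cE_ge0 // => y _; rewrite sqr_ge0. Qed.

Lemma cVar_le_sqr f x c : cVar sim f x <= cE sim (fun y => (f y - c) ^+ 2) x.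
Proof.
rewrite (cE_eq (g := fun y => (f y ^+ 2 - (2 * c) * f y) + c ^+ 2)); last by move=> y _; ring.
rewrite cED cEB cEZ cE_cst /cVar -subr_ge0.
have -> : forall a m : R, a - 2 * c * m + c ^+ 2 - (a - m ^+ 2) = (m - c) ^+ 2 by move=> *; ring.
exact: sqr_ge0.
Qed.

Lemma cVar_eq f g x : (forall y, sim x y -> f y = g y) -> cVar sim f x = cVar sim g x.
Proof.
by move=> fg; rewrite /cVar (cE_eq fg) (@cE_eq _ (fun y => g y ^+ 2)) // => y /fg ->.
Qed.

Lemma cVar_shift f g x : (forall y, sim x y -> g y = g x) ->
  cVar sim (fun y => f y - g y) x = cVar sim f x.
Proof.
move=> gx; rewrite !cVarE cEB (cE_inv gx); apply: cE_eq => y xy; rewrite gx //.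
by congr (_ ^+ 2); ring.
Qed.

Lemma cE_cauchy f g x :
  cE sim (fun y => f y * g y) x ^+ 2
    <= cE sim (fun y => f y ^+ 2) x * cE sim (fun y => g y ^+ 2) x.
Proof.
set a := cE _ (fun y => f y ^+ 2) x; set b := cE _ (fun y => g y ^+ 2) x.
set c := cE _ _ x.
have q t : 0 <= a - 2 * t * c + t ^+ 2 * b.
  rewrite (_ : _ + _ = cE sim (fun y => (f y - t * g y) ^+ 2) x).
    by apply: cE_ge0 => y _; rewrite sqr_ge0.
  rewrite -!cEZ -cEB -cED; apply: cE_eq => y _; ring.
have b0 : 0 <= b by apply: cE_ge0 => y _; rewrite sqr_ge0.
have a0 : 0 <= a by apply: cE_ge0 => y _; rewrite sqr_ge0.
have [b_eq0|bN0] := eqVneq b 0.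
  have [->|cN0] := eqVneq c 0; first by rewrite expr0n mulr_ge0.
  (* For [b = 0] the quadratic is affine in [t], and this [t] would give it the value -1. *)
  have := q ((a + 1) / (2 * c)); rewrite b_eq0 mulr0 addr0.
  have -> : a - 2 * ((a + 1) / (2 * c)) * c = - 1 by field.
  by rewrite ler0N1.
have bp : 0 < b by rewrite lt_def bN0.
have := q (c / b).
have -> : a - 2 * (c / b) * c + (c / b) ^+ 2 * b = (a * b - c ^+ 2) / b by field.
by rewrite pmulr_lge0 ?invr_gt0 // subr_ge0.
Qed.

Lemma cE_cauchy_sqrt f g x :
  `|cE sim (fun y => f y * g y) x|
    <= Num.sqrt (cE sim (fun y => f y ^+ 2) x) * Num.sqrt (cE sim (fun y => g y ^+ 2) x).
Proof.
rewrite -sqrtrM; last by apply: cE_ge0 => y _; rewrite sqr_ge0.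
by rewrite -sqrtr_sqr ler_wsqrtr // cE_cauchy.
Qed.

(** Reverse triangle inequality in the [L^2] space of a class; it compares the gradient of
    [sqrt (E f^2)] with that of [f]. *)
Lemma cE_sqrt_dist f g x :
  (Num.sqrt (cE sim (fun y => f y ^+ 2) x) - Num.sqrt (cE sim (fun y => g y ^+ 2) x)) ^+ 2
   <= cE sim (fun y => (f y - g y) ^+ 2) x.
Proof.
have := cE_cauchy_sqrt f g x; rewrite ler_norml => /andP[_ cs].
rewrite [leRHS](cE_eq (g := fun y => (f y ^+ 2 - 2 * (f y * g y)) + g y ^+ 2)); last by move=> y _; ring.
rewrite cED cEB cEZ.
have h u : 0 <= cE sim (fun y => u y ^+ 2) x by apply: cE_ge0 => y _; rewrite sqr_ge0.
rewrite sqrrB !sqr_sqrtr ?h //; move: cs; lra.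
Qed.

Lemma cEnt_eq f g x : (forall y, sim x y -> f y = g y) -> cEnt sim f x = cEnt sim g x.
Proof.
move=> fg; rewrite /cEnt (cE_eq fg) (@cE_eq _ (fun y => g y * ln (g y))) //.
by move=> y /fg ->.
Qed.

Lemma ln_le_subr1 (t : R) : 0 < t -> ln t <= t - 1.
Proof.
move=> t0; rewrite -{1}[t](subrK 1) addrC le_ln1Dx //; lra.
Qed.

(** This is [ln t <= t - 1] at [t = g * m / f], multiplied by [f]. *)
Lemma entropy_pointwise (f g m : R) : 0 <= f -> 0 <= g -> (g = 0 -> f = 0) -> 0 < m ->
  f * ln g <= f * ln f - f * ln m + g * m - f.
Proof.
move=> f0 g0 gf m0.
have [->|fN0] := eqVneq f 0; first by rewrite !mul0r subr0 subrr add0r mulr_ge0 // ltW.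
have fp : 0 < f by rewrite lt_def fN0.
have gp : 0 < g by rewrite lt_def g0 andbT; apply: contraNneq fN0 => /gf ->.
have : ln (g * m / f) <= g * m / f - 1 by rewrite ln_le_subr1 // divr_gt0 ?mulr_gt0.
rewrite ln_div ?posrE ?mulr_gt0 // lnM ?posrE // -(ler_pM2l fp).
have -> : f * (g * m / f - 1) = g * m - f by field.
lra.
Qed.

Lemma cEnt_eq0 f x : (forall y, sim x y -> f y = 0) -> cEnt sim f x = 0.
Proof.
move=> f0; rewrite (cEnt_eq (g := fun=> 0)) // /cEnt !cE_cst; ring.
Qed.

(** Gibbs variational principle with test density [g]. The mean of [g] may differ from 1, at the
    price of the last term. *)
Lemma cEnt_var f g x : (forall y, sim x y -> 0 <= f y) -> (forall y, sim x y -> 0 <= g y) ->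
  (forall y, sim x y -> g y = 0 -> f y = 0) ->
  cE sim (fun y => f y * ln (g y)) x
    <= cEnt sim f x + cE sim f x * (cE sim g x - 1).
Proof.
move=> f0 g0 gf; have [m0|mN0] := eqVneq (cE sim f x) 0.
  have fz := cE_eq0 f0 m0; rewrite m0 mul0r addr0 cEnt_eq0 //.
  by rewrite (cE_eq (g := fun=> 0)) ?cE_cst // => y xy; rewrite fz // mul0r.
set m := cE sim f x; have mp : 0 < m by rewrite lt_def mN0 cE_ge0.
apply: (@le_trans _ _ (cE sim (fun y => (f y * ln (f y) - ln m * f y + m * g y) - f y) x)).
  apply: cE_le => y xy; have := entropy_pointwise (f0 y xy) (g0 y xy) (gf y xy) mp.
  by rewrite (mulrC (ln m)) (mulrC m).
rewrite cEB cED cEB !cEZ -/m /cEnt -/m; lra.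
Qed.

Lemma cEnt_ge0 f x : (forall y, sim x y -> 0 <= f y) -> 0 <= cEnt sim f x.
Proof.
move=> f0; have := cEnt_var f0 (g := fun=> 1) (fun y _ => ler01).
rewrite ln1 (cE_eq (g := fun=> 0)) ?cE_cst; last by move=> y _; rewrite mulr0.
by rewrite subrr mulr0 addr0; apply => y _ /eqP; rewrite oner_eq0.
Qed.

(** With [m] the mean of [f] and [t] that of [sqrt f], the inequality [ln y <= y - 1] at
    [y = sqrt (m / f)] gives [Ent f >= 2 m - 2 t sqrt m], which exceeds [m - t^2] by
    [(sqrt m - t)^2]. *)
Lemma cVar_sqrt_le_cEnt (f : X -> R) x : (forall y, sim x y -> 0 <= f y) ->
  cVar sim (fun y => Num.sqrt (f y)) x <= cEnt sim f x.
Proof.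
move=> f0; have [m0|mN0] := eqVneq (cE sim f x) 0.
  have fz := cE_eq0 f0 m0; rewrite cEnt_eq0 // (cVar_eq (g := fun=> 0)).
    by rewrite /cVar !cE_cst expr0n subrr.
  by move=> y /fz ->; rewrite sqrtr0.
set m := cE sim f x; have mp : 0 < m by rewrite lt_def mN0 cE_ge0.
set s := Num.sqrt m; have sp : 0 < s by rewrite sqrtr_gt0.
have sm : s ^+ 2 = m by rewrite sqr_sqrtr // ltW.
have : cE sim (fun y => 2 * f y - (2 * s) * Num.sqrt (f y)) x
     <= cE sim (fun y => f y * ln (f y) - ln m * f y) x.
  apply: cE_le => y xy; have [->|fN0] := eqVneq (f y) 0.
    by rewrite sqrtr0 !(mulr0,mul0r) !subr0.
  have fp : 0 < f y by rewrite lt_def fN0 f0.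
  have rp : 0 < Num.sqrt (f y) by rewrite sqrtr_gt0.
  set r := Num.sqrt (f y) in rp *.
  have rf : r ^+ 2 = f y by rewrite sqr_sqrtr // ltW.
  have := @ln_le_subr1 (s / r) (divr_gt0 sp rp).
  rewrite ln_div ?posrE // -rf -sm !lnXn // -(ler_pM2l (exprn_gt0 2 rp)).
  have -> : r ^+ 2 * (s / r - 1) = s * r - r ^+ 2 by field; rewrite gt_eqF.
  lra.
rewrite !cEB !cEZ -/m /cVar /cEnt -/m.
rewrite (@cE_eq (fun y => Num.sqrt (f y) ^+ 2) f); last by move=> y /f0 ?; rewrite sqr_sqrtr.
rewrite -/m; set t := cE _ _ x => h.
have := sqr_ge0 (s - t); rewrite sqrrB sm; lra.
Qed.

(** [ln y <= y - 1] at [y = f / m] bounds the entropy by [Var f / m]. Each atom has conditional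
    probability at least [c], hence [f <= m / c], and in [(f - t^2)^2 = (sqrt f - t)^2 (sqrt f +
    t)^2] the last factor is at most [4 m / c]. *)
Lemma cEnt_le_cVar_sqrt (f : X -> R) x (c : R) : (forall y, sim x y -> 0 <= f y) -> 0 < c -> c <= 1 ->
  (forall y, sim x y -> c * (\sum_(z | sim x z) w z) <= w y) ->
  cEnt sim f x <= 4 / c * cVar sim (fun y => Num.sqrt (f y)) x.
Proof.
move=> f0 c0 c1 cw; have [m0|mN0] := eqVneq (cE sim f x) 0.
  rewrite cEnt_eq0; last exact: cE_eq0.
  by rewrite mulr_ge0 ?cVar_ge0 // divr_ge0 // ltW.
set m := cE sim f x; have mp : 0 < m by rewrite lt_def mN0 cE_ge0.
set t := cE sim (fun y => Num.sqrt (f y)) x.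
have t0 : 0 <= t by apply: cE_ge0 => y _; rewrite sqrtr_ge0.
have tm : t ^+ 2 <= m / c.
  apply: (@le_trans _ _ m).
    have := cVar_ge0 (fun y => Num.sqrt (f y)) x; rewrite /cVar -/t subr_ge0.
    by rewrite (@cE_eq (fun y => Num.sqrt (f y) ^+ 2) f) // => y /f0 ?; rewrite sqr_sqrtr.
  by rewrite ler_pdivlMr // ger_pMr.
have fm y : sim x y -> f y <= m / c.
  by move=> xy; rewrite ler_pdivlMr // mulrC cE_ge_weight // cw.
have : cEnt sim f x <= cVar sim f x / m.
  have : cE sim (fun y => f y * ln (f y) - ln m * f y) x <=
         cE sim (fun y => m^-1 * f y ^+ 2 - f y) x.
    apply: cE_le => y xy; have [->|fN0] := eqVneq (f y) 0.
      by rewrite expr0n /= !(mulr0,mul0r) subrr.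
    have fp : 0 < f y by rewrite lt_def fN0 f0.
    have := @ln_le_subr1 (f y / m) (divr_gt0 fp mp).
    rewrite ln_div ?posrE // -(ler_pM2l fp).
    have -> : f y * (f y / m - 1) = m^-1 * f y ^+ 2 - f y by field.
    lra.
  rewrite !cEB !cEZ -/m /cVar /cEnt -/m.
  have K a : (a - m ^+ 2) / m = m^-1 * a - m. by field.
  by rewrite K (mulrC m).
move=> /le_trans; apply; rewrite ler_pdivrMr // cVarE -/m.
have -> : 4 / c * cVar sim (fun y => Num.sqrt (f y)) x * m =
  cE sim (fun y => (4 * m / c) * (Num.sqrt (f y) - t) ^+ 2) x.
  by rewrite cEZ cVarE -/t; field; rewrite gt_eqF.
rewrite -cVarE; apply: (le_trans (cVar_le_sqr _ _ (t ^+ 2))).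
apply: cE_le => y xy; rewrite -{1}(sqr_sqrtr (f0 y xy)) subr_sqr exprMn mulrC.
rewrite ler_wpM2r ?sqr_ge0 //.
have := fm y xy; rewrite -{1}(sqr_sqrtr (f0 y xy)); set r := Num.sqrt _ => rm.
have -> : 4 * m / c = 4 * (m / c) by rewrite mulrA.
have := sqr_ge0 (r - t); rewrite sqrrB sqrrD; lra.
Qed.

Lemma cEntZ c f x : 0 <= c -> (forall y, sim x y -> 0 <= f y) ->
  cEnt sim (fun y => c * f y) x = c * cEnt sim f x.
Proof.
move=> c0 f0; have [->|cN0] := eqVneq c 0.
  by rewrite mul0r cEnt_eq0 // => y _; rewrite mul0r.
have cp : 0 < c by rewrite lt_def cN0.
have h a : 0 <= a -> (c * a) * ln (c * a) = c * (a * ln a) + (c * ln c) * a.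
  move=> a0; have [->|aN0] := eqVneq a 0; first by rewrite !(mulr0,mul0r) addr0.
  have ap : 0 < a by rewrite lt_def aN0.
  by rewrite lnM ?posrE //; ring.
rewrite /cEnt (cE_eq (fun y xy => h _ (f0 y xy))) cED !cEZ h ?cE_ge0 //; ring.
Qed.

(** The normalised sum is used as the test density of [cEnt_var] for every summand. Together with
    the homogeneity [cEntZ] this is the convexity of entropy. *)
Lemma cEnt_sum_le (I : finType) (F : I -> X -> R) x :
  (forall i y, 0 <= F i y) ->
  cEnt sim (fun y => \sum_i F i y) x <= \sum_i cEnt sim (F i) x.
Proof.
move=> F0; set G := fun y => \sum_i F i y.
have G0 y : 0 <= G y by apply: sumr_ge0.
have [m0|mN0] := eqVneq (cE sim G x) 0.
  rewrite cEnt_eq0; last by apply: cE_eq0.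
  by apply: sumr_ge0 => i _; apply: cEnt_ge0.
set m := cE sim G x; have mp : 0 < m by rewrite lt_def mN0 cE_ge0.
have -> : cEnt sim G x = cE sim (fun y => G y * ln (G y / m)) x.
  rewrite /cEnt -/m.
  rewrite (@cE_eq (fun y => G y * ln (G y / m)) (fun y => G y * ln (G y) - ln m * G y)).
    by rewrite cEB cEZ -/m mulrC [_ * m]mulrC.
  move=> y _; have [->|gN0] := eqVneq (G y) 0; first by rewrite !(mulr0,mul0r) subrr.
  by rewrite ln_div ?posrE // ?lt_def ?gN0 ?G0 // mulrBr [ln m * _]mulrC.
rewrite (@cE_eq _ (fun y => \sum_i F i y * ln (G y / m))); last by move=> y _; rewrite -mulr_suml.
rewrite cE_sum; apply: ler_sum => i _.
apply: (le_trans (cEnt_var (fun y _ => F0 i y) (g := fun y => G y / m) _ _)).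
- by move=> y _; rewrite divr_ge0 // ltW.
- move=> y _ /eqP; rewrite mulf_eq0 invr_eq0 (negPf mN0) orbF psumr_eq0 // => /allP.
  by move=> /(_ i (mem_index_enum _)) /= /eqP.
- rewrite (@cE_eq (fun y => G y / m) (fun y => m^-1 * G y)); last by move=> *; rewrite mulrC.
  by rewrite cEZ -/m mulVf // subrr mulr0 addr0.
Qed.

End Fixed.

(** * Nested and commuting conditional expectations *)

Section Tower.
Variables s1 s2 : rel X.
Hypotheses (E1 : equivalence_rel s1) (E2 : equivalence_rel s2).

Lemma cE_tower f x : subrel s1 s2 -> cE s2 (cE s1 f) x = cE s2 f x.
Proof.
move=> sub; rewrite /cE; congr (_ / _).
pose D y := \sum_(z | s1 y z) w z.
have D0 y : D y != 0 by rewrite gt_eqF // sim_weight_gt0.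
transitivity (\sum_(y | s2 x y) \sum_(z | s1 y z) w y * (w z * f z) / D y).
  apply: eq_bigr => y _; rewrite mulr_suml mulr_sumr; apply: eq_bigr => z _.
  by rewrite mulrA.
rewrite (exchange_big_dep (s2 x)) /=; last first.
  by move=> y z xy /sub yz; rewrite (sim_congr E2 xy).
apply: eq_bigr => z xz.
transitivity (\sum_(y | s1 z y) w y * (w z * f z) / D z).
  apply: eq_big => y.
    apply/andP/idP => [[_ yz]|zy]; first exact: sim_sym.
    by split; [rewrite (sim_congr E2 xz); apply: sub | apply: sim_sym].
  move=> /andP[_ yz]; congr (_ / _); apply: eq_bigl => u; exact: sim_congr.
by rewrite -!mulr_suml -/(D z) mulrAC mulfV // mul1r.
Qed.

Lemma cE_selfadjoint f g x : subrel s1 s2 ->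
  cE s2 (fun y => f y * cE s1 g y) x = cE s2 (fun y => cE s1 f y * cE s1 g y) x.
Proof.
move=> sub; rewrite -[LHS](cE_tower _ _ sub); apply: cE_eq => // y _.
rewrite (@cE_eq _ _ (fun z => cE s1 g z * f z)); last by move=> *; rewrite mulrC.
by rewrite cE_pull 1?mulrC // => z yz; rewrite (cE_class E1 _ yz).
Qed.

Lemma cEnt_chain f x : subrel s1 s2 ->
  cEnt s2 f x = cE s2 (cEnt s1 f) x + cEnt s2 (cE s1 f) x.
Proof.
move=> sub; rewrite {1 3}/cEnt cE_tower // cEB // cE_tower //; ring.
Qed.

(** Since the expectations commute, the test density [E2 f / E1 E2 f] is constant on [s2]-classes,
    so [f] can replace [E2 f] in front of its logarithm. The variational bound for [E1] is then
    applied inside [E2]. *)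
Lemma cEnt_cE_le f x : (forall g y, cE s1 (cE s2 g) y = cE s2 (cE s1 g) y) ->
  (forall y, 0 <= f y) -> cEnt s1 (cE s2 f) x <= cE s2 (cEnt s1 f) x.
Proof.
move=> comm f0; pose F := cE s2 f; pose N := cE s1 F.
have F0 y : 0 <= F y by apply: cE_ge0.
have N0 y : 0 <= N y by apply: cE_ge0.
have Ff y : F y = 0 -> f y = 0 by move=> /(cE_eq0 E2 (fun y _ => f0 y)); apply; apply: sim_refl.
have NF y : N y = 0 -> F y = 0 by move=> /(cE_eq0 E1 (fun y _ => F0 y)); apply; apply: sim_refl.
pose g y := F y / N y.
have g0 y : 0 <= g y by rewrite divr_ge0.
have gf y : g y = 0 -> f y = 0.
  by move=> /eqP; rewrite mulf_eq0 invr_eq0 => /orP[]/eqP => [/Ff|/NF/Ff].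
have -> : cEnt s1 F x = cE s1 (fun y => F y * ln (g y)) x.
  rewrite /cEnt -/N.
  rewrite (@cE_eq _ (fun y => F y * ln (g y)) (fun y => F y * ln (F y) - ln (N x) * F y)).
    by rewrite cEB // cEZ // -/(N x) [_ * N x]mulrC.
  move=> y xy; have [->|FN0] := eqVneq (F y) 0; first by rewrite !(mulr0,mul0r) subrr.
  have -> : N x = N y by apply: cE_class.
  rewrite ln_div ?posrE // ?lt_def ?FN0 ?F0 ?N0 ?andbT //; last by apply: contraNneq FN0 => /NF ->.
  by rewrite mulrBr [ln (N y) * _]mulrC.
have -> : cE s1 (fun y => F y * ln (g y)) x = cE s1 (cE s2 (fun y => f y * ln (g y))) x.
  apply: cE_eq => // y _.
  rewrite (@cE_eq _ (fun y => f y * ln (g y)) (fun y => ln (g y) * f y)); last by move=> *; rewrite mulrC.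
  rewrite cE_pull 1?mulrC // => z yz; congr ln; rewrite /g /F /N (cE_class E2 _ yz).
  by rewrite -/F !comm (cE_class E2 _ yz).
rewrite comm; apply: cE_le => // y _.
apply: (le_trans (cEnt_var E1 (fun z _ => f0 z) (g := g) (fun z _ => g0 z) (fun z _ => @gf z))).
rewrite gerDl mulr_ge0_le0 ?cE_ge0 // subr_le0.
rewrite (@cE_eq _ g (fun z => (N y)^-1 * F z)); last first.
  by move=> z yz; rewrite mulrC /g /N (cE_class E1 _ yz).
rewrite cEZ // -/(N y); have [->|nN0] := eqVneq (N y) 0; first by rewrite mulr0.
by rewrite mulVf.
Qed.

End Tower.
End ConditionalExpectation.

(** * Influence of a single spin on a conditional expectation *)

Section Spins.
Variables (R : realType) (V : finType) (q : nat).
Local Notation conf := {ffun V -> 'I_q}.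
Implicit Types (S : {set V}) (s t u : conf) (i j v : V) (b : 'I_q) (f g : conf -> R).

Definition upd (s : conf) (i : V) (b : 'I_q) : conf :=
  [ffun v => if v == i then b else s v].

Definition eqoff (S : {set V}) : rel conf :=
  fun s t => [forall v, (v \notin S) ==> (s v == t v)].

Lemma eqoffP (S : {set V}) (s t : conf) : reflect (forall v, v \notin S -> s v = t v) (eqoff S s t).
Proof.
apply: (iffP forallP) => h v; last by apply/implyP => /h ->.
by move=> vS; apply/eqP/(implyP (h v)).
Qed.

Lemma eqoff_equiv (S : {set V}) : equivalence_rel (eqoff S).
Proof.
move=> x y z; split; first exact/eqoffP.
move=> /eqoffP xy; apply/eqoffP/eqoffP => h v vS; first by rewrite -xy // h.
by rewrite xy // h.
Qed.

Lemma eqoff_sub S S' : S \subset S' -> subrel (eqoff S) (eqoff S').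
Proof.
move=> /subsetP sub s t /eqoffP h; apply/eqoffP => v vS'; apply: h.
by apply: contra vS'; apply: sub.
Qed.

Lemma eqoff0 s t : eqoff set0 s t = (s == t).
Proof.
apply/eqoffP/eqP => [h|->] //; apply/ffunP => v; apply: h; by rewrite inE.
Qed.

Lemma updE s i b v : upd s i b v = if v == i then b else s v.
Proof. by rewrite ffunE. Qed.

Lemma upd_id s i : upd s i (s i) = s.
Proof. by apply/ffunP => v; rewrite updE; case: eqP => [->|]. Qed.

Lemma upd_upd s i b c : upd (upd s i b) i c = upd s i c.
Proof. by apply/ffunP => v; rewrite !updE; case: eqP. Qed.

Lemma eqoff_upd S s i b : i \in S -> eqoff S s (upd s i b).
Proof.
move=> iS; apply/eqoffP => v vS; rewrite updE ifN //.
by apply: contraNneq vS => ->.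
Qed.

(** A squared gradient in which all spin values count alike, whatever their conditional
    probabilities; bounded flip ratios make up for the difference. *)
Definition Gam (i : V) (g : conf -> R) (s : conf) : R :=
  \sum_b (g (upd s i b) - g s) ^+ 2.

Lemma Gam_ge0 i g s : 0 <= Gam i g s.
Proof. by apply: sumr_ge0 => b _; rewrite sqr_ge0. Qed.

Definition osc (i : V) (g : conf -> R) : R :=
  \big[Num.max/0]_(p : conf * 'I_q) `|g (upd p.1 i p.2) - g p.1|.

Lemma le_osc i g s b : `|g (upd s i b) - g s| <= osc i g.
Proof.
exact: (le_bigmax _ (fun p : conf * 'I_q => `|g (upd p.1 i p.2) - g p.1|) (s, b)).
Qed.

Lemma osc_le i g c : 0 <= c -> (forall s b, `|g (upd s i b) - g s| <= c) -> osc i g <= c.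
Proof. by move=> c0 h; apply: bigmax_le => // p _. Qed.

Lemma osc_ge0 i g : 0 <= osc i g.
Proof. exact: bigmax_ge_id. Qed.

Lemma sum_eqoffU1 S (j : V) (s : conf) (F : conf -> R) : j \notin S ->
  \sum_(t | eqoff (j |: S) s t) F t
    = \sum_(t | eqoff S s t) \sum_b F (upd t j b).
Proof.
move=> jS; rewrite pair_big_dep /=.
rewrite (reindex_onto (fun p : conf * 'I_q => upd p.1 j p.2)
  (fun t => (upd t j (s j), t j))) /=; last by move=> t _; rewrite upd_upd upd_id.
apply: eq_bigl => -[t b] /=; rewrite updE eqxx upd_upd andbT.
apply/andP/eqoffP => [[/eqoffP h /eqP[e]] v vS|h].
  rewrite -e updE; case: eqP => [->|/eqP vj] //.
  by rewrite h ?updE ?(negPf vj) // !inE negb_or vj.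
split; first by apply/eqoffP => v; rewrite !inE negb_or updE => /andP[/negPf -> /h].
apply/eqP; congr (_, _); apply/ffunP => v; rewrite updE.
by case: eqP => [->|//]; rewrite h.
Qed.

Lemma sum_eqoff_subset S S' (s : conf) (F : conf -> R) : S \subset S' ->
  (forall t, 0 <= F t) -> \sum_(t | eqoff S s t) F t <= \sum_(t | eqoff S' s t) F t.
Proof.
move=> sub F0; rewrite [leRHS](bigID (eqoff S s)) /=.
rewrite (eq_bigl (eqoff S s)) => [|t]; first by rewrite lerDl sumr_ge0.
by apply: andb_idl; apply: eqoff_sub.
Qed.

(** The sites of [S] are released one at a time. The inequality [(x + y)^2 <= 2 x^2 + 2 y^2] and the
    [q] values of the released spin cost a factor [2 q] per site. Sums are unweighted, so the Gibbs
    weight can be brought in afterwards. *)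
Lemma crude_poincare_sum (S : {set V}) (g : conf -> R) (s : conf) :
  \sum_(t | eqoff S s t) (g t - g s) ^+ 2
   <= (2 * q%:R) ^+ #|S| * \sum_(j in S) \sum_(t | eqoff S s t) Gam j g t.
Proof.
have [n] := ubnP #|S|; elim: n S => // n IH S Sn.
have [->|/set0Pn[j jS]] := eqVneq S set0.
  rewrite big_set0 mulr0 (eq_bigl (pred1 s)) ?big_pred1_eq ?subrr ?expr0n //.
  by move=> t; rewrite eqoff0 eq_sym.
have q0 : (0 < q)%N by case: (q) (s j) => [[]|].
pose S' := S :\ j; have S'S : S' \subset S by apply: subsetDl.
have cS : #|S| = #|S'|.+1 by rewrite (cardsD1 j S) jS.
have jS' : j \notin S' by rewrite !inE eqxx.
have SE : S = j |: S' by rewrite setD1K.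
have {}IH : _ := IH S' ltac:(lia).
rewrite {1}SE sum_eqoffU1 //.
apply: (@le_trans _ _ (\sum_(t | eqoff S' s t)
   (2 * Gam j g t + 2 * q%:R * (g t - g s) ^+ 2))).
  apply: ler_sum => t _.
  apply: (@le_trans _ _ (\sum_(b : 'I_q) (2 * (g (upd t j b) - g t) ^+ 2 + 2 * (g t - g s) ^+ 2))).
    apply: ler_sum => b _.
    have := sqr_ge0 ((g (upd t j b) - g t) - (g t - g s)); nra.
  rewrite big_split /= -mulr_sumr sumr_const card_ord -[_ *+ q]mulr_natl.
  by rewrite mulrCA mulrA.
rewrite big_split /= -!mulr_sumr (big_setD1 j) //= -/S' mulrDr.
have qR : 1 <= q%:R :> R by rewrite ler1n.
have G0 i t : 0 <= Gam i g t by apply: Gam_ge0.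
apply: lerD.
  apply: ler_pM => //; first by apply: sumr_ge0.
    by rewrite cS exprS -[leLHS]mulr1 -mulrA ler_wpM2l // mulr_ege1 // exprn_ege1 //; lra.
  exact: sum_eqoff_subset.
rewrite cS exprS -[leRHS]mulrA ler_wpM2l //.
apply: (le_trans IH); rewrite ler_wpM2l ?exprn_ge0 //.
by apply: ler_sum => i _; apply: sum_eqoff_subset.
Qed.

Lemma eqoff_osc (S : {set V}) (f : conf -> R) s t : eqoff S s t ->
  `|f t - f s| <= \sum_(i in S) osc i f.
Proof.
have [n] := ubnP #|S|; elim: n S t => // n IH S t Sn st.
have [S0|/set0Pn[j jS]] := eqVneq S set0.
  by move: st; rewrite S0 eqoff0 => /eqP ->; rewrite subrr normr0 big_set0.
pose t' := upd t j (s j); rewrite (big_setD1 j) //=.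
have -> : f t - f s = (f (upd t' j (t j)) - f t') + (f t' - f s).
  by rewrite /t' upd_upd upd_id; ring.
apply: (le_trans (ler_normD _ _)); apply: lerD; first exact: le_osc.
apply: IH; first by rewrite (cardsD1 j S) jS in Sn; lia.
apply/eqoffP => v; rewrite !inE negb_and negbK updE.
by case: eqP => [->|_] //= vS; move/eqoffP: st; apply.
Qed.

Variable w : conf -> R.
Hypothesis w_gt0 : forall s, 0 < w s.
Local Notation E S := (cE w (eqoff S)).

Lemma E0 f s : E set0 f s = f s.
Proof.
apply: (cE_inv w_gt0 (eqoff_equiv _)) => t; by rewrite eqoff0 => /eqP ->.
Qed.

Lemma E_inv_mem S f s j b : j \in S -> E S f (upd s j b) = E S f s.
Proof. by move=> jS; apply/esym/(cE_class _ (eqoff_equiv S))/eqoff_upd. Qed.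

(** For [i] outside [S] this is, up to normalisation, the density of the conditional law inside [S]
    after the outer spin at [i] becomes [b], relative to the law before. *)
Definition flip_ratio i b (t : conf) : R := w (upd t i b) / w t.

Lemma flip_ratio_gt0 i b t : 0 < flip_ratio i b t.
Proof. exact: divr_gt0. Qed.

Lemma E_upd S f s i b : i \notin S ->
  E S f (upd s i b) =
  E S (fun t => flip_ratio i b t * f (upd t i b)) s / E S (flip_ratio i b) s.
Proof.
move=> iS.
have key F : \sum_(t | eqoff S (upd s i b) t) F t = \sum_(t | eqoff S s t) F (upd t i b) :> R.
  rewrite (reindex_onto (fun t => upd t i b) (fun t => upd t i (s i))) /=; last first.
    move=> t /eqoffP/(_ i iS); rewrite updE eqxx upd_upd => ->; by rewrite upd_id.
  apply: eq_bigl => t; rewrite upd_upd; apply/andP/eqoffP => [[/eqoffP h /eqP e] v vS|h].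
    rewrite -e updE; case: eqP => [->|/eqP vi] //.
    by move: (h v vS); rewrite !updE (negPf vi).
  split; first by apply/eqoffP => v /h; rewrite !updE => ->.
  apply/eqP/ffunP => v; rewrite updE; case: eqP => [->|//]; exact: h.
rewrite /cE !key.
have D0 : \sum_(t | eqoff S s t) w t != 0.
  by rewrite gt_eqF // (sim_weight_gt0 w_gt0 (eqoff_equiv S)).
have kE t : w t * flip_ratio i b t = w (upd t i b).
  by rewrite /flip_ratio mulrC divfK // gt_eqF.
rewrite [X in _ / X = _](eq_bigr (fun t => w t * flip_ratio i b t)); last by move=> *; rewrite kE.
rewrite invfM invrK mulrACA mulVf // mulr1; congr (_ / _).
by apply: eq_bigr => t _; rewrite mulrA kE.
Qed.

Lemma E_upd_neutral S f s i b : i \notin S ->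
  (forall t, eqoff S s t -> flip_ratio i b t = flip_ratio i b s) ->
  E S f (upd s i b) = E S (fun t => f (upd t i b)) s.
Proof.
move=> iS kc; rewrite E_upd // (cE_inv w_gt0 (eqoff_equiv S) kc).
rewrite cE_pull // mulrC mulKf // gt_eqF //.
exact: flip_ratio_gt0.
Qed.

(** * The density of an outer flip as a reverse martingale *)

Section Filtration.
Variables (S : {set V}) (L : nat) (T : nat -> {set V}) (i : V) (b : 'I_q) (s : conf).
Variable eps : nat -> R.
Hypotheses (iS : i \notin S) (T0 : T 0%N = set0) (TL : T L = S).
Hypothesis Tsub : forall r, (r < L)%N -> T r \subset T r.+1.
Let k := flip_ratio i b.
Let h t := k t / E S k s.
Hypothesis eps_ge0 : forall r, 0 <= eps r.
Hypothesis heps : forall r t, (r < L)%N -> eqoff S s t ->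
  `|E (T r) h t - E (T r.+1) h t| <= eps r.

Let eqv A : equivalence_rel (eqoff A). Proof. exact: eqoff_equiv. Qed.

Hypothesis TS : forall r, T r \subset S.

Lemma density_mean : E S h s = 1.
Proof.
rewrite /h (@cE_eq _ _ _ _ _ (fun t => (E S k s)^-1 * k t)); last by move=> *; rewrite mulrC.
rewrite cEZ mulVf // gt_eqF // (cE_gt0 w_gt0 (eqv S)) // => *.
exact: flip_ratio_gt0.
Qed.

Lemma density_ge0 t : 0 <= h t.
Proof.
rewrite divr_ge0 ?(cE_ge0 w_gt0 (eqv S)) // => [|? _]; exact/ltW/flip_ratio_gt0.
Qed.

Lemma E_upd_density f : E S f (upd s i b) = E S (fun t => h t * f (upd t i b)) s.
Proof.
rewrite E_upd // mulrC -cEZ; apply: cE_eq => t _.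
by rewrite /h mulrCA mulrA.
Qed.

(* The increments of the reverse martingale [r |-> E (T r) h] are orthogonal to
   every [psi r] that depends only on the spins outside [T r.+1]. *)
Lemma martingale_bound phi (psi : nat -> conf -> R) :
  (forall r t u, (r < L)%N -> eqoff (T r.+1) t u -> psi r u = psi r t) ->
  `|E S (fun t => (h t - 1) * phi t) s|
    <= \sum_(r < L) eps r * E S (fun t => `|phi t - psi r t|) s.
Proof.
move=> psi_inv.
have -> : E S (fun t => (h t - 1) * phi t) s =
  \sum_(r < L) E S (fun t => (E (T r) h t - E (T r.+1) h t) * (phi t - psi r t)) s.
  transitivity (\sum_(r < L) E S (fun t => (E (T r) h t - E (T r.+1) h t) * phi t) s).
    rewrite -(cE_sum w_gt0 (eqv S)); apply: cE_eq => t st; rewrite -mulr_suml; congr (_ * _).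
    under eq_bigr do rewrite -opprB.
    rewrite sumrN -(big_mkord xpredT (fun r => E (T r.+1) h t - E (T r) h t)).
    rewrite telescope_sumr // opprB T0 E0 TL; congr (_ - _).
    by rewrite -(cE_class _ (eqv S) _ st) density_mean.
  apply: eq_bigr => -[r rL] _ /=.
  pose D t := E (T r) h t - E (T r.+1) h t.
  have z : E S (fun t => D t * psi r t) s = 0.
    rewrite -(cE_tower w_gt0 (eqv (T r.+1)) (eqv S)); last exact: eqoff_sub.
    rewrite (@cE_eq _ _ _ _ _ (fun=> 0)) ?(cE_cst w_gt0 (eqv S)) // => t _.
    rewrite (@cE_eq _ _ _ _ _ (fun t => psi r t * D t)); last by move=> *; rewrite mulrC.
    rewrite cE_pull; last by move=> u; apply: psi_inv.
    rewrite cEB (cE_tower w_gt0 (eqv _) (eqv _)); last exact/eqoff_sub/Tsub.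
    rewrite (cE_inv w_gt0 (eqv _) (f := E (T r.+1) h)) ?subrr ?mulr0 // => u tu.
    by rewrite (cE_class _ (eqv _) _ tu).
  rewrite -[LHS]subr0 -z -cEB.
  by apply: cE_eq => t _; rewrite mulrBr.
apply: (le_trans (ler_norm_sum _ _ _)); apply: ler_sum => -[r rL] _ /=.
apply: (le_trans (cE_norm w_gt0 (eqv S) _ _)); rewrite -cEZ.
apply: (cE_le w_gt0 (eqv S)) => t st; rewrite normrM ler_wpM2r //; exact: heps.
Qed.

(** The change splits into [h] times the increment of [f] at [i], at most [osc i f] because [h] has
    mean 1, and [(h - 1) * f], to which the martingale bound applies with [psi r = E (T r.+1) f]. *)
Lemma E_upd_osc f :
  `|E S f (upd s i b) - E S f s|
    <= osc i f + \sum_(r < L) eps r * \sum_(j in T r.+1) osc j f.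
Proof.
rewrite E_upd_density.
have -> : E S (fun t => h t * f (upd t i b)) s - E S f s =
  E S (fun t => h t * (f (upd t i b) - f t)) s + E S (fun t => (h t - 1) * f t) s.
  rewrite -cEB -cED; apply: cE_eq => t _; ring.
apply: (le_trans (ler_normD _ _)); apply: lerD.
  apply: (le_trans (cE_norm w_gt0 (eqv S) _ _)).
  rewrite -[leRHS]mulr1 -density_mean -cEZ.
  apply: (cE_le w_gt0 (eqv S)) => t st; rewrite normrM ger0_norm ?density_ge0 //.
  by rewrite mulrC ler_wpM2r ?density_ge0 // le_osc.
apply: (le_trans (martingale_bound _ (psi := fun r => E (T r.+1) f) _)).
  by move=> r t u _ tu; rewrite (cE_class _ (eqv _) _ tu).
apply: ler_sum => r _; rewrite ler_wpM2l //.
rewrite -[leRHS](cE_cst w_gt0 (eqv S) _ s); apply: (cE_le w_gt0 (eqv S)) => t st.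
rewrite -{1}(cE_cst w_gt0 (eqv (T r.+1)) (f t) t) -cEB.
apply: (le_trans (cE_norm w_gt0 (eqv _) _ _)).
rewrite -[leRHS](cE_cst w_gt0 (eqv (T r.+1)) _ t); apply: (cE_le w_gt0 (eqv _)) => u tu.
by rewrite distrC eqoff_osc.
Qed.

Variables (M C : R) (g : conf -> R).
Hypothesis hM : forall t, eqoff S s t -> h t <= M.
Hypothesis gap : forall r, (r < L)%N ->
  E S (cVar w (eqoff (T r.+1)) g) s <= C * \sum_(j in T r.+1) E S (Gam j g) s.

Lemma sqr_sum_le (e x : nat -> R) n : (forall r, 0 <= e r) ->
  (\sum_(r < n) e r * x r) ^+ 2 <= (\sum_(r < n) e r) * \sum_(r < n) e r * x r ^+ 2.
Proof.
move=> e0; elim: n => [|n IH]; first by rewrite !big_ord0 expr0n mul0r.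
rewrite !big_ord_recr /=.
set A := \sum_(r < n) e r * x r in IH *; set P := \sum_(r < n) e r in IH *.
set Q := \sum_(r < n) _ in IH *.
have P0 : 0 <= P by apply: sumr_ge0.
have Q0 : 0 <= Q by apply: sumr_ge0 => r _; rewrite mulr_ge0 ?sqr_ge0.
have [P_eq0|PN0] := eqVneq P 0.
  have -> : A = 0 by apply/eqP; rewrite -sqrf_eq0 eq_le sqr_ge0 andbT (le_trans IH) // P_eq0 mul0r.
  rewrite P_eq0 !add0r exprMn expr2 mulrDr -mulrA lerDr; apply: mulr_ge0 => //.
have Pp : 0 < P by rewrite lt_def PN0.
suff : 2 * A * x n <= P * x n ^+ 2 + Q.
  rewrite -subr_ge0 => h2; rewrite -subr_ge0.
  have -> : (P + e n) * (Q + e n * x n ^+ 2) - (A + e n * x n) ^+ 2 =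
    (P * Q - A ^+ 2) + e n * (P * x n ^+ 2 + Q - 2 * A * x n) by ring.
  by rewrite addr_ge0 ?mulr_ge0 // subr_ge0.
rewrite -(ler_pM2l Pp) mulrDr; have := sqr_ge0 (P * x n - A); nra.
Qed.

(** Two moves through [A' = E (h g^2)]. Flipping inside [g] is the reverse triangle inequality for
    [sqrt h * g] and costs [M]. Removing [h] is the martingale bound with
    [psi r = (E (T r.+1) g)^2]: by [g^2 - m^2 = (g - m) (g + m)] each term costs
    [2 eps r * sqrt (v r) * sqrt B], and dividing by [sqrt A' + sqrt B >= sqrt B] leaves only the
    variances [v r]. *)
Lemma E_upd_sqrt :
  (Num.sqrt (E S (fun t => g t ^+ 2) (upd s i b)) - Num.sqrt (E S (fun t => g t ^+ 2) s)) ^+ 2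
   <= 2 * M * E S (Gam i g) s
      + 8 * (\sum_(r < L) eps r) * C * \sum_(r < L) eps r * \sum_(j in T r.+1) E S (Gam j g) s.
Proof.
rewrite E_upd_density.
pose rh t := Num.sqrt (h t).
have rhE t : rh t ^+ 2 = h t by rewrite sqr_sqrtr // density_ge0.
set A := E S (fun t => h t * _) s; set B := E S (fun t => g t ^+ 2) s.
pose A' := E S (fun t => h t * g t ^+ 2) s.
have AE : A = E S (fun t => (rh t * g (upd t i b)) ^+ 2) s.
  by apply: cE_eq => t _; rewrite exprMn rhE.
have A'E : A' = E S (fun t => (rh t * g t) ^+ 2) s.
  by apply: cE_eq => t _; rewrite exprMn rhE.
have first_part : (Num.sqrt A - Num.sqrt A') ^+ 2 <= M * E S (Gam i g) s.
  rewrite AE A'E; apply: (le_trans (cE_sqrt_dist w_gt0 (eqv S) _ _ _)).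
  rewrite -cEZ; apply: (cE_le w_gt0 (eqv S)) => t st.
  rewrite -mulrBr exprMn rhE ler_pM ?density_ge0 ?sqr_ge0 ?hM //.
  rewrite /Gam (bigD1 b) //= lerDl sumr_ge0 // => c _; exact: sqr_ge0.
have B0 : 0 <= B by apply: (cE_ge0 w_gt0 (eqv S)) => t _; rewrite sqr_ge0.
have A'0 : 0 <= A'.
  by apply: (cE_ge0 w_gt0 (eqv S)) => t _; rewrite mulr_ge0 ?density_ge0 ?sqr_ge0.
pose v r := E S (cVar w (eqoff (T r.+1)) g) s.
have v0 r : 0 <= v r.
  by apply: (cE_ge0 w_gt0 (eqv S)) => t _; apply: (cVar_ge0 w_gt0 (eqv _)).
have AB : `|A' - B| <= (2 * \sum_(r < L) eps r * Num.sqrt (v r)) * Num.sqrt B.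
  have -> : A' - B = E S (fun t => (h t - 1) * g t ^+ 2) s.
    rewrite -cEB; apply: cE_eq => t _; ring.
  apply: (le_trans (martingale_bound _ (psi := fun r t => E (T r.+1) g t ^+ 2) _)).
    by move=> r t u _ tu; rewrite (cE_class _ (eqv _) _ tu).
  rewrite mulrAC mulr_sumr; apply: ler_sum => r _.
  rewrite [leRHS]mulrCA ler_wpM2l //.
  pose m := E (T r.+1) g.
  rewrite (@cE_eq _ _ _ _ _ (fun t => `|g t - m t| * `|g t + m t|)); last first.
    by move=> t _; rewrite -normrM -subr_sqr.
  apply: (le_trans (ler_norm _)).
  apply: (le_trans (cE_cauchy_sqrt w_gt0 (eqv S) _ _ _)).
  have -> : E S (fun t => `|g t - m t| ^+ 2) s = v r.
    rewrite /v -(cE_tower w_gt0 (eqv (T r.+1)) (eqv S)); last exact: eqoff_sub.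
    apply: cE_eq => t _; rewrite (cVarE w_gt0 (eqv _)); apply: cE_eq => u tu.
    by rewrite /m (cE_class _ (eqv _) _ tu) -normrX ger0_norm // sqr_ge0.
  rewrite mulrC ler_wpM2r ?sqrtr_ge0 //.
  have -> : 2 * Num.sqrt B = Num.sqrt (4 * B).
    have s4 : Num.sqrt (4 : R) = 2.
      have -> : (4 : R) = 2 ^+ 2 by ring.
      by rewrite sqrtr_sqr ger0_norm.
    by rewrite [RHS]sqrtrM // s4.
  rewrite ler_wsqrtr //.
  apply: (@le_trans _ _ (E S (fun t => 2 * g t ^+ 2 + 2 * m t ^+ 2) s)).
    apply: (cE_le w_gt0 (eqv S)) => t _; rewrite -normrX ger0_norm ?sqr_ge0 //.
    have := sqr_ge0 (g t - m t); rewrite sqrrB sqrrD; lra.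
  rewrite cED !cEZ -/B.
  suff : E S (fun t => m t ^+ 2) s <= B by lra.
  rewrite /B -(cE_tower w_gt0 (eqv (T r.+1)) (eqv S) (fun t => g t ^+ 2)); last exact: eqoff_sub.
  apply: (cE_le w_gt0 (eqv S)) => t _; rewrite -subr_ge0; exact: (cVar_ge0 w_gt0 (eqv _)).
have second_part : (Num.sqrt A' - Num.sqrt B) ^+ 2 <= (2 * \sum_(r < L) eps r * Num.sqrt (v r)) ^+ 2.
  set K := 2 * _ in AB *.
  have K0 : 0 <= K by rewrite mulr_ge0 // sumr_ge0 // => r _; rewrite mulr_ge0 ?sqrtr_ge0.
  rewrite -ler_sqrt ?sqr_ge0 // !sqrtr_sqr (ger0_norm K0).
  have [B_eq0|BN0] := eqVneq B 0.
    move: AB; rewrite B_eq0 sqrtr0 mulr0 !subr0 normr_le0 => /eqP ->.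
    by rewrite sqrtr0 normr0.
  have sB : 0 < Num.sqrt B by rewrite sqrtr_gt0 lt_def BN0.
  rewrite -(ler_pM2r sB); apply: le_trans AB.
  rewrite -{2}(sqr_sqrtr A'0) -{3}(sqr_sqrtr B0) subr_sqr normrM ler_wpM2l //.
  by rewrite ger0_norm ?lerDr ?sqrtr_ge0 // addr_ge0 ?sqrtr_ge0.
have third : (2 * \sum_(r < L) eps r * Num.sqrt (v r)) ^+ 2 <=
   4 * (\sum_(r < L) eps r) * C * \sum_(r < L) eps r * \sum_(j in T r.+1) E S (Gam j g) s.
  rewrite exprMn (_ : (2 : R) ^+ 2 = 4); last by ring.
  rewrite -!mulrA ler_wpM2l //.
  apply: (le_trans (sqr_sum_le (fun r => Num.sqrt (v r)) _ eps_ge0)).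
  apply: ler_wpM2l; first exact: sumr_ge0.
  rewrite mulr_sumr; apply: ler_sum => r _; rewrite sqr_sqrtr // [leRHS]mulrCA.
  by rewrite ler_wpM2l // gap.
have -> : Num.sqrt A - Num.sqrt B = (Num.sqrt A - Num.sqrt A') + (Num.sqrt A' - Num.sqrt B) by ring.
have h2 := le_trans second_part third.
have sq2 (x y : R) : (x + y) ^+ 2 <= 2 * x ^+ 2 + 2 * y ^+ 2.
  have := sqr_ge0 (x - y); rewrite sqrrB sqrrD; lra.
apply: (le_trans (sq2 _ _)); apply: lerD; first by rewrite -mulrA ler_wpM2l.
have -> : (8 : R) = 2 * 4 by ring.
by rewrite -!(mulrA 2) ler_wpM2l.
Qed.

End Filtration.
End Spins.

(** * The Potts Hamiltonian on a cube *)

Section Geometry.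
Variables (d l : nat).
Implicit Types (v w : vertex d l).

Definition adj v w : bool := vdist v w == 1%N.

Lemma vdistE v w : vdist v w = (\sum_i ((v i - w i) + (w i - v i)))%N.
Proof. by apply: eq_bigr => i _; rewrite !ffunE; lia. Qed.

Lemma adj_sym v w : adj v w = adj w v.
Proof. by rewrite /adj !vdistE; congr (_ == _); apply: eq_bigr => i _; rewrite addnC. Qed.

Lemma adj_irr v : adj v v = false.
Proof. by rewrite /adj vdistE big1 // => i _; lia. Qed.

Lemma adj_coord v w : adj v w -> exists k : 'I_d,
  ((v k = w k + 1 :> nat) \/ (w k = v k + 1 :> nat))%N /\ forall m, m != k -> v m = w m.
Proof.
rewrite /adj vdistE => /eqP h.
have [/existsP[k hk]|/existsPn none] := boolP [exists k, v k != w k]; last first.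
  by move: h; rewrite big1 // => i _; have /negPn/eqP -> := none i; lia.
exists k; move: h; rewrite (bigD1 k) //=; set S := \sum_(i | _) _ => h.
have vk : (v k : nat) <> w k by move=> e; case/eqP: hk; apply: val_inj.
have S0 : S = 0%N by lia.
split; first by lia.
move=> m mk; move: S0; rewrite /S (bigD1 m) //= => h0; apply: val_inj => /=; lia.
Qed.

Lemma adj_near v w k : adj v w -> (v k <= w k + 1)%N /\ (w k <= v k + 1)%N.
Proof.
move=> /adj_coord[m [hm h]]; have [->|/h ->] := eqVneq k m; lia.
Qed.

Lemma vdist_tri u v w : (vdist u w <= vdist u v + vdist v w)%N.
Proof. by rewrite !vdistE -big_split leq_sum //= => i _; lia. Qed.

Lemma vdist_ge_coord v w k : (v k - w k <= vdist v w)%N /\ (w k - v k <= vdist v w)%N.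
Proof. by rewrite vdistE (bigD1 k) //=; lia. Qed.

Lemma card_box v (r : nat) :
  (#|[set w : vertex d l | [forall k, (v k <= w k + r) && (w k <= v k + r)]]|
   <= (2 * r + 1) ^ d)%N.
Proof.
have <- : #|{ffun 'I_d -> 'I_(2 * r + 1)}| = ((2 * r + 1) ^ d)%N.
  by rewrite card_ffun !card_ord.
(* The reduction modulo [2 r + 1] only makes [F] total; it is the identity on the box. *)
have lt0 (w : vertex d l) k : ((w k + r - v k) %% (2 * r + 1) < 2 * r + 1)%N by rewrite ltn_mod; lia.
pose F (w : vertex d l) : {ffun 'I_d -> 'I_(2 * r + 1)} := [ffun k => Ordinal (lt0 w k)].
rewrite -(card_in_imset (f := F)); first exact: max_card.
move=> w w'; rewrite !inE => /forallP h /forallP h' /ffunP e; apply/ffunP => k.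
apply: val_inj => /=; have := congr1 val (e k); rewrite !ffunE /=.
have /andP[? ?] := h k; have /andP[? ?] := h' k.
rewrite !modn_small; lia.
Qed.

(** Neighbours lie in the box of radius 1; this is the origin of the [3 ^ d] that stands for the
    degree in all later constants. *)
Lemma card_adj v : (#|[set w | adj v w]| <= 3 ^ d)%N.
Proof.
apply: leq_trans (card_box v 1); apply: subset_leq_card; apply/subsetP => w; rewrite !inE => vw.
by apply/forallP => k; have [? ?] := adj_near k vw; apply/andP; split.
Qed.

Lemma is_edgeP (e : {set vertex d l}) :
  reflect (exists v w, adj v w /\ e = [set v; w]) (is_edge e).
Proof.
apply: (iffP existsP) => [[v /existsP[w /andP[vw /eqP ->]]]|[v [w [vw ->]]]].
  by exists v, w.
by exists v; apply/existsP; exists w; rewrite eqxx andbT.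
Qed.

Lemma set2_eq (a b v w : vertex d l) : a != b ->
  ([set v; w] == [set a; b]) = ((v == a) && (w == b)) || ((v == b) && (w == a)).
Proof.
move=> ab; apply/eqP/orP => [e|[]/andP[/eqP-> /eqP->] //]; last by rewrite setUC.
have va : v \in [set a; b] by rewrite -e !inE eqxx.
have wa : w \in [set a; b] by rewrite -e !inE eqxx orbT.
have av : a \in [set v; w] by rewrite e !inE eqxx.
have bv : b \in [set v; w] by rewrite e !inE eqxx orbT.
move: va wa av bv; rewrite !inE => /orP[]/eqP -> /orP[]/eqP ->; rewrite ?eqxx ?orbb /=; auto.
  by move=> _ /eqP ba; rewrite ba eqxx in ab.
by move=> /eqP ba; rewrite ba eqxx in ab.
Qed.

Lemma sum_pairs_edges (P : rel (vertex d l)) : symmetric P ->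
  (\sum_v \sum_w (adj v w && P v w) =
   2 * \sum_(e : edge d l) [exists v in val e, exists w in val e, adj v w && P v w])%N.
Proof.
move=> Psym; rewrite pair_big /=.
transitivity (\sum_(p : vertex d l * vertex d l) \sum_(e : edge d l | val e == [set p.1; p.2])
    (adj p.1 p.2 && P p.1 p.2))%N.
  apply: eq_bigr => -[v w] _ /=; case: (boolP (adj v w)) => [vw|_] /=; last by rewrite big1.
  have ew : is_edge [set v; w] by apply/is_edgeP; exists v, w.
  pose e0 : edge d l := exist (fun e : {set vertex d l} => is_edge e) _ ew.
  have e0E (e : edge d l) : (val e == [set v; w]) = (e == e0) by exact: (val_eqE e e0).
  by rewrite (big_pred1 e0).
rewrite (exchange_big_dep xpredT) //= big_distrr /=; apply: eq_bigr => -[e ee] _ /=.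
have /is_edgeP[a [b [ab eE]]] := ee.
have abN : a != b by apply: contraTneq ab => ->; rewrite adj_irr.
have -> : [exists v in e, exists w in e, adj v w && P v w] = P a b.
  apply/idP/idP => [/existsP[v /andP[ve /existsP[w /andP[we /andP[vw Pvw]]]]]|Pab].
    have : [set v; w] == [set a; b].
      have vwN : v != w by apply: contraTneq vw => ->; rewrite adj_irr.
      rewrite eqEcard !cards2 abN vwN andbT subUset !sub1set -eE ve we //.
    rewrite set2_eq // => /orP[]/andP[/eqP e1 /eqP e2]; first by rewrite -e1 -e2.
    by rewrite Psym -e1 -e2.
  apply/existsP; exists a; rewrite eE !inE eqxx /=; apply/existsP; exists b.
  by rewrite !inE eqxx orbT ab Pab.
rewrite (bigD1 (a, b)) /=; last by rewrite eE.
rewrite (bigD1 (b, a)) /=; last first.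
  by rewrite eE setUC eqxx xpair_eqE eq_sym (negPf abN).
rewrite big1 => [|[v w] /=]; last first.
  rewrite eE eq_sym set2_eq // !xpair_eqE => /andP[/andP[]].
  by move=> /orP[] -> //=; rewrite ?andbF.
by rewrite ab adj_sym ab Psym; lia.
Qed.

Lemma card_edge : (#|{: edge d l}| <= 3 ^ d * #|{: vertex d l}|)%N.
Proof.
have h := @sum_pairs_edges (fun _ _ => true) (fun _ _ => erefl).
have e1 : (\sum_(e : edge d l) [exists v in val e, exists w in val e, adj v w && true]
   = #|{: edge d l}|)%N.
  rewrite -sum1_card; apply: eq_bigr => -[e ee] _ /=.
  have /is_edgeP[a [b [ab ->]]] := ee.
  suff -> : [exists v in [set a; b], exists w in [set a; b], adj v w && true] by [].
  apply/existsP; exists a; rewrite !inE eqxx; apply/existsP; exists b.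
  by rewrite !inE eqxx orbT ab.
have : (\sum_v \sum_w (adj v w && true) <= \sum_(v : vertex d l) 3 ^ d)%N.
  apply: leq_sum => v _; apply: leq_trans (card_adj v); rewrite -sum1_card.
  rewrite [leqRHS]big_mkcond /=; apply: leq_sum => w _; rewrite inE andbT.
  by case: (adj v w).
have -> : (\sum_(v : vertex d l) 3 ^ d = #|{: vertex d l}| * 3 ^ d)%N by rewrite sum_nat_const.
rewrite h e1; lia.
Qed.

Variables (q : nat).

(** Ordered pairs of vertices instead of edges: each disagreement counts twice, which [gw] corrects
    by [beta / 2]. *)
Definition ham (s : spins d l q) : nat := (\sum_v \sum_w (adj v w && (s v != s w)))%N.

Lemma ham_disagree (s : spins d l q) : ham s = (2 * #|disagree s|)%N.
Proof.
rewrite /ham (sum_pairs_edges (P := fun v w => s v != s w)); last by move=> v w; rewrite eq_sym.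
congr (2 * _)%N; rewrite -sum1_card [RHS]big_mkcond /=; apply: eq_bigr => -[e ee] _.
rewrite inE /=; have /is_edgeP[a [b [ab eE]]] := ee.
case: ifP => [/existsP[v /andP[ve /existsP[w /andP[we svw]]]]|/negbT/existsPn h].
  suff -> : [exists v in e, exists w in e, adj v w && (s v != s w)] by [].
  apply/existsP; exists v; rewrite ve; apply/existsP; exists w; rewrite we svw andbT /=.
  move: ve we svw; rewrite eE !inE => /orP[]/eqP -> /orP[]/eqP ->; rewrite ?eqxx //.
  by rewrite adj_sym.
suff -> : [exists v in e, exists w in e, adj v w && (s v != s w)] = false by [].
apply/negbTE/existsPn => v; apply: contra (h v) => /andP[-> /existsP[w /andP[we /andP[_ svw]]]].
by apply/existsP; exists w; rewrite we.
Qed.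

End Geometry.

(** * Locality and boundedness of a spin flip *)

Section PottsWeight.
Variables (R : realType) (d l q : nat) (beta : R).
Hypothesis beta_gt0 : 0 < beta.
Local Notation conf := (spins d l q).
Implicit Types (s t : conf) (i : vertex d l) (b : 'I_q).

Definition gw (s : conf) : R := expR (- (beta / 2) * (ham s)%:R).

Lemma gw_gt0 s : 0 < gw s. Proof. exact: expR_gt0. Qed.

Lemma gwE s : gw s = expR (- beta * #|disagree s|%:R).
Proof. by rewrite /gw ham_disagree natrM; congr expR; field. Qed.

(** The terms that a flip at [i] can change. The others cancel in the flip ratio, which is therefore
    local. *)
Definition ham_at (i : vertex d l) (s : conf) : nat :=
  (\sum_v \sum_w [&& adj v w, (v == i) || (w == i) & s v != s w])%N.

Definition ham_off (i : vertex d l) (s : conf) : nat :=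
  (\sum_v \sum_w [&& adj v w, ~~ ((v == i) || (w == i)) & s v != s w])%N.

Lemma ham_split i s : ham s = (ham_at i s + ham_off i s)%N.
Proof.
rewrite /ham -big_split; apply: eq_bigr => v _; rewrite -big_split; apply: eq_bigr => w _ /=.
by case: (adj v w); case: (_ || _); case: (s v != s w).
Qed.

Lemma ham_off_upd i b s : ham_off i (upd s i b) = ham_off i s.
Proof.
apply: eq_bigr => v _; apply: eq_bigr => w _; rewrite !updE.
by case: (v == i); case: (w == i); rewrite //= !andbF.
Qed.

Lemma flip_ratioE i b s : flip_ratio gw i b s =
  expR (- (beta / 2) * (ham_at i (upd s i b))%:R + (beta / 2) * (ham_at i s)%:R).
Proof.
rewrite /flip_ratio /gw -expRB !(ham_split i) ham_off_upd !natrD; congr expR; ring.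
Qed.

Lemma ham_at_local i s t : s i = t i -> (forall v, adj i v -> s v = t v) ->
  ham_at i s = ham_at i t.
Proof.
move=> si sv; apply: eq_bigr => v _; apply: eq_bigr => w _.
case: (boolP (adj v w)) => vw //=.
have [e|_] := eqVneq v i; first by rewrite -e in si sv *; rewrite si sv.
have [e|//] := eqVneq w i.
by rewrite -e in si sv *; rewrite si sv // adj_sym.
Qed.

Lemma flip_ratio_local i b s t : s i = t i -> (forall v, adj i v -> s v = t v) ->
  flip_ratio gw i b s = flip_ratio gw i b t.
Proof.
move=> si sv; rewrite !flip_ratioE (@ham_at_local _ s t) // (@ham_at_local _ _ (upd t i b)) //.
  by rewrite !updE eqxx.
by move=> v iv; rewrite !updE; case: eqP => // _; apply: sv.
Qed.

Lemma ham_at_le i s : (ham_at i s <= 2 * 3 ^ d)%N.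
Proof.
apply: (@leq_trans (\sum_v \sum_w ((adj i w) && (v == i) + (adj i v) && (w == i)))%N).
  apply: leq_sum => v _; apply: leq_sum => w _; case: (boolP (adj v w)) => vw //=.
  have [<-|_] := eqVneq v i; first by rewrite vw /=; case: (_ != _).
  have [<-|_] := eqVneq w i; rewrite ?andbF // adj_sym vw.
  by case: (_ != _); rewrite ?addn1.
have e (u : vertex d l -> bool) : (\sum_w (u w : nat) = #|[set w | u w]|)%N.
  by rewrite -sum1_card [RHS]big_mkcond /=; apply: eq_bigr => w _; rewrite inE; case: (u w).
have -> : (\sum_v \sum_w ((adj i w) && (v == i) + (adj i v) && (w == i)))%N =
  (\sum_v \sum_w ((adj i w) && (v == i)) + \sum_v \sum_w ((adj i v) && (w == i)))%N.
  by rewrite -big_split; apply: eq_bigr => v _; rewrite -big_split.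
rewrite mul2n -addnn leq_add //.
  rewrite (bigD1 i) //= [X in (_ + X)%N]big1 ?addn0; last first.
    by move=> v /negPf vi; rewrite big1 // => w _; rewrite vi andbF.
  by under eq_bigr do rewrite eqxx andbT; rewrite e card_adj.
apply: leq_trans (card_adj i); rewrite -e leq_sum // => v _.
rewrite (bigD1 i) //= big1 ?addn0; first by rewrite eqxx andbT.
by move=> w /negPf ->; rewrite andbF.
Qed.

(** [ham_at] is at most [2 * 3 ^ d] and enters with the factor [beta / 2]. *)
Definition flip_bound : R := expR (beta * (3 ^ d)%:R).

Lemma flip_bound_ge1 : 1 <= flip_bound.
Proof. by rewrite -expR0 ler_expR mulr_ge0 // ltW. Qed.

Lemma flip_ratio_le i b s : flip_ratio gw i b s <= flip_bound.
Proof.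
rewrite flip_ratioE ler_expR.
have h : (ham_at i s)%:R <= 2 * (3 ^ d)%:R :> R by rewrite -natrM ler_nat ham_at_le.
have h0 : 0 <= (ham_at i (upd s i b))%:R :> R by [].
have b2 : 0 <= beta / 2 by rewrite divr_ge0 // ltW.
have := ler_wpM2l b2 h; have := mulr_ge0 b2 h0; lra.
Qed.

Lemma flip_ratio_ge i b s : flip_bound^-1 <= flip_ratio gw i b s.
Proof.
have h : flip_ratio gw i b s = (flip_ratio gw i (s i) (upd s i b))^-1.
  by rewrite /flip_ratio upd_upd upd_id invfM invrK mulrC.
by rewrite h lef_pV2 ?posrE ?flip_ratio_le ?flip_ratio_gt0 ?expR_gt0 //; exact: gw_gt0.
Qed.

End PottsWeight.

(** * Spatial mixing as a bound on conditional expectations *)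

Section Cubes.
Variables (d l : nat).
Local Notation corner := ('I_d -> nat).

Definition cube (x : corner) (s : nat) : {set vertex d l} :=
  [set v : vertex d l | [forall k, (x k <= v k <= x k + s)%N]].

Lemma in_cube x s (v : vertex d l) :
  reflect (forall k, x k <= v k <= x k + s)%N (v \in cube x s).
Proof. by rewrite inE; apply: forallP. Qed.

(* The free region [T] of the cube [x + [0,s]^d]: the remaining vertices of the
   cube, which carry the boundary condition, lie on its internal boundary. *)
Record region (x : corner) (s : nat) (T : {set vertex d l}) : Prop := Region {
  region_fits : forall k, (x k + s <= l)%N;
  region_sub : T \subset cube x s;
  region_nbr : forall v w : vertex d l, v \in T -> adj v w -> w \in cube x s;
  region_int : forall v : vertex d l, (forall k, x k < v k < x k + s)%N -> v \in T }.

(** The free boundary condition is the case of a region with nothing frozen. *)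
Lemma region_full : region (fun=> 0%N) l [set: vertex d l].
Proof.
have full v : v \in cube (fun=> 0%N) l by apply/in_cube => k; rewrite leq0n add0n -ltnS ltn_ord.
split=> [k|||v _]; rewrite ?inE //; by apply/subsetP => v _; apply: full.
Qed.

Lemma region_card x s T : region x s T -> (#|T| <= (2 * s + 1) ^ d)%N.
Proof.
move=> [fit sub _ _]; have [->|[v vT]] := set_0Vmem T; first by rewrite cards0.
apply: leq_trans (card_box v s); apply: subset_leq_card; apply/subsetP => w wT.
have /in_cube hv := subsetP sub _ vT; have /in_cube hw := subsetP sub _ wT.
by rewrite inE; apply/forallP => k; have := hv k; have := hw k; lia.
Qed.

Definition nearby (m : nat) (i j : vertex d l) : bool :=
  [forall k, (i k <= j k + m) && (j k <= i k + m)]%N.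

End Cubes.

(** * Conditioning on a region as a Potts measure on a smaller cube *)

Section Transfer.
Variables (R : realType) (d l q : nat) (beta a b : R).
Hypotheses (beta_gt0 : 0 < beta).
Local Notation conf := (spins d l q).
Local Notation corner := ('I_d -> nat).
Local Notation E S := (cE (@gw R d l q beta) (eqoff S)).
Variables (x : corner) (s : nat) (T : {set vertex d l}).
Hypothesis rT : region x s T.

Let fits k (u : vertex d s) : (x k + u k < l.+1)%N.
Proof. have := region_fits rT k; have := ltn_ord (u k); lia. Qed.

Definition emb (u : vertex d s) : vertex d l := [ffun k => Ordinal (fits k u)].
Definition proj (v : vertex d l) : vertex d s := [ffun k => inord (v k - x k)].

Lemma embE u k : emb u k = (x k + u k)%N :> nat.
Proof. by rewrite ffunE. Qed.

Lemma emb_cube u : emb u \in cube l x s.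
Proof. by apply/in_cube => k; rewrite embE; have := ltn_ord (u k); lia. Qed.

Lemma embK : cancel emb proj.
Proof.
move=> u; apply/ffunP => k; apply: val_inj; rewrite ffunE /= embE addKn.
by rewrite inordK.
Qed.

Lemma projK : {in cube l x s, cancel proj emb}.
Proof.
move=> v /in_cube h; apply/ffunP => k; apply: val_inj; rewrite /= embE ffunE inordK; have := h k; lia.
Qed.

Lemma vdist_emb u u' : vdist (emb u) (emb u') = vdist u u'.
Proof. by rewrite !vdistE; apply: eq_bigr => k _; rewrite !embE; lia. Qed.

Definition res (t : conf) : spins d s q := [ffun u => t (emb u)].
Definition glue (sg : conf) (t : spins d s q) : conf :=
  [ffun v => if v \in T then t (proj v) else sg v].
Definition bc (sg : conf) : partial_spins d s q :=
  [ffun u => if emb u \in T then None else Some (sg (emb u))].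

Lemma res_glue sg t : agrees (bc sg) t -> res (glue sg t) = t.
Proof.
move=> /forallP h; apply/ffunP => u; rewrite !ffunE embK; case: ifP => // /negbT eT.
have := h u; rewrite inE ffunE (negPf eT) /= => /eqP; by case.
Qed.

Lemma glue_eqoff sg t : eqoff T sg (glue sg t).
Proof. by apply/eqoffP => v vT; rewrite ffunE (negPf vT). Qed.

Lemma glue_res sg t : eqoff T sg t -> glue sg (res t) = t.
Proof.
move=> /eqoffP h; apply/ffunP => v; rewrite ffunE; case: ifP => [vT|/negbT /h //].
by rewrite ffunE projK // (subsetP (region_sub rT)).
Qed.

Lemma agrees_res sg t : eqoff T sg t -> agrees (bc sg) (res t).
Proof.
move=> /eqoffP h; apply/forallP => u; apply/implyP; rewrite inE !ffunE.
by case: ifP => // /negbT /h ->.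
Qed.

Definition ham_out (sg : conf) : nat :=
  (\sum_v \sum_w [&& adj v w, ~~ ((v \in cube l x s) && (w \in cube l x s)) & sg v != sg w])%N.

Lemma sum_cube (F : vertex d l -> nat) :
  (\sum_(v in cube l x s) F v = \sum_(u : vertex d s) F (emb u))%N.
Proof.
rewrite (reindex_onto emb proj) /=; last by move=> v /projK.
by apply: eq_bigl => u; rewrite emb_cube embK eqxx.
Qed.

Lemma ham_res t : ham t = (ham (res t) + ham_out t)%N.
Proof.
have -> : ham (res t) = (\sum_v \sum_w [&& adj v w, (v \in cube l x s) && (w \in cube l x s) & t v != t w])%N.
  rewrite [RHS](bigID (mem (cube l x s))) /= [X in (_ + X)%N]big1 ?addn0; last first.
    by move=> v /negPf vC; rewrite big1 // => w _; rewrite vC /= andbF.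
  rewrite sum_cube; apply: eq_bigr => u _.
  rewrite (bigID (mem (cube l x s))) /= [X in (_ + X)%N]big1 ?addn0; last first.
    by move=> w /negPf wC; rewrite wC !andbF.
  rewrite sum_cube; apply: eq_bigr => u' _.
  by rewrite !emb_cube /adj vdist_emb !ffunE.
rewrite -big_split; apply: eq_bigr => v _; rewrite -big_split; apply: eq_bigr => w _ /=.
by case: ((v \in cube l x s) && (w \in cube l x s)); case: (adj v w); case: (t v != t w).
Qed.

(** All neighbours of a vertex of [T] stay in the cube, so an adjacent pair that is not inside the
    cube has both ends frozen. *)
Lemma ham_out_eqoff sg t : eqoff T sg t -> ham_out t = ham_out sg.
Proof.
move=> /eqoffP h; apply: eq_bigr => v _; apply: eq_bigr => w _.
case: (boolP (adj v w)) => //= vw; case: (boolP ((v \in cube l x s) && (w \in cube l x s))) => //= nC.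
have sub := subsetP (region_sub rT).
have vT : v \notin T.
  by apply: contra nC => vT; rewrite sub //= (region_nbr rT vT).
have wT : w \notin T.
  by apply: contra nC => wT; rewrite (sub w) //= (region_nbr rT wT) // adj_sym.
by rewrite !h.
Qed.

Lemma sum_eqoff_potts sg (F : conf -> R) :
  \sum_(t | eqoff T sg t) gw beta t * F t =
  expR (- (beta / 2) * (ham_out sg)%:R) *
   \sum_(t : spins d s q) potts_weight beta (bc sg) t * F (glue sg t).
Proof.
rewrite mulr_sumr [RHS](bigID (agrees (bc sg))) /= [X in _ + X]big1 ?addr0; last first.
  by move=> t nt; rewrite /potts_weight (negPf nt) mul0r mulr0.
rewrite (reindex_onto (glue sg) res) /=; last by move=> t; apply: glue_res.
apply: eq_big => [t|t /andP[h /eqP e]].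
  apply/andP/idP => [[h /eqP <-]|ag]; first exact: agrees_res.
  by rewrite glue_eqoff res_glue ?eqxx.
have ag : agrees (bc sg) t by rewrite -e agrees_res.
rewrite /potts_weight ag mulrA; congr (_ * _).
rewrite {1}/gw ham_res res_glue // (ham_out_eqoff (glue_eqoff sg t)) natrD mulrDr expRD mulrC.
by congr (_ * _); rewrite -/(gw beta t) gwE.
Qed.

Lemma E_potts sg F : E T F sg = \sum_t potts beta (bc sg) t * F (glue sg t).
Proof.
rewrite /cE sum_eqoff_potts.
have -> : \sum_(t | eqoff T sg t) gw beta t = expR (- (beta / 2) * (ham_out sg)%:R) *
   \sum_(t : spins d s q) potts_weight beta (bc sg) t.
  transitivity (\sum_(t | eqoff T sg t) gw beta t * 1); first by apply: eq_bigr => *; rewrite mulr1.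
  rewrite (sum_eqoff_potts sg (fun=> 1)); congr (_ * _).
  by apply: eq_bigr => *; rewrite mulr1.
rewrite -mulf_div divff ?gt_eqF ?expR_gt0 // mul1r mulr_suml.
by apply: eq_bigr => t _; rewrite /potts mulrAC.
Qed.

(** By [region_int] a frozen vertex is not strictly inside the cube, so one of its coordinates is
    extreme and a step in that direction leaves the cube. *)
Lemma bc_bdry sg : is_bc (bc sg).
Proof.
apply/subsetP => v; rewrite inE ffunE; case: ifP => // /negbT eT _.
rewrite inE; apply/asboolP.
have : ~ forall k, (x k < emb v k < x k + s)%N by move=> /(region_int rT); apply/negP.
move=> /existsNP[k] /negP; rewrite embE => hk.
have bdry y : ~~ (x k < x k + y < x k + s)%N -> (y < s.+1)%N -> y = 0%N \/ y = s by lia.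
have {bdry} hk := bdry _ hk (ltn_ord _).
(* The coordinate just beyond the face: below 0 or above [s]. *)
pose z : int := if v k == 0%N :> nat then -1 else (s.+1)%:Z.
exists [ffun m => if m == k then z else to_site v m]; split.
  rewrite /l1dist (bigD1 k) //= big1 ?addn0 => [|m /negPf mk].
    rewrite !ffunE eqxx /z; case: hk => ->; case: eqP => //; lia.
  by rewrite !ffunE mk; lia.
move=> w /ffunP/(_ k); rewrite !ffunE eqxx /z; have := ltn_ord (w k); case: ifP; lia.
Qed.

Hypothesis mixing : spatial_mixing d s q beta a b.

Lemma sum_marginal (B : {set vertex d s}) (mu mu' f : spins d s q -> R) (M : R) : 0 <= M ->
  (forall t t' : spins d s q, (forall u, u \in B -> t u = t' u) -> f t = f t') -> (forall t, `|f t| <= M) ->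
  `|\sum_t mu t * f t - \sum_t mu' t * f t| <=
   2 * M * tv_dist (marginal mu (B := B)) (marginal mu' (B := B)).
Proof.
move=> M0 floc fM; rewrite -sumrB.
pose rs (t : spins d s q) : {ffun {v | v \in B} -> 'I_q} := [ffun v => t (val v)].
rewrite (partition_big rs xpredT) //=.
have -> : 2 * M * tv_dist (marginal mu (B := B)) (marginal mu' (B := B)) =
  \sum_(eta : {ffun {v | v \in B} -> 'I_q}) M * `|marginal mu eta - marginal mu' eta|.
  by rewrite -mulr_sumr /tv_dist; field.
apply: (le_trans (ler_norm_sum _ _ _)); apply: ler_sum => eta _.
have [/existsP[t0 /eqP e0]|/existsPn none] := boolP [exists t, rs t == eta]; last first.
  by rewrite big_pred0 ?normr0 ?mulr_ge0 // => t; apply/negbTE/none.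
rewrite /marginal -sumrB.
rewrite (eq_bigr (fun t => (mu t - mu' t) * f t0)) => [|t /eqP tE]; last first.
  rewrite mulrBl (floc t t0) // => u uB.
  have := congr1 (fun g : {ffun {v | v \in B} -> 'I_q} => g (exist _ u uB)) (etrans tE (esym e0)).
  by rewrite !ffunE.
by rewrite -mulr_suml normrM mulrC ler_wpM2r.
Qed.

(** Spatial mixing as a bound on conditional expectations: [phi] sees the free spins only through
    [B] and ignores the flipped spin at [v], so the flip acts only through the boundary
    condition. *)
Lemma E_boundary_influence (B : {set vertex d l}) (phi : conf -> R) (M : R) (D : nat)
    (sg : conf) (v : vertex d l) (c : 'I_q) :
  0 <= M -> (forall t, `|phi t| <= M) -> B \subset T ->
  (forall t t' : conf, eqoff T sg t -> eqoff T sg t' -> (forall u, u \in B -> t u = t' u) -> phi t = phi t') ->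
  (forall t, eqoff T sg t -> phi (upd t v c) = phi t) ->
  v \in cube l x s -> v \notin T -> (D <= d * s)%N ->
  (forall u, u \in B -> (D <= vdist v u)%N) -> 0 < a -> 0 < b ->
  `|E T phi (upd sg v c) - E T phi sg| <= 2 * M * (b * expR (- a * D%:R)).
Proof.
move=> M0 phiM BT philoc phiv vC vT Ds Dv a0 b0; rewrite !E_potts.
pose f t := phi (glue sg t).
have -> : \sum_t potts beta (bc (upd sg v c)) t * phi (glue (upd sg v c) t) =
          \sum_t potts beta (bc (upd sg v c)) t * f t.
  apply: eq_bigr => t _; congr (_ * _); rewrite /f -(phiv (glue sg t)) ?glue_eqoff //; congr phi.
  by apply/ffunP => u; rewrite !ffunE; case: ifP => // uT; case: eqP => // uv; rewrite -uv uT in vT.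
pose B' : {set vertex d s} := [set u | emb u \in B].
apply: (le_trans (sum_marginal (B := B') _ _ M0 _ _)) => //.
- move=> t t' tt'; apply: philoc; try exact: glue_eqoff.
  move=> u uB; have uT := subsetP BT _ uB; rewrite !ffunE uT.
  by apply: tt'; rewrite inE projK // (subsetP (region_sub rT)).
- by move=> t; apply: phiM.
apply: ler_wpM2l; first by rewrite mulr_ge0.
have ev : emb (proj v) = v by rewrite projK.
have domE sg' : bdom (bc sg') = [set u | emb u \notin T].
  by apply/setP => u; rewrite !inE ffunE; case: ifP.
apply: le_trans (mixing B' (u := proj v) _ (bc_bdry _) (bc_bdry _) _ _) _.
- apply: (subsetP (bc_bdry sg)); by rewrite domE inE ev.
- by rewrite !domE.
- move=> u uv; rewrite !ffunE; case: eqP => // e; case/eqP: uv; by rewrite -e embK.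
apply: ler_wpM2l; first exact: ltW.
rewrite ler_expR !mulNr lerN2; apply: ler_wpM2l; first exact: ltW.
rewrite ler_nat.
(* The value [d * s] that [set_dist] takes on the empty set is the reason for the hypothesis
   [D <= d * s]. *)
rewrite /set_dist; elim/big_ind: _ => // [m n|u]; first by rewrite leq_min => -> ->.
by rewrite inE => uB; rewrite -vdist_emb ev Dv.
Qed.

End Transfer.

(** * Gradients of block averages *)

Lemma dist_le_bound (R : realType) (u v m : R) :
  u <= m -> v <= m -> 0 <= u -> 0 <= v -> `|v - u| <= m.
Proof. by rewrite ler_norml; lra. Qed.

Section NestedCubes.
Variables (R : realType) (d l q : nat) (beta a b : R).
Hypotheses (d_gt0 : (0 < d)%N) (beta_gt0 : 0 < beta) (a_gt0 : 0 < a) (b_gt0 : 0 < b).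
Hypothesis mixing : forall s, spatial_mixing d s q beta a b.
Local Notation corner := ('I_d -> nat).
Local Notation E S := (cE (@gw R d l q beta) (eqoff S)).
Local Notation M := (@flip_bound R d beta).

(** One factor [M] normalises the density, the other bounds the flip ratio; [(2 r + 3)^d] bounds the
    number of sites of [Tr r.+1], and the influence of each decays like [2 b exp (- a (r / 2 - 1))].
    The factor [expR (2 * a)] absorbs the rounding of [r / 2 - 1], and with [1 + 2 * b] it also
    makes the trivial bound [M^2] enough for [r < 4]. *)
Definition eps (r : nat) : R :=
  M ^+ 2 * expR (2 * a) * (1 + 2 * b) * (2 * r + 3)%:R ^+ d * expR (- (a / 2) * r%:R).

Lemma eps_ge0 r : 0 <= eps r.
Proof. by rewrite !mulr_ge0 ?exprn_ge0 ?expR_ge0 ?addr_ge0 ?mulr_ge0 // ltW // expR_gt0. Qed.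

Section Block.
Variables (x : corner) (L : nat) (T : {set vertex d l}) (i : vertex d l).
Hypotheses (rT : region x L T) (iC : i \in cube l x L) (iT : i \notin T).

(** Corner of a cube of side [r] around [i], centred at [i] as far as the constraint of staying in
    the block allows. The site [i] may lie on a face of the block, and then the cubes are
    one-sided. *)
Definition lo (r : nat) : corner := fun k =>
  maxn (x k) (minn (i k - r./2) (x k + L - r)).

(** Vertices of the nested cube with a neighbour outside it are frozen, so that [Tr r] is a region
    and spatial mixing applies to it. *)
Definition Tr (r : nat) : {set vertex d l} :=
  [set v in T | (v \in cube l (lo r) r) && [forall w, adj v w ==> (w \in cube l (lo r) r)]].

Let iCk k : (x k <= i k <= x k + L)%N. Proof. exact/in_cube. Qed.

Lemma TrP r v : reflect [/\ v \in T, v \in cube l (lo r) r &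
  forall w, adj v w -> w \in cube l (lo r) r] (v \in Tr r).
Proof.
apply: (iffP idP) => [|[vT vC h]].
  by rewrite inE => /and3P[vT vC /forallP h]; split=> // w; apply/implyP.
by rewrite inE vT vC; apply/forallP => w; apply/implyP/h.
Qed.

Lemma Tr_sub r : Tr r \subset T.
Proof. by apply/subsetP => v /TrP[]. Qed.

Lemma Tr_region r : (r <= L)%N -> region (lo r) r (Tr r).
Proof.
move=> rL; split.
- move=> k; have := iCk k; have := region_fits rT k; rewrite /lo; lia.
- by apply/subsetP => v /TrP[].
- by move=> v w /TrP[_ _]; apply.
- move=> v h; apply/TrP; split.
  + apply: (region_int rT) => k; have := h k; have := iCk k; rewrite /lo; lia.
  + by apply/in_cube => k; have := h k; lia.
  + move=> w vw; apply/in_cube => k; have := h k; have := adj_near k vw; lia.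
Qed.

Lemma cube_lo_mono r : (r < L)%N -> cube l (lo r) r \subset cube l (lo r.+1) r.+1.
Proof.
move=> rL; apply/subsetP => v /in_cube h; apply/in_cube => k.
have := h k; have := iCk k; rewrite /lo; lia.
Qed.

Lemma Tr_mono r : (r < L)%N -> Tr r \subset Tr r.+1.
Proof.
move=> rL; have /subsetP sub := cube_lo_mono rL; apply/subsetP => v /TrP[vT vC h].
by apply/TrP; split=> [//||w /h]; apply: sub.
Qed.

Lemma Tr0 : Tr 0 = set0.
Proof.
apply/setP => v; rewrite [RHS]inE; apply/negbTE/negP => /TrP[vT /in_cube vC _].
suff vi : v = i by rewrite vi (negPf iT) in vT.
apply/ffunP => k; apply: val_inj => /=; have := vC k; have := iCk k; rewrite /lo; lia.
Qed.

Lemma TrL : Tr L = T.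
Proof.
have e : cube l (lo L) L = cube l x L.
  by apply/setP => v; rewrite !inE; apply: eq_forallb => k; rewrite /lo; have := iCk k; lia.
apply/setP => v; apply/TrP/idP => [[]//|vT]; rewrite e; split=> // [|w vw].
  exact: (subsetP (region_sub rT)).
exact: (region_nbr rT vT).
Qed.

Lemma Tr_near r v : (r <= L)%N -> v \in Tr r -> nearby r i v.
Proof.
move=> rL /TrP[_ /in_cube h _]; apply/forallP => k; have := h k; have := iCk k.
rewrite /lo; lia.
Qed.

(** The neighbour of [v] that leaves the nested cube is still in the block. Hence that face of the
    nested cube was not pushed inwards by the block, and it is at distance at least [r./2] from
    [i]. *)
Lemma Tr_far r v : (r <= L)%N -> v \in T -> v \in cube l (lo r) r -> v \notin Tr r ->
  (r./2 <= vdist v i)%N.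
Proof.
move=> rL vT vC vTr.
have : ~~ [forall w, adj v w ==> (w \in cube l (lo r) r)].
  by apply: contra vTr => h; rewrite inE vT vC.
case/forallPn => w; rewrite negb_imply => /andP[vw wC].
have wX := region_nbr rT vT vw.
move: wC; rewrite inE => /forallPn[k wk].
have [h1 h2] := vdist_ge_coord v i k; have := adj_near k vw.
move/in_cube: vC => /(_ k); move/in_cube: wX => /(_ k); move: wk; have := iCk k.
rewrite /lo; lia.
Qed.

Lemma adj_in_lo r w : (1 < r <= L)%N -> adj i w -> w \in T -> w \in cube l (lo r) r.
Proof.
move=> rL iw wT; have /in_cube wX := subsetP (region_sub rT) _ wT.
apply/in_cube => k; have := wX k; have := iCk k; have := adj_near k iw.
rewrite /lo; lia.
Qed.

Variable c : 'I_q.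
Let k := flip_ratio (@gw R d l q beta) i c.
Let eqv A : equivalence_rel (@eqoff (vertex d l) q A). Proof. exact: eqoff_equiv. Qed.
Let gw0 := @gw_gt0 R d l q beta.

Let M1 : 1 <= M. Proof. exact: flip_bound_ge1. Qed.
Let k_le t : k t <= M. Proof. exact: flip_ratio_le. Qed.
Let k_gt0 t : 0 < k t. Proof. exact: flip_ratio_gt0. Qed.

(** A spin inside [Tr r] is averaged out, and one outside the nested cube touches neither [Tr r] nor
    [i]. Otherwise [v] is a frozen site of the nested cube and spatial mixing applies between [v]
    and the neighbours of [i], the only spins besides that of [i] on which [k] depends. The
    condition [4 <= r] keeps [v] from being such a neighbour. *)
Lemma Tr_influence r v s c' : (4 <= r <= L)%N -> v \in T ->
  `|E (Tr r) k (upd s v c') - E (Tr r) k s| <= 2 * M * (b * expR (- a * (r./2 - 1)%:R)).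
Proof.
move=> rL vT.
have [rL' r1] : (r <= L)%N /\ (1 < r <= L)%N by clear -rL; lia.
have rhs0 : 0 <= 2 * M * (b * expR (- a * (r./2 - 1)%:R)).
  by rewrite !mulr_ge0 ?expR_ge0 // ltW // expR_gt0.
have [vTr|vTr] := boolP (v \in Tr r).
  by rewrite (E_inv_mem _ _ _ _ vTr) subrr normr0.
have vi : v != i by apply: contraTneq vT => ->.
have [vC|vC] := boolP (v \in cube l (lo r) r); last first.
  have viN : ~~ adj i v by apply: contra vC => iv; apply: (adj_in_lo r1).
  have ku t : k (upd t v c') = k t.
    apply: flip_ratio_local; first by rewrite updE eq_sym (negPf vi).
    by move=> u iu; rewrite updE; case: eqP => // e; rewrite -e iu in viN.
  rewrite (E_upd_neutral gw0 _ vTr); last first.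
    move=> t /eqoffP st; apply: flip_ratio_local; first by rewrite st.
    move=> u vu; rewrite st //; apply: contra vC => /TrP[_ _]; apply.
    by rewrite adj_sym.
  by rewrite (@cE_eq _ _ _ _ _ k) ?subrr ?normr0.
have far := Tr_far rL' vT vC vTr.
have viN : ~~ adj i v by rewrite adj_sym /adj; apply: contraL far => /eqP ->; clear -rL; lia.
have ku t : k (upd t v c') = k t.
  apply: flip_ratio_local; first by rewrite updE eq_sym (negPf vi).
  by move=> u iu; rewrite updE; case: eqP => // e; rewrite -e iu in viN.
apply: (E_boundary_influence beta_gt0 (Tr_region rL') (@mixing r) (B := [set u in Tr r | adj i u])
  (phi := k) (M := M) (D := (r./2 - 1)%N) (sg := s) (v := v) (c := c')) => //.
- exact: le_trans ler01 M1.
- by move=> t; rewrite ger0_norm ?k_le //; apply: ltW.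
- by apply/subsetP => u; rewrite inE => /andP[].
- move=> t t' /eqoffP st /eqoffP st' h; apply: flip_ratio_local.
    by rewrite -st ?st' //; apply: contra iT; apply: (subsetP (Tr_sub r)).
  move=> u iu; have [uT|uT] := boolP (u \in Tr r); first by apply: h; rewrite inE uT.
  by rewrite -st ?st'.
- by apply: (@leq_trans r); [clear; lia | rewrite leq_pmull].
- move=> u; rewrite inE => /andP[_ iu]; have := vdist_tri v u i.
  by move: iu far; rewrite adj_sym /adj => /eqP ->; clear; lia.
Qed.

(** Averaging over [Tr r.+1] moves [E (Tr r) k] by at most its total oscillation over the sites of
    [Tr r.+1], and [Tr_influence] bounds each of these. For [r < 4] the two expectations are merely
    bounded by [M]. *)
Lemma density_eps r s t : (r < L)%N -> eqoff T s t ->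
  `|E (Tr r) (fun u => k u / E T k s) t - E (Tr r.+1) (fun u => k u / E T k s) t| <= eps r.
Proof.
move=> rL st; pose z := E T k s; pose h u := k u / z; rewrite -/z -/h.
have z_ge : M^-1 <= z.
  rewrite -[leLHS](cE_cst gw0 (eqv T) _ s); apply: (cE_le gw0 (eqv T)) => u _.
  exact: flip_ratio_ge.
have M0 : 0 < M by apply: lt_le_trans M1.
have z0 : 0 < z by apply: lt_le_trans z_ge; rewrite invr_gt0.
have zV : z^-1 <= M by rewrite -[leRHS]invrK lef_pV2 ?posrE ?invr_gt0.
have hE S u : E S h u = z^-1 * E S k u.
  by rewrite -cEZ; apply: cE_eq => v _; rewrite mulrC.
rewrite !hE -mulrBr normrM gtr0_norm ?invr_gt0 //.
have [r4|r4] := leqP 4 r; last first.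
  have Ek0 S u : 0 <= E S k u by apply: (cE_ge0 gw0 (eqv _)) => *; apply: ltW.
  have EkM S u : E S k u <= M.
    by rewrite -[leRHS](cE_cst gw0 (eqv S) _ u); apply: (cE_le gw0 (eqv _)).
  apply: (@le_trans _ _ (M * M)).
    apply: ler_pM => //; first by rewrite invr_ge0 ltW.
    by apply: dist_le_bound.
  have -> : eps r = (M * M) *
      ((1 + 2 * b) * ((2 * r + 3)%:R ^+ d * (expR (2 * a) * expR (- (a / 2) * r%:R)))).
    by rewrite /eps; ring.
  rewrite -[leLHS]mulr1 ler_wpM2l ?mulr_ge0 ?(ltW M0) //.
  rewrite mulr_ege1 //; first by rewrite lerDl mulr_ge0 // ltW.
  rewrite mulr_ege1 ?exprn_ege1 ?ler1n ?addn3 //.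
  rewrite -expRD -[leLHS]expR0 ler_expR.
  have r3 : r%:R <= 3 :> R by rewrite ler_nat.
  have -> : 2 * a + - (a / 2) * r%:R = (a / 2) * (4 - r%:R) by field.
  by rewrite mulr_ge0 ?divr_ge0 ?(ltW a_gt0) // subr_ge0 (le_trans r3) // ler_nat.
set o := 2 * M * (b * expR (- a * (r./2 - 1)%:R)).
have o0 : 0 <= o by rewrite !mulr_ge0 ?expR_ge0 // ltW // expR_gt0.
have osc_o v : v \in T -> osc v (E (Tr r) k) <= o.
  move=> vT; apply: osc_le => // s' c'; apply: Tr_influence => //.
  by rewrite r4 ltnW.
have step : `|E (Tr r) k t - E (Tr r.+1) k t| <= (2 * r + 3)%:R ^+ d * o.
  rewrite -(cE_tower gw0 (eqv (Tr r)) (eqv (Tr r.+1))); last exact/eqoff_sub/Tr_mono.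
  rewrite -{1}(cE_cst gw0 (eqv (Tr r.+1)) (E (Tr r) k t) t) -cEB.
  apply: (le_trans (cE_norm gw0 (eqv _) _ _)).
  rewrite -[leRHS](cE_cst gw0 (eqv (Tr r.+1)) _ t); apply: (cE_le gw0 (eqv _)) => u tu.
  rewrite distrC; apply: (le_trans (eqoff_osc _ tu)).
  apply: (@le_trans _ _ (\sum_(v in Tr r.+1) o)).
    by apply: ler_sum => v /(subsetP (Tr_sub _)); apply: osc_o.
  rewrite sumr_const -[_ *+ #|_|]mulr_natl ler_wpM2r // -natrX ler_nat.
  by apply: leq_trans (region_card (Tr_region rL)) _; rewrite leq_exp2r //; clear; lia.
apply: (@le_trans _ _ (M * ((2 * r + 3)%:R ^+ d * o))).
  by apply: ler_pM => //; rewrite invr_ge0 ltW.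
set P := (2 * r + 3)%:R ^+ d.
have P0 : 0 <= P by rewrite exprn_ge0.
have -> : M * (P * o) = (M ^+ 2 * P) * (2 * b * expR (- a * (r./2 - 1)%:R)) by rewrite /o; ring.
have -> : eps r = (M ^+ 2 * P) * ((1 + 2 * b) * (expR (2 * a) * expR (- (a / 2) * r%:R))).
  by rewrite /eps -/P; ring.
rewrite ler_wpM2l ?mulr_ge0 ?exprn_ge0 ?(ltW M0) //.
apply: ler_pM; rewrite ?mulr_ge0 ?expR_ge0 ?(ltW b_gt0) //; first by lra.
rewrite -expRD ler_expR.
have : r%:R <= 2 * (r./2 - 1)%:R + 3 :> R by rewrite -natrM -natrD ler_nat; clear; lia.
set D := (r./2 - 1)%:R => hr.
have -> : 2 * a + - (a / 2) * r%:R = - a * D + (a / 2) * ((2 * D + 3 - r%:R) + 1) by field.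
by rewrite lerDl mulr_ge0 ?divr_ge0 ?(ltW a_gt0) // addr_ge0 ?subr_ge0.
Qed.

Lemma density_le s t : k t / E T k s <= M ^+ 2.
Proof.
have M0 : 0 < M by apply: lt_le_trans M1.
have z_ge : M^-1 <= E T k s.
  rewrite -[leLHS](cE_cst gw0 (eqv T) _ s); apply: (cE_le gw0 (eqv T)) => u _.
  exact: flip_ratio_ge.
have z0 : 0 < E T k s by apply: lt_le_trans z_ge; rewrite invr_gt0.
apply: ler_pM => //; first exact: ltW.
  by rewrite invr_ge0 ltW.
by rewrite -[leRHS]invrK lef_pV2 ?posrE ?invr_gt0.
Qed.

Lemma block_osc f s :
  `|E T f (upd s i c) - E T f s|
    <= osc i f + \sum_(r < L) eps r * \sum_(j in T | nearby r.+1 i j) osc j f.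
Proof.
apply: (le_trans (E_upd_osc gw0 (T := Tr) iT Tr0 TrL Tr_mono eps_ge0 _ _ _)).
- by move=> r t; apply: density_eps.
- by move=> r; apply: Tr_sub.
rewrite lerD2l; apply: ler_sum => r _; rewrite ler_wpM2l ?eps_ge0 //.
rewrite [leRHS]big_mkcond [leLHS]big_mkcond /=; apply: ler_sum => j _.
case: ifP => [jT|_]; last by case: ifP => // _; apply: osc_ge0.
by rewrite (subsetP (Tr_sub _) _ jT) (Tr_near _ jT).
Qed.

(** The gap is required on all regions of side at most [L], because the martingale argument uses the
    variance on each [Tr r.+1]. *)
Lemma block_sqrt (C : R) g s : 0 <= C ->
  (forall y m S t, region y m S -> (m <= L)%N ->
     cVar (@gw R d l q beta) (eqoff S) g t <= C * \sum_(j in S) E S (Gam j g) t) ->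
  (Num.sqrt (E T (fun t => g t ^+ 2) (upd s i c)) - Num.sqrt (E T (fun t => g t ^+ 2) s)) ^+ 2
   <= 2 * M ^+ 2 * E T (Gam i g) s
      + 8 * (\sum_(r < L) eps r) * C *
        \sum_(r < L) eps r * \sum_(j in T | nearby r.+1 i j) E T (Gam j g) s.
Proof.
move=> C0 gap.
have EG0 j : 0 <= E T (Gam j g) s by apply: (cE_ge0 gw0 (eqv _)) => t _; apply: Gam_ge0.
apply: (le_trans (E_upd_sqrt gw0 (T := Tr) (L := L) (eps := eps) (M := M ^+ 2) (C := C) 
  iT Tr0 TrL Tr_mono eps_ge0 _ _ _ _)).
- by move=> r t; apply: density_eps.
- by move=> r; apply: Tr_sub.
- by move=> t _; apply: density_le.
- move=> r rL; apply: (@le_trans _ _ (E T (fun t => C * \sum_(j in Tr r.+1) E (Tr r.+1) (Gam j g) t) s)).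
    by apply: (cE_le gw0 (eqv _)) => t _; exact: gap (Tr_region rL) rL.
  rewrite cEZ ler_wpM2l // (cE_sum gw0 (eqv _)); apply: ler_sum => j _.
  by rewrite (cE_tower gw0 (eqv _) (eqv _)) //; apply/eqoff_sub/Tr_sub.
rewrite lerD2l ler_wpM2l //.
  by rewrite !mulr_ge0 // sumr_ge0 // => r _; apply: eps_ge0.
apply: ler_sum => r _; rewrite ler_wpM2l ?eps_ge0 //.
rewrite [leRHS]big_mkcond [leLHS]big_mkcond /=; apply: ler_sum => j _.
case: ifP => [jT|_]; last by case: ifP.
by rewrite (subsetP (Tr_sub _) _ jT) (Tr_near _ jT).
Qed.

End Block.
End NestedCubes.

(** * Weighted blocks *)

Section BlockWeights.
Variables (R : realType) (d l : nat).
Local Notation corner := ('I_d -> nat).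
Variables (x : corner) (K N : nat).
Hypothesis K_gt0 : (0 < K)%N.
Let L := (K * K)%N.
Hypothesis LN : (L <= N)%N.
Variable S : {set vertex d l}.
Hypothesis rS : region x (N + L) S.
Local Notation index := {ffun 'I_d -> 'I_N.+1}.
Implicit Types (y : index) (i j v w : vertex d l).

Definition block (y : index) : {set vertex d l} := cube l (fun k => x k + y k)%N L.

Definition block_free (y : index) : {set vertex d l} :=
  [set v in S | (v \in block y) && [forall w, adj v w ==> (w \in block y)]].

Lemma block_freeP y v : reflect [/\ v \in S, v \in block y &
  forall w, adj v w -> w \in block y] (v \in block_free y).
Proof.
apply: (iffP idP) => [|[vT vC h]].
  by rewrite inE => /and3P[vT vC /forallP h]; split=> // w; apply/implyP.
by rewrite inE vT vC; apply/forallP => w; apply/implyP/h.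
Qed.

Lemma block_free_sub y : block_free y \subset S.
Proof. by apply/subsetP => v /block_freeP[]. Qed.

Lemma block_region y : region (fun k => x k + y k)%N L (block_free y).
Proof.
split.
- by move=> k; have := region_fits rS k; have := ltn_ord (y k); lia.
- by apply/subsetP => v /block_freeP[].
- by move=> v w /block_freeP[_ _]; apply.
- move=> v h; apply/block_freeP; split.
  + by apply: (region_int rS) => k; have := h k; have := ltn_ord (y k); lia.
  + by apply/in_cube => k; have := h k; lia.
  + by move=> w vw; apply/in_cube => k; have := h k; have := adj_near k vw; lia.
Qed.

(* Blocks touching a face of the large cube weigh more, so that nearby the faces
   the blocks having a given site on their boundary remain a small fraction. *)
Definition w1 (c : nat) : R := if (c == 0%N) || (c == N) then K%:R else 1.
Definition weight (y : index) : R := \prod_k w1 (y k).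

Lemma w1_ge1 c : 1 <= w1 c.
Proof. by rewrite /w1; case: ifP => // _; rewrite ler1n. Qed.

Lemma weight_ge1 y : 1 <= weight y.
Proof.
rewrite /weight; elim/big_ind: _ => // [u v u1 v1|k _]; last exact: w1_ge1.
by rewrite mulr_ege1.
Qed.

Definition cov (u c : nat) : bool := (c <= u <= c + L)%N.
(** Cover weight in one dimension. Blocks and weights are products over coordinates, so the
    estimates reduce to this one. *)
Definition G1 (u : nat) : R := \sum_(c < N.+1 | cov u c) w1 c.
Definition cover_weight j : R := \sum_(y | j \in block y) weight y.

Lemma G1_ge_w1 u c : (c <= N)%N -> cov u c -> w1 c <= G1 u.
Proof.
move=> cN uc; have cN' : (c < N.+1)%N by [].
rewrite /G1 (bigD1 (Ordinal cN')) //= lerDl sumr_ge0 // => c' _.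
exact: le_trans (w1_ge1 _).
Qed.

Lemma G1_ge_window u m : (u <= N + L)%N ->
  (m <= minn u N - (u - L) + 1)%N -> m%:R <= G1 u.
Proof.
move=> uN mu; apply: (@le_trans _ _ (\sum_(c < N.+1 | cov u c) 1)); last first.
  by apply: ler_sum => c _; apply: w1_ge1.
rewrite sumr_const ler_nat; apply: (leq_trans mu).
pose f (t : 'I_(minn u N - (u - L) + 1)) : 'I_N.+1 := inord (u - L + t).
have <- : #|f @: [set: 'I_(minn u N - (u - L) + 1)]| =
   (minn u N - (u - L) + 1)%N.
  rewrite card_imset ?cardsT ?card_ord // => t t' /(congr1 val) /=.
  rewrite !inordK; [| have := ltn_ord t'; lia | have := ltn_ord t; lia] => e.
  by apply: val_inj => /=; lia.
apply: subset_leq_card; apply/subsetP => c /imsetP[t _ ->]; rewrite unfold_in /cov.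
rewrite inordK; have := ltn_ord t; lia.
Qed.

(** Within [L] of either end, an extreme position covers [u] and has weight [K] by itself; elsewhere
    more than [L >= K] positions do. *)
Lemma G1_ge_K u : (u <= N + L)%N -> K%:R <= G1 u.
Proof.
move=> uN; have KL : (K <= L)%N by rewrite /L; nia.
have [uL|uL] := leqP u L.
  by apply: (@le_trans _ _ (w1 0)); [rewrite /w1 eqxx | apply: G1_ge_w1; rewrite // /cov; lia].
have [Nu|uN'] := leqP N u.
  apply: (@le_trans _ _ (w1 N)); first by rewrite /w1 eqxx orbT.
  by apply: G1_ge_w1; rewrite // /cov; lia.
apply: G1_ge_window => //; lia.
Qed.

(** [(1 + m) (L - m + 1) = L + 1 + m (L - m)], which is at least [L = K^2]. *)
Lemma window_product (m t : nat) : (m <= L)%N -> (L - m + 1 <= t)%N ->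
  K%:R * K%:R <= 2 * (1 + m%:R) * t%:R :> R.
Proof.
move=> mL mt; rewrite -natrM (_ : 1 + m%:R = (1 + m)%:R :> R); last by rewrite natrD.
rewrite -!natrM ler_nat -/L.
have : ((1 + m) * (L - m + 1) <= (1 + m) * t)%N by rewrite leq_mul2l mt orbT.
have : (L <= (1 + m) * (L - m + 1))%N; last by lia.
by rewrite -{1}(subnKC mL); set r := (L - m)%N; nia.
Qed.

(** An ordinary position has weight 1 and [G1_ge_K] suffices. An extreme position has weight [K],
    but its inner face is at the far end of the interval; a point within [m] of that end is covered
    by at least [L - m + 1] positions, and [window_product] balances [K * K] against them. *)
Lemma face_weight u c m : (u <= N + L)%N -> (c <= N)%N -> cov u c ->
  ((0 < c) && (u <= c + m))%N || ((c < N) && (c + L <= u + m))%N ->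
  K%:R * w1 c <= 2 * (1 + m%:R) * G1 u.
Proof.
move=> uN cN uc bad; have GK := G1_ge_K uN.
have m0 : 0 <= m%:R :> R by [].
have easy : w1 c = 1 -> K%:R * w1 c <= 2 * (1 + m%:R) * G1 u.
  move=> ->; rewrite mulr1; apply: (le_trans GK); rewrite -[leLHS]mul1r ler_wpM2r //.
    exact: le_trans GK.
  lra.
have big m' t : (m' <= m)%N -> (m' <= L)%N -> (L - m' + 1 <= t)%N -> t%:R <= G1 u ->
    K%:R * K%:R <= 2 * (1 + m%:R) * G1 u.
  move=> mm mL mt tG; apply: (le_trans (window_product mL mt)).
  have mR : m'%:R <= m%:R :> R by rewrite ler_nat.
  by apply: ler_pM => //; rewrite ?mulr_ge0 ?addr_ge0 // ler_wpM2l // lerD2l.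
move: uc; rewrite /cov => uc.
have [c0|c0] := eqVneq c 0%N.
  rewrite {1}/w1 c0 eqxx /=; apply: (big (L - u)%N u.+1); try lia.
  by apply: G1_ge_window => //; lia.
have [cN'|cN'] := eqVneq c N; last by apply: easy; rewrite /w1 (negPf c0) (negPf cN').
rewrite {1}/w1 cN' eqxx orbT; apply: (big (u - N)%N (N - (u - L) + 1)%N); try lia.
apply: G1_ge_window => //; lia.
Qed.

Definition rel_coord j k : nat := (j k - x k)%N.

Lemma in_block j y : j \in S ->
  (j \in block y) = [forall k, cov (rel_coord j k) (y k)].
Proof.
move=> jS; have /in_cube jC := subsetP (region_sub rS) _ jS.
apply/in_cube/forallP => h k; have := h k; have := jC k; rewrite /cov /rel_coord; lia.
Qed.

Lemma sum_index_prod (F : 'I_d -> nat -> R) :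
  \sum_(y : index) \prod_k F k (y k) = \prod_k \sum_(c < N.+1) F k c.
Proof. by rewrite (bigA_distr_bigA (fun k (c : 'I_N.+1) => F k c)). Qed.

Lemma prod_indicator (P : 'I_d -> bool) (F : 'I_d -> R) :
  (if [forall k, P k] then \prod_k F k else 0) = \prod_k (if P k then F k else 0).
Proof.
case: ifP => [/forallP h|/negbT/forallPn[k nk]]; first by apply: eq_bigr => k _; rewrite h.
by rewrite (bigD1 k) //= (negPf nk) mul0r.
Qed.

Lemma cover_weightE j : j \in S -> cover_weight j = \prod_k G1 (rel_coord j k).
Proof.
move=> jS; rewrite /cover_weight big_mkcond /=.
under eq_bigr => y _ do rewrite in_block // /weight prod_indicator.
rewrite (sum_index_prod (fun k c => if cov (rel_coord j k) c then w1 c else 0)).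
by apply: eq_bigr => k _; rewrite -big_mkcond.
Qed.

Lemma cover_weight_ge1 j : j \in S -> 1 <= cover_weight j.
Proof.
move=> jS; rewrite cover_weightE //; elim/big_ind: _ => // [u v u1 v1|k _]; first by rewrite mulr_ege1.
have /in_cube jC := subsetP (region_sub rS) _ jS.
apply: le_trans (G1_ge_K _); first by rewrite ler1n.
by have := jC k; rewrite /rel_coord; lia.
Qed.

Lemma G1_le u : G1 u <= K%:R * (L + 1)%:R.
Proof.
apply: (@le_trans _ _ (\sum_(c < N.+1 | cov u c) K%:R)).
  by apply: ler_sum => c _; rewrite /w1; case: ifP => // _; rewrite ler1n.
rewrite sumr_const -[_ *+ #|_|]mulr_natr ler_wpM2l // ler_nat.
have -> : (L + 1)%N = #|'I_(L + 1)| by rewrite card_ord.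
pose f (c : 'I_N.+1) : 'I_(L + 1) := insubd (Ordinal (ltac:(lia) : (0 < L + 1)%N)) (u - c)%N.
rewrite -(card_in_imset (f := f)); first exact: max_card.
move=> c c'; rewrite !unfold_in /cov => hc hc' /(congr1 val).
rewrite !val_insubd !ifT; [|lia|lia] => e; apply: val_inj => /=; lia.
Qed.

Lemma cover_weight_le j : j \in S -> cover_weight j <= (K%:R * (L + 1)%:R) ^+ d.
Proof.
move=> jS; rewrite cover_weightE //.
apply: (@le_trans _ _ (\prod_(k < d) (K%:R * (L + 1)%:R))).
  apply: ler_prod => k _; rewrite G1_le andbT.
  by apply: sumr_ge0 => c _; apply: le_trans (w1_ge1 _).
by rewrite prodr_const card_ord.
Qed.

Lemma sum_free_cover (X : vertex d l -> R) : (forall i, 0 <= X i) ->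
  \sum_y weight y * \sum_(j in block_free y) X j <= \sum_(j in S) cover_weight j * X j.
Proof.
move=> X0; apply: (@le_trans _ _ (\sum_y weight y * \sum_(i in S) (if i \in block y then X i else 0))).
  apply: ler_sum => y _; rewrite ler_wpM2l ?(le_trans _ (weight_ge1 y)) //.
  rewrite [leLHS]big_mkcond [leRHS]big_mkcond /=; apply: ler_sum => i _.
  case: (boolP (i \in block_free y)) => [/block_freeP[-> -> _] //|_].
  by case: (i \in S); case: (i \in block y).
under eq_bigr do rewrite mulr_sumr.
rewrite exchange_big /= le_eqVlt; apply/orP; left; apply/eqP.
apply: eq_bigr => j _; rewrite /cover_weight mulr_suml [RHS]big_mkcond /=.
by apply: eq_bigr => y _; case: ifP; rewrite ?mulr0.
Qed.

Definition face i k (c : nat) : bool :=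
  ((0 < c)%N && (rel_coord i k == c)) || ((c < N)%N && (rel_coord i k == c + L)%N).

(** The neighbour of [i] that leaves the block remains in the large cube, so the face carrying [i]
    is not a face of the large cube. *)
Lemma bad_face i y : i \in S -> i \in block y -> i \notin block_free y ->
  exists k, face i k (y k).
Proof.
move=> iS iB iF; have : ~~ [forall w, adj i w ==> (w \in block y)].
  by apply: contra iF => h; rewrite inE iS iB.
case/forallPn => w; rewrite negb_imply => /andP[iw wB].
have /in_cube wC := region_nbr rS iS iw.
move: wB; rewrite inE => /forallPn[k wk]; exists k; rewrite /face /rel_coord.
have := wC k; have := adj_near k iw; move/in_cube: iB => /(_ k).
have := ltn_ord (y k); move: wk; lia.
Qed.

(** Only coordinate [k] is constrained by the face; the others give the same factors as in
    [cover_weight j]. In coordinate [k] each of the two faces fixes the position, and [face_weight]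
    contributes [2 (1 + m)] for each. *)
Lemma sum_face i j k m : i \in S -> j \in S -> nearby m i j ->
  K%:R * \sum_(y | (j \in block y) && face i k (y k)) weight y
    <= 4 * (1 + m%:R) * cover_weight j.
Proof.
move=> iS jS /forallP nij; have /in_cube jC := subsetP (region_sub rS) _ jS.
have /in_cube iC := subsetP (region_sub rS) _ iS.
have G0 u : 0 <= G1 u by apply: sumr_ge0 => c _; apply: le_trans (w1_ge1 _).
have -> : \sum_(y | (j \in block y) && face i k (y k)) weight y =
  (\sum_(c < N.+1) if cov (rel_coord j k) c && face i k c then w1 c else 0) *
  \prod_(k' | k' != k) G1 (rel_coord j k').
  rewrite big_mkcond /=.
  transitivity (\sum_(y : index) \prod_k' (if cov (rel_coord j k') (y k') &&
       ((k' != k) || face i k (y k')) then w1 (y k') else 0)).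
    apply: eq_bigr => y _; rewrite -prod_indicator in_block //; congr (if _ then _ else _).
    apply/andP/forallP => [[/forallP h f] k'|h].
      by rewrite h; have [->|] := eqVneq k' k.
    split; first by apply/forallP => k'; have /andP[] := h k'.
    by have := h k; rewrite eqxx => /andP[].
  rewrite (sum_index_prod (fun k' c => if cov (rel_coord j k') c &&
       ((k' != k) || face i k c) then w1 c else 0)).
  rewrite (bigD1 k) //= eqxx; congr (_ * _); apply: eq_bigr => k' k'k.
  by rewrite /G1 [RHS]big_mkcond; apply: eq_bigr => c _; rewrite k'k andbT.
rewrite cover_weightE // [X in _ <= _ * X](bigD1 k) //= !mulrA ler_wpM2r ?prodr_ge0 //.
pose u := rel_coord j k.
have uN : (u <= N + L)%N by have := jC k; rewrite /u /rel_coord; lia.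
have one (P : pred nat) : (forall c c', P c -> P c' -> c = c') ->
   (forall c, (c <= N)%N -> P c -> cov u c -> K%:R * w1 c <= 2 * (1 + m%:R) * G1 u) ->
   K%:R * \sum_(c < N.+1) (if cov u c && P c then w1 c else 0) <= 2 * (1 + m%:R) * G1 u.
  move=> Puniq Pw; have rhs0 : 0 <= 2 * (1 + m%:R) * G1 u by rewrite !mulr_ge0 ?addr_ge0.
  have [/existsP[c Pc]|/existsPn none] := boolP [exists c : 'I_N.+1, cov u c && P c].
    rewrite (bigD1 c) //= Pc big1 ?addr0 => [|c' c'c]; last first.
      case: ifP => // /andP[_ Pc']; case/eqP: c'c; apply: val_inj; apply: Puniq => //.
      by case/andP: Pc.
    by case/andP: Pc => uc Pc; apply: Pw => //; rewrite -ltnS ltn_ord.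
  by rewrite big1 ?mulr0 // => c _; rewrite (negPf (none c)).
have h1 := one (fun c => (0 < c)%N && (rel_coord i k == c)) ltac:(by move=> c c' /andP[_ /eqP <-] /andP[_ /eqP]) .
have h2 := one (fun c => (c < N)%N && (rel_coord i k == c + L)%N) ltac:(by move=> c c' /andP[_ /eqP e] /andP[_ /eqP e']; lia).
have nk := nij k; have iCk := iC k; have jCk := jC k.
have {}h1 := h1 _; have {}h2 := h2 _.
apply: (@le_trans _ _ (K%:R * (\sum_(c < N.+1) (if cov u c && ((0 < c)%N && (rel_coord i k == c)) then w1 c else 0)
   + \sum_(c < N.+1) (if cov u c && ((c < N)%N && (rel_coord i k == c + L)%N) then w1 c else 0)))).
  rewrite ler_wpM2l // -big_split; apply: ler_sum => c _ /=; rewrite -/u /face.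
  have w0 : 0 <= w1 c by apply: le_trans (w1_ge1 _).
  have bool2 (p q r : bool) : (if p && (q || r) then w1 c else 0) <=
      (if p && q then w1 c else 0) + (if p && r then w1 c else 0).
    by case: p; case: q; case: r; rewrite /= ?addr0 ?add0r // lerDl.
  exact: bool2.
rewrite mulrDr; have -> : 4 * (1 + m%:R) * G1 u = 2 * (1 + m%:R) * G1 u + 2 * (1 + m%:R) * G1 u by ring.
apply: lerD; [apply: h1|apply: h2] => c cN /andP[c0 /eqP e] uc; apply: face_weight => //.
  by apply/orP; left; move: e; rewrite /u /rel_coord; lia.
by apply/orP; right; move: e; rewrite /u /rel_coord; lia.
Qed.

Lemma sum_bad i j m : i \in S -> j \in S -> nearby m i j ->
  \sum_(y | (j \in block y) && ((i \in block y) && (i \notin block_free y))) weight y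
    <= 4 * d%:R / K%:R * (1 + m%:R) * cover_weight j.
Proof.
move=> iS jS nij; have K0 : 0 < K%:R :> R by rewrite ltr0n.
have w0 y : 0 <= weight y by apply: le_trans (weight_ge1 _).
apply: (@le_trans _ _ (\sum_k \sum_(y | (j \in block y) && face i k (y k)) weight y)).
  rewrite (exchange_big_dep (fun y => j \in block y)) /=; last by move=> k y _ /andP[].
  rewrite big_mkcondr /=; apply: ler_sum => y jy.
  case: ifP => [/andP[iB iF]|_]; last by apply: sumr_ge0.
  have [k fk] := bad_face iS iB iF.
  by rewrite (bigD1 k) ?jy ?fk //= lerDl sumr_ge0.
have -> : 4 * d%:R / K%:R * (1 + m%:R) * cover_weight j = \sum_(k < d) (4 * (1 + m%:R) * cover_weight j / K%:R).
  by rewrite sumr_const card_ord -[_ *+ d]mulr_natl; ring.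
apply: ler_sum => k _; rewrite ler_pdivlMr // mulrC; exact: sum_face.
Qed.

Lemma card_nearby m j : (#|[set i | nearby m i j]| <= (2 * m + 1) ^ d)%N.
Proof.
apply: leq_trans (card_box j m); apply: subset_leq_card; apply/subsetP => i; rewrite !inE.
by move=> /forallP h; apply/forallP => k; rewrite andbC.
Qed.

Variables (X : vertex d l -> R) (XX : index -> vertex d l -> R) (C0 : R) (e : nat -> R).
Hypotheses (X_ge0 : forall i, 0 <= X i) (C0_ge0 : 0 <= C0) (e_ge0 : forall r, 0 <= e r).
Hypothesis XX_free : forall y i, i \in block_free y -> XX y i <= 0.
Hypothesis XX_out : forall y i, i \in S -> i \notin block y -> XX y i <= X i.
Hypothesis XX_bad : forall y i, i \in S -> i \in block y -> i \notin block_free y ->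
  XX y i <= C0 * X i + \sum_(r < L) e r * \sum_(j in block_free y | nearby r.+1 i j) X j.

(** In the sum, [r + 2] is the [1 + m] of [sum_bad] at [m = r + 1], and [(2 r + 3)^d] bounds the
    number of sites [i] within [r + 1] of a given [j]. *)
Definition bad_factor : R := C0 + \sum_(r < L) e r * (r + 2)%:R * (2 * r + 3)%:R ^+ d.

(** Stated for abstract gradients because it serves twice, for oscillations and for the mean of
    [Gam i (sqrt f)]. A free site loses its gradient and a site outside the block does not gain;
    only bad sites can gain, and by [sum_bad] the blocks where this happens have a share of order
    [1 / K] in the cover weight. *)
Lemma block_sum :
  \sum_y weight y * \sum_(i in S) XX y i
   <= (\sum_y weight y) * (\sum_(i in S) X i)
      - (1 - 4 * d%:R / K%:R * bad_factor) * \sum_(j in S) cover_weight j * X j.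
Proof.
have w0 y : 0 <= weight y by apply: le_trans (weight_ge1 _).
pose bad y i := (i \in block y) && (i \notin block_free y).
pose Y y i := \sum_(r < L) e r * \sum_(j in S | (j \in block y) && nearby r.+1 i j) X j.
have pt y i : i \in S -> XX y i <= X i - (if i \in block y then X i else 0)
    + (if bad y i then C0 * X i + Y y i else 0).
  move=> iS; rewrite /bad; case: ifP => [iB|/negbT iB] /=; last by rewrite subr0 addr0 XX_out.
  case: ifP => [iF|/negbFE iF]; rewrite subrr add0r; last exact: XX_free.
  apply: (le_trans (XX_bad iS iB iF)); rewrite lerD2l; apply: ler_sum => r _.
  rewrite ler_wpM2l // [leRHS]big_mkcond [leLHS]big_mkcond /=; apply: ler_sum => j _.
  case: (boolP (j \in block_free y)) => [/block_freeP[-> -> _] //|_] /=.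
  by case: ifP.
apply: (@le_trans _ _ (\sum_y weight y * \sum_(i in S) (X i - (if i \in block y then X i else 0)
    + (if bad y i then C0 * X i + Y y i else 0)))).
  by apply: ler_sum => y _; rewrite ler_wpM2l //; apply: ler_sum => i iS; apply: pt.
have -> : \sum_y weight y * \sum_(i in S) (X i - (if i \in block y then X i else 0)
    + (if bad y i then C0 * X i + Y y i else 0)) =
  (\sum_y weight y) * (\sum_(i in S) X i) - \sum_(j in S) cover_weight j * X j
  + \sum_y weight y * \sum_(i in S) (if bad y i then C0 * X i + Y y i else 0).
  rewrite mulr_suml.
  have -> : \sum_(j in S) cover_weight j * X j = \sum_y weight y * \sum_(i in S) (if i \in block y then X i else 0).
    under [RHS]eq_bigr do rewrite mulr_sumr.
    rewrite exchange_big /=; apply: eq_bigr => j _; rewrite /cover_weight mulr_suml big_mkcond /=.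
    by apply: eq_bigr => y _; case: ifP; rewrite ?mulr0.
  rewrite -sumrB -big_split; apply: eq_bigr => y _ /=.
  by rewrite -mulrBr -mulrDr; congr (_ * _); rewrite -sumrB -big_split.
have -> : forall a b c : R, a - (1 - c) * b = a - b + c * b by move=> *; ring.
rewrite lerD2l.
have Wbad i j m : i \in S -> j \in S -> nearby m i j ->
    \sum_(y | (j \in block y) && bad y i) weight y <= 4 * d%:R / K%:R * (1 + m%:R) * cover_weight j.
  exact: sum_bad.
set kap := 4 * d%:R / K%:R in Wbad *.
have kap0 : 0 <= kap by rewrite divr_ge0 ?mulr_ge0.
have cov0 j : 0 <= cover_weight j by apply: sumr_ge0.
(* The sums are exchanged so that each source [j] collects the weight of the blocks that contain it
   and for which [i] is bad. *)
have -> : \sum_y weight y * \sum_(i in S) (if bad y i then C0 * X i + Y y i else 0) =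
  C0 * (\sum_(i in S) X i * \sum_(y | (i \in block y) && bad y i) weight y) +
  \sum_(r < L) e r * \sum_(j in S) X j *
     \sum_(i in S | nearby r.+1 i j) \sum_(y | (j \in block y) && bad y i) weight y.
  transitivity (\sum_(i in S) (\sum_(y | bad y i) weight y * (C0 * X i)
      + \sum_(y | bad y i) weight y * Y y i)).
    under eq_bigr do rewrite mulr_sumr.
    rewrite exchange_big /=; apply: eq_bigr => i _; rewrite -big_split [RHS]big_mkcond /=.
    by apply: eq_bigr => y _; case: ifP; rewrite ?mulr0 // mulrDr.
  rewrite big_split /=; congr (_ + _).
    rewrite mulr_sumr; apply: eq_bigr => i _; rewrite -mulr_suml mulrC -mulrA; congr (_ * (_ * _)).
    by apply: eq_bigl => y; rewrite /bad; case: (i \in block y).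
  transitivity (\sum_(i in S) \sum_(r < L) \sum_(j in S | nearby r.+1 i j)
      e r * (X j * \sum_(y | (j \in block y) && bad y i) weight y)).
    apply: eq_bigr => i _; rewrite /Y.
    transitivity (\sum_(y | bad y i) \sum_(r < L) \sum_(j in S | nearby r.+1 i j)
       (if j \in block y then weight y * (e r * X j) else 0)).
      apply: eq_bigr => y _; rewrite mulr_sumr; apply: eq_bigr => r _.
      rewrite mulr_sumr mulr_sumr [LHS]big_mkcond [RHS]big_mkcond /=; apply: eq_bigr => j _.
      by case: (j \in S); case: (j \in block y); case: (nearby _ _ _).
    rewrite exchange_big /=; apply: eq_bigr => r _; rewrite exchange_big /=; apply: eq_bigr => j _.
    rewrite mulr_sumr mulr_sumr [RHS]big_mkcond [LHS]big_mkcond /=; apply: eq_bigr => y _.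
    case: (j \in block y); case: (bad y i) => //=; ring.
  rewrite exchange_big /=; apply: eq_bigr => r _; rewrite mulr_sumr.
  rewrite (exchange_big_dep (mem S)) /=; last by move=> i j _ /andP[].
  apply: eq_bigr => j jS; rewrite -mulr_sumr -mulr_sumr.
  by congr (_ * (_ * _)); apply: eq_bigl => i; rewrite jS.
have -> : kap * bad_factor * \sum_(j in S) cover_weight j * X j =
  C0 * (\sum_(i in S) X i * (kap * cover_weight i)) +
  \sum_(r < L) e r * \sum_(j in S) X j * (((2 * r + 3)%:R ^+ d) * (kap * (r + 2)%:R * cover_weight j)).
  rewrite /bad_factor mulrDr mulrDl; congr (_ + _).
    by rewrite !mulr_sumr; apply: eq_bigr => i _; ring.
  rewrite [kap * _]mulr_sumr mulr_suml; apply: eq_bigr => r _.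
  by rewrite !mulr_sumr; apply: eq_bigr => j _; ring.
apply: lerD.
  rewrite ler_wpM2l //; apply: ler_sum => i iS; rewrite ler_wpM2l //.
  have := Wbad i i 0%N iS iS; rewrite addr0 mulr1; apply.
  by apply/forallP => k; rewrite addn0 leqnn.
apply: ler_sum => r _; rewrite ler_wpM2l //; apply: ler_sum => j jS; rewrite ler_wpM2l //.
apply: (@le_trans _ _ (\sum_(i in S | nearby r.+1 i j) kap * (r + 2)%:R * cover_weight j)).
  apply: ler_sum => i /andP[iS nij]; have := Wbad i j r.+1 iS jS nij.
  by rewrite (_ : 1 + r.+1%:R = (r + 2)%:R :> R) // addn2 -[r.+2]add1n natrD.
rewrite sumr_const -[_ *+ #|_|]mulr_natl ler_wpM2r ?mulr_ge0 // -natrX ler_nat.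
apply: (@leq_trans #|[set i | nearby r.+1 i j]|).
  by apply: subset_leq_card; apply/subsetP => i; rewrite !inE unfold_in => /andP[].
by apply: (leq_trans (card_nearby _ _)); rewrite (_ : 2 * r.+1 + 1 = 2 * r + 3)%N //; lia.
Qed.

End BlockWeights.

(** * Elementary estimates and crude constants *)

Lemma bernoulli (R : realType) (y : R) t : 0 <= y -> 1 + t%:R * y <= (1 + y) ^+ t.
Proof.
move=> y0; elim: t => [|t IH]; first by rewrite mul0r addr0 expr0.
rewrite exprS -natr1; have y1 : 0 <= 1 + y by rewrite addr_ge0.
apply: (le_trans _ (ler_wpM2l y1 IH)).
have := mulr_ge0 (ler0n R t) (mulr_ge0 y0 y0); lra.
Qed.

Lemma geometric_bound (R : realType) (rho x B : R) : 0 <= rho -> rho < 1 ->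
  (forall t, x <= rho ^+ t * B) -> x <= 0.
Proof.
move=> r0 r1 h; have [r00|rN0] := eqVneq rho 0.
  by have := h 1%N; rewrite r00 expr1 mul0r.
have rp : 0 < rho by rewrite lt_def rN0.
rewrite leNgt; apply/negP => x0.
have Bp : 0 < B by have := lt_le_trans x0 (h 0%N); rewrite expr0 mul1r.
pose y := rho^-1 - 1; have y0 : 0 < y by rewrite subr_gt0 invf_gt1.
pose t := Num.bound (B / (x * y)).
have tB : B / (x * y) < t%:R by rewrite archi_boundP // divr_ge0 ?mulr_ge0 // ltW.
have e1 : 1 + y = rho^-1 by rewrite /y; ring.
have := bernoulli t (ltW y0); rewrite e1 exprVn.
have := h t; rewrite -ler_pdivrMl ?exprn_gt0 // => ht bt.
have h2 : x * (1 + t%:R * y) <= B.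
  by apply: le_trans ht; rewrite mulrC ler_wpM2r // ltW.
move: tB; rewrite ltr_pdivrMr ?mulr_gt0 // => tB.
have e2 : x * (1 + t%:R * y) = x + t%:R * (x * y) by ring.
rewrite e2 in h2; have : B < x + t%:R * (x * y) by apply: (lt_le_trans tB); rewrite lerDr ltW.
by move=> /lt_le_trans/(_ h2); rewrite ltxx.
Qed.

(** Ratios of consecutive terms are nondecreasing, so a first ratio [th > r] would force growth like
    [th ^ t] against the bound [C r ^ t]. *)
Lemma log_convex_decay (R : realType) (b : nat -> R) (r C : R) :
  (forall t, 0 <= b t) -> (forall t, b t.+1 ^+ 2 <= b t * b t.+2) ->
  0 < r -> (forall t, b t <= C * r ^+ t) -> b 1%N <= r * b 0%N.
Proof.
move=> b0 bconv r0 bC; have [e|bN0] := eqVneq (b 0%N) 0.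
  have := bconv 0%N; rewrite e mul0r mulr0 => h.
  by rewrite le_eqVlt -sqrf_eq0 eq_le h sqr_ge0.
have bp : 0 < b 0%N by rewrite lt_def bN0 b0.
rewrite leNgt; apply/negP => lt1; pose th := b 1%N / b 0%N.
have rth : r < th by rewrite /th ltr_pdivlMr.
have th0 : 0 < th by apply: lt_trans rth.
have step t : 0 < b t /\ th * b t <= b t.+1.
  elim: t => [|t [bt ht]]; first by split=> //; rewrite /th divfK.
  have bt1 : 0 < b t.+1 by apply: lt_le_trans ht; rewrite mulr_gt0.
  split=> //; rewrite -(ler_pM2l bt); apply: le_trans (bconv t).
  by rewrite mulrCA mulrA expr2 ler_wpM2r // ltW.
have grow t : th ^+ t * b 0%N <= b t.
  elim: t => [|t IH]; first by rewrite expr0 mul1r.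
  by apply: le_trans (step t).2; rewrite exprS -mulrA ler_wpM2l // ltW.
have : b 0%N <= 0.
  apply: (@geometric_bound _ (r / th) _ C).
  - by apply: divr_ge0; apply: ltW.
  - by rewrite ltr_pdivrMr // mul1r.
  - move=> t; rewrite expr_div_n mulrAC ler_pdivlMr ?exprn_gt0 // mulrC.
    by apply: (le_trans (grow t)); rewrite mulrC.
by rewrite leNgt bp.
Qed.

(** * Summability and constants for regions of bounded size *)

Section Uniform.
Variables (R : realType) (d q : nat) (beta a b : R).
Hypotheses (d_gt0 : (0 < d)%N) (q_gt0 : (0 < q)%N).
Hypotheses (beta_gt0 : 0 < beta) (a_gt0 : 0 < a) (b_gt0 : 0 < b).
Hypothesis mixing : forall s, spatial_mixing d s q beta a b.
Local Notation M := (@flip_bound R d beta).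
Local Notation eps := (@eps R d beta a b).
Local Notation gw l := (@gw R d l q beta).
Local Notation E S := (cE (gw _) (eqoff S)).

Let M1 : 1 <= M. Proof. exact: flip_bound_ge1. Qed.
Let M0 : 0 < M. Proof. exact: lt_le_trans M1. Qed.
Let M0' : 0 <= M. Proof. exact: ltW. Qed.
Let b0' : 0 <= b. Proof. exact: ltW. Qed.
Let eqv l A : equivalence_rel (@eqoff (vertex d l) q A). Proof. exact: eqoff_equiv. Qed.
Let gw0 l := @gw_gt0 R d l q beta.

Lemma eps_series : exists2 C : R, 0 <= C & forall L,
  \sum_(r < L) eps r * (r + 2)%:R * (2 * r + 3)%:R ^+ d <= C.
Proof.
(* [m] is the degree of the polynomial factor, bounded by [y ^ m] with [y = 2 r + 3]. By the choice
   of [c], the [m]-th power of [expR (c * y)] is [expR (a / 8 * y)], which uses up half of the decay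
   [expR (- (a / 2) * r)]. *)
pose m := (2 * d).+1; pose c := a / (8 * m%:R).
have mR : 0 < m%:R :> R by rewrite ltr0n.
have c0 : 0 < c by rewrite divr_gt0 // mulr_gt0.
pose A := M ^+ 2 * expR (2 * a) * (1 + 2 * b).
have A0 : 0 <= A by rewrite !mulr_ge0 ?exprn_ge0 ?expR_ge0 ?addr_ge0 ?mulr_ge0.
pose B := A * (c^-1 ^+ m * expR (3 * a / 8)).
have B0 : 0 <= B.
  by apply: mulr_ge0 => //; rewrite mulr_ge0 ?exprn_ge0 ?invr_ge0 ?expR_ge0 ?(ltW c0).
pose rho := expR (- (a / 4)).
have rho1 : rho < 1 by rewrite expR_lt1 oppr_lt0 divr_gt0.
have rho0 : 0 <= rho by rewrite expR_ge0.
have term r : eps r * (r + 2)%:R * (2 * r + 3)%:R ^+ d <= B * rho ^+ r.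
  have -> : eps r * (r + 2)%:R * (2 * r + 3)%:R ^+ d =
     A * ((2 * r + 3)%:R ^+ d * (2 * r + 3)%:R ^+ d * (r + 2)%:R * expR (- (a / 2) * r%:R)).
    by rewrite /eps /A; ring.
  rewrite /B -[leRHS]mulrA ler_wpM2l //; set y := (2 * r + 3)%:R.
  have y0 : 0 <= y by rewrite /y.
  apply: (@le_trans _ _ (y ^+ m * expR (- (a / 2) * r%:R))).
    rewrite ler_wpM2r ?expR_ge0 // /m exprS mulrC mul2n -addnn exprD ler_wpM2r ?mulr_ge0 ?exprn_ge0 //.
    by rewrite /y ler_nat; clear; lia.
  have ycy : y <= c^-1 * expR (c * y).
    rewrite mulrC ler_pdivlMr // mulrC; apply: le_trans (expR_ge1Dx _); lra.
  apply: (@le_trans _ _ ((c^-1 * expR (c * y)) ^+ m * expR (- (a / 2) * r%:R))).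
    by rewrite ler_wpM2r ?expR_ge0 // lerXn2r // nnegrE ?(le_trans y0).
  rewrite exprMn -[leLHS]mulrA -[leRHS]mulrA; apply: ler_wpM2l.
    by rewrite exprn_ge0 ?invr_ge0 // ltW.
  rewrite -(expRM_natl m (c * y)) -(expRM_natl r (- (a / 4)) : _ = rho ^+ r) -!expRD ler_expR.
  have -> : m%:R * (c * y) = a / 8 * y by rewrite /c; field; rewrite gt_eqF.
  by rewrite le_eqVlt; apply/orP; left; apply/eqP; rewrite /y natrD natrM; field.
exists (B / (1 - rho)); first by rewrite divr_ge0 // subr_ge0 ltW.
move=> L; apply: (@le_trans _ _ (\sum_(r < L) B * rho ^+ r)); first by apply: ler_sum => r _.
rewrite -mulr_sumr ler_wpM2l // -[leRHS]mul1r ler_pdivlMr ?subr_gt0 //.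
have := subrX1 rho L; have := exprn_ge0 L rho0; rewrite mulrC; lra.
Qed.

Lemma weight_eqoff l (S : {set vertex d l}) s t : eqoff S s t -> gw l t <= M ^+ #|S| * gw l s.
Proof.
have [n] := ubnP #|S|; elim: n S t => // n IH S t Sn st.
have [S0|/set0Pn[j jS]] := eqVneq S set0.
  by move: st; rewrite S0 eqoff0 cards0 expr0 mul1r => /eqP ->.
pose t' := upd t j (s j).
have st' : eqoff (S :\ j) s t'.
  apply/eqoffP => v; rewrite !inE negb_and negbK updE.
  by case: eqP => [->|_] //= vS; move/eqoffP: st; apply.
have cS : #|S| = #|S :\ j|.+1 by rewrite (cardsD1 j S) jS.
have Sn' : (#|S :\ j| < n)%N by clear -Sn cS; lia.
have {}IH := IH (S :\ j) t' Sn' st'.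
have := flip_ratio_le beta_gt0 j (t j) t'; rewrite /flip_ratio /t' upd_upd upd_id.
rewrite ler_pdivrMr ?gw_gt0 // => h; apply: (le_trans h).
by rewrite cS exprS -mulrA ler_wpM2l // ltW.
Qed.

Lemma card_class l (S : {set vertex d l}) (s : spins d l q) :
  \sum_(t | eqoff S s t) 1 = q%:R ^+ #|S| :> R.
Proof.
have [n] := ubnP #|S|; elim: n S => // n IH S Sn.
have [->|/set0Pn[j jS]] := eqVneq S set0.
  rewrite cards0 expr0 (eq_bigl (pred1 s)) ?big_pred1_eq // => t.
  by rewrite eqoff0 eq_sym.
have cS : #|S| = #|S :\ j|.+1 by rewrite (cardsD1 j S) jS.
rewrite -{1}(setD1K jS) sum_eqoffU1 ?inE ?eqxx //.
under eq_bigr do rewrite sumr_const card_ord -[_ *+ q]mulr_natl.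
by rewrite -mulr_sumr IH ?cS ?exprS //; clear -Sn cS; lia.
Qed.

(** Lower bound for the conditional probability of any configuration on at most [m] free sites:
    there are at most [q^m] of them, and their weights differ by factors of at most [M^m]. *)
Definition cell (m : nat) : R := ((q%:R * M) ^+ m)^-1.

Let qM : 1 <= q%:R * M. Proof. by rewrite mulr_ege1 // ler1n. Qed.

Lemma cell_gt0 m : 0 < cell m.
Proof. by rewrite invr_gt0 exprn_gt0 // (lt_le_trans _ qM). Qed.

Lemma cell_le1 m : cell m <= 1.
Proof. by rewrite invf_le1 ?exprn_ege1 // exprn_gt0 // (lt_le_trans _ qM). Qed.

Lemma cell_weight l (S : {set vertex d l}) m s t : (#|S| <= m)%N -> eqoff S s t ->
  cell m * (\sum_(u | eqoff S s u) gw l u) <= gw l t.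
Proof.
move=> Sm st; rewrite ler_pdivrMl ?exprn_gt0 ?(lt_le_trans _ qM) //.
apply: (@le_trans _ _ (\sum_(u | eqoff S s u) M ^+ m * gw l t * 1)).
  apply: ler_sum => u su; rewrite mulr1.
  apply: (@le_trans _ _ (M ^+ #|S| * gw l t)).
    by apply: weight_eqoff; rewrite -(sim_congr (eqv S) st).
  by rewrite ler_wpM2r ?(ltW (gw0 _)) // ler_weXn2l.
rewrite -mulr_sumr card_class exprMn mulrC -[leRHS]mulrA; apply: ler_wpM2r.
  by rewrite mulr_ge0 ?exprn_ge0 // ltW.
by rewrite ler_weXn2l // ler1n.
Qed.

Definition crude (m : nat) : R := (2 * q%:R) ^+ m / cell m.

Lemma crude_ge0 m : 0 <= crude m.
Proof. by rewrite divr_ge0 ?exprn_ge0 ?mulr_ge0 // ltW // cell_gt0. Qed.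

(** The weights are dropped, [crude_poincare_sum] is applied, and they are restored through [cell].
    The constant is exponential in [m], hence meant for blocks. *)
Lemma crude_var l (S : {set vertex d l}) m g s : (#|S| <= m)%N ->
  cVar (gw l) (eqoff S) g s <= crude m * \sum_(j in S) E S (Gam j g) s.
Proof.
move=> Sm; apply: (le_trans (cVar_le_sqr (@gw0 l) (eqv S) _ _ (g s))).
have W0 := sim_weight_gt0 (@gw0 l) (eqv S) s.
apply: (@le_trans _ _ (\sum_(t | eqoff S s t) (g t - g s) ^+ 2)).
  rewrite ler_pdivrMr // mulr_suml; apply: ler_sum => t st.
  rewrite mulrC ler_wpM2l ?sqr_ge0 // (bigD1 t) //= lerDl sumr_ge0 // => u _.
  exact/ltW/gw0.
apply: (le_trans (crude_poincare_sum _ _ _)).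
have G0 (j : vertex d l) t : 0 <= Gam j g t by apply: Gam_ge0.
rewrite /crude -mulrA; apply: ler_pM; rewrite ?exprn_ge0 ?mulr_ge0 //.
- by rewrite sumr_ge0 // => j _; rewrite sumr_ge0.
- rewrite ler_weXn2l //; have : 1 <= q%:R :> R by rewrite ler1n.
  lra.
rewrite mulr_sumr; apply: ler_sum => j _.
rewrite ler_pdivlMl ?cell_gt0 // /cE ler_pdivlMr // mulrAC mulr_sumr.
apply: ler_sum => t st; rewrite ler_wpM2r //; exact: cell_weight.
Qed.

Lemma crude_ent l (S : {set vertex d l}) m f s : (#|S| <= m)%N -> (forall t, 0 <= f t) ->
  cEnt (gw l) (eqoff S) f s <=
    4 / cell m * crude m * \sum_(j in S) E S (Gam j (fun t => Num.sqrt (f t))) s.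
Proof.
move=> Sm f0.
apply: (le_trans (cEnt_le_cVar_sqrt (@gw0 l) (eqv S) (fun t _ => f0 t) (cell_gt0 m) (cell_le1 m) _)).
  by move=> t; apply: cell_weight.
rewrite -[leRHS]mulrA; apply: ler_wpM2l; last exact: crude_var.
by rewrite divr_ge0 // ltW // cell_gt0.
Qed.

End Uniform.

(** * Spectral gap and log-Sobolev inequality for the Potts measure *)

Section FunctionalInequalities.
Variables (R : realType) (d q : nat) (beta a b : R).
Hypotheses (d_gt0 : (0 < d)%N) (q_gt0 : (0 < q)%N).
Hypotheses (beta_gt0 : 0 < beta) (a_gt0 : 0 < a) (b_gt0 : 0 < b).
Hypothesis mixing : forall s, spatial_mixing d s q beta a b.
Local Notation M := (@flip_bound R d beta).
Local Notation eps := (@eps R d beta a b).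
Local Notation gw l := (@gw R d l q beta).
Local Notation E S := (cE (gw _) (eqoff S)).
Local Notation crude := (@crude R d q beta).
Local Notation cell := (@cell R d q beta).

Let eqv l A : equivalence_rel (@eqoff (vertex d l) q A). Proof. exact: eqoff_equiv. Qed.
Let gw0 l := @gw_gt0 R d l q beta.
Let M1 : 1 <= M. Proof. exact: flip_bound_ge1. Qed.

Section Neutral.
Variables (l : nat) (x : 'I_d -> nat) (L : nat) (T : {set vertex d l}) (i : vertex d l).
Hypotheses (rT : region x L T) (iC : i \notin cube l x L).

Lemma neutral_notin : i \notin T.
Proof. by apply: contra iC; apply: (subsetP (region_sub rT)). Qed.

(** A site outside the cube has no neighbour in [T]; its flip ratio is constant on the class and no
    density appears. *)
Lemma E_neutral f s c : E T f (upd s i c) = E T (fun t => f (upd t i c)) s.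
Proof.
apply: (E_upd_neutral (@gw0 l)) => [|t /eqoffP st]; first exact: neutral_notin.
apply: flip_ratio_local => [|u iu]; first by rewrite st // neutral_notin.
by rewrite st //; apply: contra iC => uT; apply: (region_nbr rT uT); rewrite adj_sym.
Qed.

Lemma osc_neutral f : osc i (E T f) <= osc i f.
Proof.
apply: osc_le => [|s c]; first exact: osc_ge0.
rewrite E_neutral -cEB; apply: (le_trans (cE_norm (@gw0 l) (eqv T) _ _)).
rewrite -[leRHS](cE_cst (@gw0 l) (eqv T) _ s); apply: (cE_le (@gw0 l) (eqv T)) => t _.
exact: le_osc.
Qed.

Lemma Gam_neutral g s :
  Gam i (fun t => Num.sqrt (E T (fun u => g u ^+ 2) t)) s <= E T (Gam i g) s.
Proof.
rewrite /Gam (cE_sum (@gw0 l) (eqv T)); apply: ler_sum => c _.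
by rewrite E_neutral; apply: (cE_sqrt_dist (@gw0 l) (eqv T)).
Qed.

End Neutral.

Lemma bound_nat (r : R) : exists2 n : nat, (0 < n)%N & r <= n%:R.
Proof.
exists (Num.bound `|r|).+1 => //; apply: (le_trans (ler_norm _)).
by apply/ltW/(lt_le_trans (archi_boundP (normr_ge0 r))); rewrite ler_nat.
Qed.

Lemma kappa_choice (A : R) : exists2 K : nat, (0 < K)%N & 4 * d%:R / K%:R * A <= 1 / 2.
Proof.
have [K K0 hK] := bound_nat (8 * d%:R * A); exists K => //.
have KR : 0 < K%:R :> R by rewrite ltr0n.
rewrite mulrAC ler_pdivrMr //; lra.
Qed.

(** * Contraction by weighted block averages on a large cube *)

Section LargeCube.
Variables (K N l : nat) (x : 'I_d -> nat) (S : {set vertex d l}) (s : spins d l q).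
Hypotheses (K_gt0 : (0 < K)%N) (LN : (K * K <= N)%N) (rS : region x (N + K * K) S).
Local Notation index := {ffun 'I_d -> 'I_N.+1}.
Local Notation free := (@block_free d l x K N S).
Local Notation W := (@weight R d K N).
Local Notation cov := (@cover_weight R d l x K N).
Local Notation L := (K * K)%N.

Let freeS (y : index) : subrel (eqoff (q := q) (free y)) (eqoff S).
Proof. exact/eqoff_sub/block_free_sub. Qed.

Definition Ztot : R := \sum_(y : index) W y.

Let W1 (y : index) : 1 <= W y. Proof. exact: weight_ge1. Qed.
Let W0 (y : index) : 0 <= W y. Proof. exact: le_trans (W1 y). Qed.

Lemma Ztot_ge1 : 1 <= Ztot.
Proof.
rewrite /Ztot (bigD1 [ffun=> ord0]) //= -[leLHS]addr0 lerD // sumr_ge0 //.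
Qed.

Let Z0 : 0 < Ztot. Proof. exact: lt_le_trans Ztot_ge1. Qed.

Definition avg (f : spins d l q -> R) (t : spins d l q) : R :=
  \sum_(y : index) W y / Ztot * E (free y) f t.

Lemma weight_sum1 : \sum_(y : index) W y / Ztot = 1.
Proof. by rewrite -mulr_suml mulfV // gt_eqF. Qed.

Lemma E_avg f t : E S (avg f) t = E S f t.
Proof.
rewrite /avg (cE_sum (@gw0 l) (eqv S)).
rewrite (eq_bigr (fun y => W y / Ztot * E S f t)) => [|y _].
  by rewrite -mulr_suml weight_sum1 mul1r.
by rewrite cEZ (cE_tower (@gw0 l) (eqv _) (eqv S)).
Qed.

Lemma avg_selfadjoint f g t : E S (fun u => f u * avg g u) t = E S (fun u => avg f u * g u) t.
Proof.
transitivity (\sum_(y : index) W y / Ztot * E S (fun u => f u * E (free y) g u) t).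
  rewrite (@cE_eq _ _ _ _ _ (fun u => \sum_(y : index) W y / Ztot * (f u * E (free y) g u))).
    by rewrite (cE_sum (@gw0 l) (eqv S)); apply: eq_bigr => y _; rewrite cEZ.
  by move=> u _; rewrite /avg mulr_sumr; apply: eq_bigr => y _; rewrite mulrCA.
transitivity (\sum_(y : index) W y / Ztot * E S (fun u => E (free y) f u * g u) t).
  apply: eq_bigr => y _; congr (_ * _).
  rewrite (cE_selfadjoint (@gw0 l) (eqv _) (eqv S)) //.
  rewrite [RHS](@cE_eq _ _ _ _ _ (fun u => g u * E (free y) f u)); last by move=> *; rewrite mulrC.
  rewrite [RHS](cE_selfadjoint (@gw0 l) (eqv _) (eqv S)) //.
  by apply: cE_eq => u _; rewrite mulrC.
rewrite [RHS](@cE_eq _ _ _ _ _ (fun u => \sum_(y : index) W y / Ztot * (E (free y) f u * g u))).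
  by rewrite (cE_sum (@gw0 l) (eqv S)); apply: eq_bigr => y _; rewrite cEZ.
by move=> u _; rewrite /avg mulr_suml; apply: eq_bigr => y _; rewrite mulrA.
Qed.

Lemma block_sum_half (X : vertex d l -> R) (XX : index -> vertex d l -> R) (C0 : R) (e : nat -> R) :
  (forall i, 0 <= X i) -> 0 <= C0 -> (forall r, 0 <= e r) ->
  (forall y i, i \in free y -> XX y i <= 0) ->
  (forall y i, i \in S -> i \notin block l x K y -> XX y i <= X i) ->
  (forall y i, i \in S -> i \in block l x K y -> i \notin free y ->
     XX y i <= C0 * X i + \sum_(r < L) e r * \sum_(j in free y | nearby r.+1 i j) X j) ->
  4 * d%:R / K%:R * bad_factor d K C0 e <= 1 / 2 ->
  \sum_y W y * \sum_(i in S) XX y i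
    <= Ztot * (\sum_(i in S) X i) - 1 / 2 * \sum_(j in S) cov j * X j.
Proof.
move=> X0 C00 e0 h1 h2 h3 hA.
apply: (le_trans (block_sum K_gt0 LN rS X0 C00 e0 h1 h2 h3)).
rewrite lerD2l lerN2 ler_wpM2r //; last by lra.
by apply: sumr_ge0 => j jS; rewrite mulr_ge0 // (le_trans _ (cover_weight_ge1 R K_gt0 LN rS jS)).
Qed.

Lemma sum_cover_ge (X : vertex d l -> R) : (forall i, 0 <= X i) ->
  \sum_(i in S) X i <= \sum_(j in S) cov j * X j.
Proof.
move=> X0; apply: ler_sum => j jS; rewrite -[leLHS]mul1r ler_wpM2r //.
exact: (cover_weight_ge1 R K_gt0 LN rS jS).
Qed.

Definition tosc (f : spins d l q -> R) : R := \sum_(i in S) osc i f.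
(** The loss [1 / 2] comes from [block_sum_half] and the division by [Ztot] from normalising the
    average; [cov j >= 1] turns the weighted gradient sum into the plain one. *)
Definition rho : R := 1 - 1 / 2 / Ztot.

Lemma tosc_ge0 f : 0 <= tosc f.
Proof. by apply: sumr_ge0 => i _; apply: osc_ge0. Qed.

Lemma rho_gt0 : 0 < rho.
Proof. by rewrite /rho subr_gt0 ltr_pdivrMr // mul1r; have := Ztot_ge1; lra. Qed.

Lemma rho_lt1 : rho < 1.
Proof. by rewrite /rho ltrBlDr ltrDl divr_gt0. Qed.

Lemma osc_avg i f : osc i (avg f) <= \sum_(y : index) W y / Ztot * osc i (E (free y) f).
Proof.
have c0 (y : index) : 0 <= W y / Ztot by rewrite divr_ge0 // ltW.
apply: osc_le => [|t c]; first by apply: sumr_ge0 => y _; rewrite mulr_ge0 // osc_ge0.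
rewrite /avg -sumrB; apply: (le_trans (ler_norm_sum _ _ _)); apply: ler_sum => y _.
by rewrite -mulrBr normrM (ger0_norm (c0 y)) ler_wpM2l // le_osc.
Qed.

(** [block_osc] supplies the gradient bound at bad sites. It has [C0 = 1] and uses no spectral gap,
    which is why oscillations can start the argument. *)
Lemma tosc_avg f : 4 * d%:R / K%:R * bad_factor d K 1 eps <= 1 / 2 -> tosc (avg f) <= rho * tosc f.
Proof.
move=> hA; have eps0 r := eps_ge0 d beta a b_gt0 r.
have := @block_sum_half (fun i => osc i f) (fun y i => osc i (E (free y) f)) 1 eps
  (fun i => osc_ge0 i f) ler01 eps0.
move=> /(_ _ _ _ hA) h.
have {}h : \sum_(y : index) W y * \sum_(i in S) osc i (E (free y) f) <=
   Ztot * tosc f - 1 / 2 * \sum_(j in S) cov j * osc j f.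
  apply: h => y i.
  - move=> iy; apply: osc_le => // t c; by rewrite E_inv_mem // subrr normr0.
  - by move=> iS iy; apply: (osc_neutral (block_region K_gt0 LN rS y)).
  - move=> iS iy iF; apply: osc_le => [|t c].
      rewrite mul1r addr_ge0 ?osc_ge0 // sumr_ge0 // => r _; rewrite mulr_ge0 // sumr_ge0 // => j _.
      exact: osc_ge0.
    rewrite mul1r.
    exact: (block_osc d_gt0 beta_gt0 a_gt0 b_gt0 mixing (block_region K_gt0 LN rS y) iy iF).
have := sum_cover_ge (fun i => osc_ge0 i f); rewrite -/(tosc f) => h'.
apply: (@le_trans _ _ ((\sum_(y : index) W y * \sum_(i in S) osc i (E (free y) f)) / Ztot)).
  rewrite mulr_suml; under [leRHS]eq_bigr do rewrite mulrAC mulr_sumr.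
  by rewrite exchange_big /=; apply: ler_sum => i _; apply: osc_avg.
rewrite ler_pdivrMr //; apply: (le_trans h).
have -> : rho * tosc f * Ztot = Ztot * tosc f - 1 / 2 * tosc f by rewrite /rho; field; rewrite gt_eqF.
by rewrite lerD2l lerN2 ler_wpM2l.
Qed.

(* [r |-> E S ((avg^r g)^2)] is log-convex because [avg] is self-adjoint, so the
   exponential decay of the total oscillation forces its first ratio below 1. *)
Lemma large_gap f : 4 * d%:R / K%:R * bad_factor d K 1 eps <= 1 / 2 ->
  cVar (gw l) (eqoff S) f s <=
    2 * crude ((2 * L + 1) ^ d) * (K%:R * (L + 1)%:R) ^+ d * \sum_(j in S) E S (Gam j f) s.
Proof.
move=> hA; pose m := E S f s; pose g t := f t - E S f t.
have gmean t : E S g t = 0.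
  rewrite /g cEB (cE_inv (@gw0 l) (eqv S) (f := E S f)) ?subrr // => u tu.
  by rewrite (cE_class _ (eqv S) _ tu).
pose it n := iter n avg g.
have itmean n t : E S (it n) t = 0 by elim: n => [|n IH] /=; [exact: gmean | rewrite E_avg].
pose bb n := E S (fun t => it n t ^+ 2) s.
have toscit n : tosc (it n) <= rho ^+ n * tosc g.
  elim: n => [|n IH]; first by rewrite expr0 mul1r.
  apply: (le_trans (tosc_avg (it n) hA)); rewrite exprS -mulrA ler_wpM2l //.
  exact/ltW/rho_gt0.
have itbound n t : `|it n t| <= tosc (it n).
  rewrite -[it n t]subr0 -(itmean n t) -{1}(cE_cst (@gw0 l) (eqv S) (it n t) t) -cEB.
  apply: (le_trans (cE_norm (@gw0 l) (eqv S) _ _)).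
  rewrite -[leRHS](cE_cst (@gw0 l) (eqv S) _ t); apply: (cE_le (@gw0 l) (eqv S)) => u tu.
  by rewrite distrC; apply: eqoff_osc.
have bb0 n : 0 <= bb n by apply: (cE_ge0 (@gw0 l) (eqv S)) => t _; apply: sqr_ge0.
have r0 := rho_gt0.
have decay : bb 1%N <= rho ^+ 2 * bb 0%N.
  apply: (@log_convex_decay _ bb _ (tosc g ^+ 2)) => //; last 2 first.
  - exact: exprn_gt0.
  - move=> n; rewrite -[leRHS](cE_cst (@gw0 l) (eqv S) _ s).
    apply: (cE_le (@gw0 l) (eqv S)) => t _.
    rewrite -exprM mulnC exprM -exprMn -[leLHS]ger0_norm ?sqr_ge0 // normrX.
    rewrite lerXn2r ?nnegrE ?mulr_ge0 ?tosc_ge0 ?exprn_ge0 ?(ltW r0) //.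
    by rewrite mulrC (le_trans (itbound n t)).
  - move=> n; rewrite /bb.
    have -> : E S (fun t => it n.+1 t ^+ 2) s = E S (fun t => it n t * it n.+2 t) s.
      rewrite [it n.+2]/(avg (it n.+1)) avg_selfadjoint.
      by apply: cE_eq => t _; exact: mulrC.
    exact: (cE_cauchy (@gw0 l) (eqv S)).
have inner : E S (fun t => g t * avg g t) s <= rho * bb 0%N.
  apply: (le_trans (ler_norm _)); apply: (le_trans (cE_cauchy_sqrt (@gw0 l) (eqv S) _ _ _)).
  rewrite -/(bb 0%N) -[E S (fun t => avg g t ^+ 2) s]/(bb 1%N).
  apply: (@le_trans _ _ (Num.sqrt (bb 0%N) * Num.sqrt (rho ^+ 2 * bb 0%N))).
    by rewrite ler_wpM2l ?sqrtr_ge0 // ler_wsqrtr.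
  have -> : Num.sqrt (rho ^+ 2 * bb 0%N) = rho * Num.sqrt (bb 0%N).
    by rewrite sqrtrM ?sqr_ge0 // sqrtr_sqr ger0_norm // ltW.
  by rewrite mulrCA -expr2 sqr_sqrtr.
have var : cVar (gw l) (eqoff S) f s = bb 0%N.
  rewrite (cVarE (@gw0 l) (eqv S)); apply: cE_eq => t st.
  by rewrite /it /= /g (cE_class _ (eqv S) _ st).
(* The Dirichlet form of [avg] is the weighted mean of the block variances, and blocks have bounded
   size, so the crude inequality applies to each. *)
have dirichlet : bb 0%N - E S (fun t => g t * avg g t) s =
    \sum_(y : index) W y / Ztot * E S (cVar (gw l) (eqoff (free y)) f) s.
  have -> : E S (fun t => g t * avg g t) s =
     \sum_(y : index) W y / Ztot * E S (fun t => g t * E (free y) g t) s.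
    rewrite (@cE_eq _ _ _ _ _ (fun u => \sum_(y : index) W y / Ztot * (g u * E (free y) g u))).
      by rewrite (cE_sum (@gw0 l) (eqv S)); apply: eq_bigr => y _; rewrite cEZ.
    by move=> u _; rewrite /avg mulr_sumr; apply: eq_bigr => y _; rewrite mulrCA.
  rewrite -[bb 0%N]mul1r -weight_sum1 mulr_suml -sumrB; apply: eq_bigr => y _.
  rewrite -mulrBr; congr (_ * _).
  rewrite (@cE_eq _ _ _ _ (cVar _ _ f) (cVar (gw l) (eqoff (free y)) g)); last first.
    move=> t _; rewrite /g (cVar_shift (@gw0 l) (eqv _)) // => u tu.
    by rewrite (cE_class _ (eqv S) _ (freeS tu)).
  rewrite /cVar cEB (cE_tower (@gw0 l) (eqv _) (eqv S)) //; congr (_ - _).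
  rewrite (cE_selfadjoint (@gw0 l) (eqv _) (eqv S)) //.
have crude_y y t : cVar (gw l) (eqoff (free y)) f t <=
    crude ((2 * L + 1) ^ d) * \sum_(j in free y) E (free y) (Gam j f) t.
  apply: crude_var => //; exact: (region_card (block_region K_gt0 LN rS y)).
set CL := crude _ in crude_y *; set Kd := (_ * _) ^+ d.
have CL0 : 0 <= CL by apply: crude_ge0.
have EG0 j : 0 <= E S (Gam j f) s by apply: (cE_ge0 (@gw0 l) (eqv S)) => t _; apply: Gam_ge0.
have step : bb 0%N - E S (fun t => g t * avg g t) s <=
   CL * (\sum_(j in S) cov j * E S (Gam j f) s) / Ztot.
  rewrite dirichlet; apply: (@le_trans _ _ (CL * (\sum_(y : index) W y * \sum_(j in free y) E S (Gam j f) s) / Ztot)).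
    rewrite mulr_sumr mulr_suml; apply: ler_sum => y _.
    rewrite [leRHS](_ : _ = W y / Ztot * (CL * \sum_(j in free y) E S (Gam j f) s)); last by ring.
    apply: ler_wpM2l; first by rewrite divr_ge0 // ltW.
    apply: (@le_trans _ _ (E S (fun t => CL * \sum_(j in free y) E (free y) (Gam j f) t) s)).
      by apply: (cE_le (@gw0 l) (eqv S)) => t _; apply: crude_y.
    rewrite cEZ ler_wpM2l // (cE_sum (@gw0 l) (eqv S)); apply: ler_sum => j _.
    by rewrite (cE_tower (@gw0 l) (eqv _) (eqv S)).
  rewrite ler_wpM2r ?invr_ge0 ?(ltW Z0) // ler_wpM2l //.
  exact: sum_free_cover.
have covle : \sum_(j in S) cov j * E S (Gam j f) s <= Kd * \sum_(j in S) E S (Gam j f) s.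
  by rewrite mulr_sumr; apply: ler_sum => j jS; rewrite ler_wpM2r // (cover_weight_le R K_gt0 LN rS).
rewrite var.
have h1 : 1 / 2 / Ztot * bb 0%N <= bb 0%N - E S (fun t => g t * avg g t) s.
  move: inner; rewrite /rho; lra.
have := le_trans h1 step; rewrite mulrAC ler_pM2r ?invr_gt0 // => h2.
have := ler_wpM2l CL0 covle; lra.
Qed.

(** * From the spectral gap to the log-Sobolev inequality *)

Section EntropyStep.
Variables (Cs Cg : R).
Hypotheses (Cs_ge0 : 0 <= Cs) (Cg_ge0 : 0 <= Cg).
Hypothesis eps_sum : \sum_(r < L) eps r <= Cs.
Hypothesis gap : forall l x m (T : {set vertex d l}) g t, region x m T ->
  cVar (gw l) (eqoff T) g t <= Cg * \sum_(j in T) E T (Gam j g) t.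
Local Notation e := (fun r => 8 * q%:R * Cs * Cg * eps r).
Hypothesis K_large : 4 * d%:R / K%:R * bad_factor d K (2 * q%:R * M ^+ 2) e <= 1 / 2.

Definition fisher (f : spins d l q -> R) : R :=
  \sum_(i in S) E S (Gam i (fun t => Num.sqrt (f t))) s.

Lemma fisher_term_ge0 i f : 0 <= E S (Gam i f) s.
Proof. by apply: (cE_ge0 (@gw0 l) (eqv S)) => t _; apply: Gam_ge0. Qed.

Lemma fisher_ge0 f : 0 <= fisher f.
Proof. by apply: sumr_ge0 => i _; apply: fisher_term_ge0. Qed.

(** [block_sqrt] summed over the [q] new spins and averaged over [S]. The uniform gap enters here,
    through the variances on the nested cubes. *)
Lemma fisher_bad (y : index) i f : (forall t, 0 <= f t) ->
  i \in block l x K y -> i \notin free y ->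
  E S (Gam i (fun t => Num.sqrt (E (free y) f t))) s <=
    2 * q%:R * M ^+ 2 * E S (Gam i (fun t => Num.sqrt (f t))) s +
    \sum_(r < L) e r * \sum_(j in free y | nearby r.+1 i j) E S (Gam j (fun t => Num.sqrt (f t))) s.
Proof.
move=> f0 iy iF; pose g t := Num.sqrt (f t).
have eps0 r := eps_ge0 d beta a b_gt0 r.
have fg T t : E T f t = E T (fun t => g t ^+ 2) t.
  by apply: cE_eq => u _; rewrite sqr_sqrtr.
pose rhs t := 2 * M ^+ 2 * E (free y) (Gam i g) t + 8 * Cs * Cg *
   \sum_(r < L) eps r * \sum_(j in free y | nearby r.+1 i j) E (free y) (Gam j g) t.
have EyG j t : 0 <= E (free y) (Gam j g) t.
  by apply: (cE_ge0 (@gw0 l) (eqv _)) => u _; apply: Gam_ge0.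
have pt t : Gam i (fun t => Num.sqrt (E (free y) f t)) t <= q%:R * rhs t.
  apply: (@le_trans _ _ (\sum_(c < q) rhs t)); last by rewrite sumr_const card_ord -[_ *+ q]mulr_natl.
  apply: ler_sum => c _ /=; rewrite !fg.
  apply: (le_trans (block_sqrt d_gt0 beta_gt0 a_gt0 b_gt0 mixing
    (block_region K_gt0 LN rS y) iy iF (C := Cg) (g := g) c t Cg_ge0 _)).
    by move=> x' m T t' rT _; apply: gap rT.
  rewrite lerD2l; apply: ler_wpM2r.
    by apply: sumr_ge0 => r _; rewrite mulr_ge0 // sumr_ge0.
  by rewrite ler_wpM2r // ler_wpM2l.
apply: (le_trans (cE_le (@gw0 l) (eqv S) (fun t _ => pt t))).
have tow j : E S (E (free y) (Gam j g)) s = E S (Gam j g) s.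
  by rewrite (cE_tower (@gw0 l) (eqv _) (eqv S)).
have sum_eq : E S (fun t => \sum_(r < L) eps r * \sum_(j in free y | nearby r.+1 i j) E (free y) (Gam j g) t) s
    = \sum_(r < L) eps r * \sum_(j in free y | nearby r.+1 i j) E S (Gam j g) s.
  rewrite (cE_sum (@gw0 l) (eqv S)); apply: eq_bigr => r _.
  rewrite cEZ (cE_sum (@gw0 l) (eqv S)); congr (_ * _); apply: eq_bigr => j _; exact: tow.
rewrite cEZ /rhs cED !cEZ tow sum_eq le_eqVlt; apply/orP; left; apply/eqP.
rewrite mulrDr; congr (_ + _); first by ring.
by rewrite mulrA mulr_sumr; apply: eq_bigr => r _; rewrite mulrA; congr (_ * _); ring.
Qed.

Let m := ((2 * L + 1) ^ d)%N.
Let CL := 4 / cell m * crude m.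

Let CL0 : 0 <= CL.
Proof. by rewrite mulr_ge0 ?crude_ge0 // divr_ge0 // ltW // cell_gt0. Qed.

(* Iterated from the crude constant of [S], which depends on its size, this brings
   the constant down to [2 * CL]. *)
Lemma entropy_improve A : 2 * CL <= A ->
  (forall f, (forall t, 0 <= f t) -> cEnt (gw l) (eqoff S) f s <= A * fisher f) ->
  forall f, (forall t, 0 <= f t) ->
    cEnt (gw l) (eqoff S) f s <= (A - (A / 2 - CL) / Ztot) * fisher f.
Proof.
move=> CLA entA f f0; have A0 : 0 <= A by apply: le_trans CLA; rewrite mulr_ge0.
have eps0 r := eps_ge0 d beta a b_gt0 r.
pose X i := E S (Gam i (fun t => Num.sqrt (f t))) s.
have X0 i : 0 <= X i by apply: fisher_term_ge0.
have Ey0 (y : index) t : 0 <= E (free y) f t by apply: (cE_ge0 (@gw0 l) (eqv _)).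
(* Chain rule at one block: the crude inequality inside the block, the assumed constant [A] for the
   entropy of the block average. *)
have split_y (y : index) : cEnt (gw l) (eqoff S) f s <=
    CL * \sum_(j in free y) X j + A * fisher (E (free y) f).
  rewrite (cEnt_chain (@gw0 l) (eqv (free y)) (eqv S)) //; apply: lerD; last exact: entA.
  apply: (@le_trans _ _ (E S (fun t => CL * \sum_(j in free y) E (free y) (Gam j (fun t => Num.sqrt (f t))) t) s)).
    apply: (cE_le (@gw0 l) (eqv S)) => t _; apply: crude_ent => //.
    exact: (region_card (block_region K_gt0 LN rS y)).
  rewrite cEZ ler_wpM2l // (cE_sum (@gw0 l) (eqv S)); apply: ler_sum => j _.
  by rewrite (cE_tower (@gw0 l) (eqv _) (eqv S)).
have sumW : Ztot * cEnt (gw l) (eqoff S) f s <=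
    CL * (\sum_y W y * \sum_(j in free y) X j) + A * \sum_y W y * fisher (E (free y) f).
  rewrite /Ztot mulr_suml !mulr_sumr -big_split; apply: ler_sum => y _ /=.
  by apply: (le_trans (ler_wpM2l (W0 y) (split_y y))); rewrite mulrDr !(mulrCA (W y)).
have contr : \sum_y W y * fisher (E (free y) f) <=
    Ztot * fisher f - 1 / 2 * \sum_(j in S) cov j * X j.
  apply: (@block_sum_half X (fun y i => E S (Gam i (fun t => Num.sqrt (E (free y) f t))) s)
     (2 * q%:R * M ^+ 2) e X0 _ _ _ _ _ K_large).
  - by apply: mulr_ge0; [rewrite mulr_ge0 | rewrite exprn_ge0 // (le_trans _ M1)].
  - by move=> r /=; apply: mulr_ge0 => //; apply: mulr_ge0 => //; apply: mulr_ge0 => //; apply: mulr_ge0.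
  - move=> y i iy; rewrite (@cE_eq _ _ _ _ _ (fun=> 0)) ?(cE_cst (@gw0 l) (eqv S)) // => t _.
    by rewrite /Gam big1 // => c _; rewrite E_inv_mem // subrr expr0n.
  - move=> y i iS iy; rewrite -[X i](cE_tower (@gw0 l) (eqv (free y)) (eqv S)) //.
    apply: (cE_le (@gw0 l) (eqv S)) => t _.
    apply: le_trans (Gam_neutral (block_region K_gt0 LN rS y) iy _ _).
    rewrite le_eqVlt; apply/orP; left; apply/eqP; congr Gam; apply/funext => u.
    by congr Num.sqrt; apply: cE_eq => v _; rewrite sqr_sqrtr.
  - by move=> y i iS; apply: fisher_bad.
have free_le : \sum_y W y * \sum_(j in free y) X j <= \sum_(j in S) cov j * X j.
  exact: sum_free_cover.
have cov_ge : fisher f <= \sum_(j in S) cov j * X j by apply: sum_cover_ge.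
rewrite -(ler_pM2l Z0); apply: (le_trans sumW).
have -> : Ztot * ((A - (A / 2 - CL) / Ztot) * fisher f) =
   A * (Ztot * fisher f) - (A / 2 - CL) * fisher f by field; rewrite gt_eqF.
apply: (le_trans (lerD (ler_wpM2l CL0 free_le) (ler_wpM2l A0 contr))).
have h : 0 <= A / 2 - CL by lra.
have := ler_wpM2l h cov_ge; set Y := \sum_(j in S) _; lra.
Qed.

(** The improvement step has the fixed point [2 * CL] and multiplies the distance to it by exactly
    [rho]. In the limit only [rho < 1] matters, although [rho] and the starting constant [B] depend
    on the volume. *)
Lemma large_lsi f : (forall t, 0 <= f t) ->
  cEnt (gw l) (eqoff S) f s <= 2 * CL * fisher f.
Proof.
move=> f0; pose B := 4 / cell #|S| * crude #|S|.
have B0 : 0 <= B by rewrite mulr_ge0 ?crude_ge0 // divr_ge0 // ltW // cell_gt0.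
have r0 := rho_gt0.
have iter n : forall f, (forall t, 0 <= f t) ->
    cEnt (gw l) (eqoff S) f s <= (2 * CL + rho ^+ n * B) * fisher f.
  elim: n => [|n IH] h h0.
    rewrite expr0 mul1r mulrDl; apply: (@le_trans _ _ (B * fisher h)); first exact: crude_ent.
    by rewrite lerDr mulr_ge0 ?fisher_ge0 // mulr_ge0.
  have rB : 0 <= rho ^+ n * B by rewrite mulr_ge0 // exprn_ge0 // ltW.
  have := entropy_improve _ IH h0; rewrite lerDl => /(_ rB).
  suff -> : 2 * CL + rho ^+ n * B - ((2 * CL + rho ^+ n * B) / 2 - CL) / Ztot =
     2 * CL + rho ^+ n.+1 * B by [].
  by rewrite exprS /rho; field; rewrite gt_eqF.
rewrite -subr_le0; apply: (@geometric_bound _ rho _ (B * fisher f)); [exact: ltW|exact: rho_lt1|].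
by move=> n; rewrite lerBlDl [X in _ + X]mulrA -mulrDl; apply: iter.
Qed.

End EntropyStep.
End LargeCube.

Lemma eps_sum_le Cs n : (forall n, \sum_(r < n) eps r * (r + 2)%:R * (2 * r + 3)%:R ^+ d <= Cs) ->
  \sum_(r < n) eps r <= Cs.
Proof.
move=> h; apply: le_trans (h n); apply: ler_sum => r _.
rewrite -mulrA -[leLHS]mulr1 ler_wpM2l ?(eps_ge0 d beta a b_gt0) //.
by rewrite mulr_ege1 ?exprn_ege1 ?ler1n ?addn2 ?addn3.
Qed.

(** [K], and with it the block side [L = K^2], depends only on the sum of the series of [eps].
    Regions in cubes of side at least [2 L] leave room for the translates; those in smaller cubes
    have bounded cardinality. *)
Lemma uniform_gap : exists2 Cg : R, 0 <= Cg & forall l x m (T : {set vertex d l}) g t,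
  region x m T -> cVar (gw l) (eqoff T) g t <= Cg * \sum_(j in T) E T (Gam j g) t.
Proof.
have [Cs Cs0 hCs] := eps_series d beta a_gt0 b_gt0.
have [K K0 hK] := kappa_choice (1 + Cs).
set L := (K * K)%N.
have hbad : 4 * d%:R / K%:R * bad_factor d K 1 eps <= 1 / 2.
  apply: le_trans hK; rewrite ler_wpM2l ?divr_ge0 ?mulr_ge0 // lerD2l; exact: hCs.
pose C1 := crude ((2 * (2 * L) + 1) ^ d); pose C2 := 2 * crude ((2 * L + 1) ^ d) * (K%:R * (L + 1)%:R) ^+ d.
have C10 : 0 <= C1 by apply: crude_ge0.
have C20 : 0 <= C2.
  apply: mulr_ge0; last by rewrite exprn_ge0 // mulr_ge0.
  by apply: mulr_ge0 => //; apply: crude_ge0.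
exists (C1 + C2); first by rewrite addr_ge0.
move=> l x n T g t rT.
have D0 : 0 <= \sum_(j in T) E T (Gam j g) t.
  by apply: sumr_ge0 => j _; apply: (cE_ge0 (@gw0 l) (eqv _)) => u _; apply: Gam_ge0.
rewrite mulrDl; have [nL|nL] := leqP (2 * L) n.
  have LN : (L <= n - L)%N by clear -nL; lia.
  have rT' : region x (n - L + K * K) T by rewrite subnK //; clear -nL; lia.
  apply: (le_trans (large_gap _ K0 LN rT' _ hbad)); rewrite lerDr mulr_ge0 //.
apply: (@le_trans _ _ (C1 * \sum_(j in T) E T (Gam j g) t)); last by rewrite lerDl mulr_ge0.
apply: crude_var => //; apply: (leq_trans (region_card rT)); rewrite leq_exp2r //.
by clear -nL; lia.
Qed.

Lemma uniform_lsi : exists2 C : R, 0 <= C & forall l (f : spins d l q -> R) s,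
  (forall t, 0 <= f t) -> cEnt (gw l) (eqoff [set: vertex d l]) f s <=
    C * \sum_(i in [set: vertex d l]) E [set: vertex d l] (Gam i (fun t => Num.sqrt (f t))) s.
Proof.
have [Cs Cs0 hCs] := eps_series d beta a_gt0 b_gt0.
have [Cg Cg0 gap] := uniform_gap.
pose e r := 8 * q%:R * Cs * Cg * eps r.
(* The blocks are chosen anew: the gradient bound at bad sites now involves [q], [M] and the gap
   constant [Cg]. *)
have [K K0 hK] := kappa_choice (2 * q%:R * M ^+ 2 + 8 * q%:R * Cs * Cg * Cs).
set L := (K * K)%N.
have hbad : 4 * d%:R / K%:R * bad_factor d K (2 * q%:R * M ^+ 2) e <= 1 / 2.
  apply: le_trans hK; rewrite ler_wpM2l ?divr_ge0 ?mulr_ge0 // lerD2l.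
  apply: (le_trans _ (ler_wpM2l _ (hCs L))); last by rewrite !mulr_ge0.
  by rewrite mulr_sumr; apply: ler_sum => r _; rewrite /e !mulrA.
pose cst m := 4 / cell m * crude m.
have cst0 m : 0 <= cst m by rewrite mulr_ge0 ?crude_ge0 // divr_ge0 // ltW // cell_gt0.
pose C1 := cst ((2 * (2 * L) + 1) ^ d)%N; pose C2 := 2 * cst ((2 * L + 1) ^ d)%N.
have C20 : 0 <= C2 by rewrite mulr_ge0.
exists (C1 + C2); first by rewrite addr_ge0 // cst0.
move=> l f s f0; have rT := region_full d l; set T := [set: _] in rT *.
have D0 : 0 <= \sum_(j in T) E T (Gam j (fun t => Num.sqrt (f t))) s.
  by apply: sumr_ge0 => j _; apply: (cE_ge0 (@gw0 l) (eqv _)) => u _; apply: Gam_ge0.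
rewrite mulrDl; have [nL|nL] := leqP (2 * L) l.
  have LN : (L <= l - L)%N by clear -nL; lia.
  have rT' : region (fun=> 0%N) (l - L + K * K) T by rewrite subnK //; clear -nL; lia.
  apply: (le_trans (large_lsi _ K0 LN rT' Cs0 Cg0 (eps_sum_le _ hCs) gap hbad f0)).
  by rewrite lerDr mulr_ge0 // cst0.
apply: (@le_trans _ _ (C1 * \sum_(j in T) E T (Gam j (fun t => Num.sqrt (f t))) s)); last first.
  by rewrite lerDl mulr_ge0.
apply: crude_ent => //; apply: (leq_trans (region_card rT)); rewrite leq_exp2r //.
by clear -nL; lia.
Qed.

End FunctionalInequalities.

(** * Product measures *)

Section ProductSpace.
Variables (R : realType) (V : finType) (q : nat).
Local Notation conf := {ffun V -> 'I_q}.
Variable w : conf -> R.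
Hypothesis w_gt0 : forall s, 0 < w s.
Hypothesis w_prod : forall i b (s t : conf), s i = t i -> flip_ratio w i b s = flip_ratio w i b t.
Local Notation E S := (cE w (eqoff S)).
Implicit Types (S : {set V}) (s t : conf) (i : V) (b : 'I_q).

Let eqv S : equivalence_rel (@eqoff V q S). Proof. exact: eqoff_equiv. Qed.

(** The product form of [w] is expressed by flip ratios that depend only on the flipped spin; such a
    ratio is constant on the classes of a set not containing [i]. *)
Lemma prod_E_upd S f s i b : i \notin S -> E S f (upd s i b) = E S (fun t => f (upd t i b)) s.
Proof.
move=> iS; apply: (E_upd_neutral w_gt0) => // t /eqoffP st; apply: w_prod; by rewrite st.
Qed.

Lemma sum_eqoff1 i s (F : conf -> R) :
  \sum_(t | eqoff [set i] s t) F t = \sum_b F (upd s i b).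
Proof.
rewrite -(setU0 [set i]) sum_eqoffU1 ?inE // (eq_bigl (pred1 s)) ?big_pred1_eq // => t.
by rewrite eqoff0 eq_sym.
Qed.

Lemma E1E i f s : E [set i] f s = (\sum_b w (upd s i b) * f (upd s i b)) / \sum_b w (upd s i b).
Proof. by rewrite /cE !sum_eqoff1. Qed.

Lemma E1_flip i f s : E [set i] f s =
  (\sum_b flip_ratio w i b s * f (upd s i b)) / \sum_b flip_ratio w i b s.
Proof.
have wN0 : w s != 0 by rewrite gt_eqF.
have kE b : w s * flip_ratio w i b s = w (upd s i b) by rewrite /flip_ratio mulrC divfK.
rewrite E1E.
have -> : \sum_b w (upd s i b) * f (upd s i b) = w s * \sum_b flip_ratio w i b s * f (upd s i b).
  by rewrite mulr_sumr; apply: eq_bigr => b _; rewrite mulrA kE.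
have -> : \sum_b w (upd s i b) = w s * \sum_b flip_ratio w i b s.
  by rewrite mulr_sumr; apply: eq_bigr => b _; rewrite kE.
by rewrite invfM mulrACA mulfV // mul1r.
Qed.

Lemma prod_commute i S f s : i \notin S -> E [set i] (E S f) s = E S (E [set i] f) s.
Proof.
move=> iS; rewrite E1_flip.
rewrite (@cE_eq _ _ _ _ (E [set i] f)
  (fun t => (\sum_b flip_ratio w i b s)^-1 * \sum_b flip_ratio w i b s * f (upd t i b))); last first.
  move=> t /eqoffP/(_ i iS) st; rewrite E1_flip mulrC; congr (_^-1 * _).
    by apply: eq_bigr => b _; apply: w_prod.
  by apply: eq_bigr => b _; rewrite (w_prod b (esym st)).
rewrite cEZ (cE_sum w_gt0 (eqv S)) mulrC; congr (_ * _); apply: eq_bigr => b _.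
by rewrite cEZ prod_E_upd.
Qed.

Lemma prod_E_setU1 i S f s : i \notin S -> E [set i] (E S f) s = E (i |: S) f s.
Proof.
move=> iS; set g := E [set i] (E S f).
have g_inv t : eqoff (i |: S) s t -> g t = g s.
  move=> st; pose t' := upd t i (s i).
  have -> : g t = g t' by rewrite /g (E_inv_mem _ _ _ _ (set11 i)).
  rewrite /g prod_commute // [RHS]prod_commute //; apply/esym/(cE_class _ (eqv S)).
  apply/eqoffP => v vS; rewrite updE; case: eqP => [->//|/eqP vi].
  by move/eqoffP: st; apply; rewrite !inE negb_or vi.
rewrite -[g s](cE_inv w_gt0 (eqv (i |: S)) g_inv) /g.
rewrite (cE_tower w_gt0 (eqv _) (eqv _)); last by apply: eqoff_sub; rewrite sub1set setU11.
by rewrite (cE_tower w_gt0 (eqv _) (eqv _)) //; apply/eqoff_sub/subsetU1.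
Qed.

(** Chain rule for [S' = S :\ i]. The function [E S' f] depends, within a class of [S], only on the
    spin at [i], so its entropy is a mean of one-site entropies; as [E S'] commutes with [E
    [set i]], [cEnt_cE_le] moves it outside. *)
Lemma entropy_tensorization S f s : (forall t, 0 <= f t) ->
  cEnt w (eqoff S) f s <= \sum_(i in S) E S (cEnt w (eqoff [set i]) f) s.
Proof.
move=> f0; have [n] := ubnP #|S|; elim: n S s => // n IH S s Sn.
have [->|/set0Pn[i iS]] := eqVneq S set0.
  rewrite big_set0 /cEnt !E0 // subrr //.
pose S' := S :\ i; have iS' : i \notin S' by rewrite !inE eqxx.
have SE : S = i |: S' by rewrite setD1K.
have S'S : S' \subset S by apply: subsetDl.
have iSub : [set i] \subset S by rewrite sub1set.
have cS : #|S| = #|S'|.+1 by rewrite (cardsD1 i S) iS.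
have Sn' : (#|S'| < n)%N by clear -Sn cS; lia.
have g0 t : 0 <= E S' f t by apply: (cE_ge0 w_gt0 (eqv _)).
rewrite (cEnt_chain w_gt0 (eqv S') (eqv S)); last exact: eqoff_sub.
rewrite (big_setD1 i) //= -/S' [leLHS]addrC; apply: lerD; last first.
  apply: (@le_trans _ _ (E S (fun t => \sum_(j in S') E S' (cEnt w (eqoff [set j]) f) t) s)).
    by apply: (cE_le w_gt0 (eqv S)) => t _; apply: IH.
  rewrite (cE_sum w_gt0 (eqv S)); apply: ler_sum => j _.
  by rewrite (cE_tower w_gt0 (eqv _) (eqv _)) //; apply: eqoff_sub.
rewrite (cEnt_chain w_gt0 (eqv [set i]) (eqv S)); last exact: eqoff_sub.
have -> : cEnt w (eqoff S) (E [set i] (E S' f)) s = 0.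
  have e t : eqoff S s t -> E [set i] (E S' f) t = E S f s.
    by move=> st; rewrite prod_E_setU1 // -SE (cE_class _ (eqv S) _ st).
  rewrite (cEnt_eq _ e) /cEnt !(cE_cst w_gt0 (eqv S)) subrr //.
rewrite addr0 -(cE_tower w_gt0 (eqv S') (eqv S) (cEnt w (eqoff [set i]) f)); last exact: eqoff_sub.
apply: (cE_le w_gt0 (eqv S)) => t _; apply: (cEnt_cE_le w_gt0 (eqv _) (eqv _)) => // h u.
exact: prod_commute.
Qed.

End ProductSpace.

(** * Bernoulli percolation *)

Section Bernoulli.
Variables (R : realType) (V : finType) (p : R).
Hypotheses (p_gt0 : 0 < p) (p_lt1 : p < 1).
Local Notation conf := {ffun V -> 'I_2}.
Implicit Types (F S : {set V}) (s t : conf) (i : V) (f h : conf -> R).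

(** Edge states are spins with two values, so the results on [eqoff] and [flip_ratio] apply to
    percolation as well. *)
Definition on : 'I_2 := ord_max.
Definition off : 'I_2 := ord0.
Definition ber1 (b : 'I_2) : R := if b == on then p else 1 - p.
Definition ber (s : conf) : R := \prod_i ber1 (s i).

Lemma ber1_gt0 b : 0 < ber1 b.
Proof. by rewrite /ber1; case: ifP => // _; rewrite subr_gt0. Qed.

Lemma ber_gt0 s : 0 < ber s.
Proof. by apply: prodr_gt0 => i _; apply: ber1_gt0. Qed.

Lemma ber_flip i b s : flip_ratio ber i b s = ber1 b / ber1 (s i).
Proof.
rewrite /flip_ratio /ber (bigD1 i) //= [X in _ / X](bigD1 i) //= updE eqxx.
rewrite (eq_bigr (fun j => ber1 (s j))) => [|j ji]; last by rewrite updE (negPf ji).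
by rewrite -mulf_div divff ?mulr1 // gt_eqF // prodr_gt0 // => j _; apply: ber1_gt0.
Qed.

Lemma ber_prod i b s t : s i = t i -> flip_ratio ber i b s = flip_ratio ber i b t.
Proof. by rewrite !ber_flip => ->. Qed.

Local Notation E S := (cE ber (eqoff S)).
Let eqv S : equivalence_rel (@eqoff V 2 S). Proof. exact: eqoff_equiv. Qed.

Lemma sum2 (F : 'I_2 -> R) : \sum_b F b = F off + F on.
Proof. by rewrite big_ord_recl big_ord1; congr (_ + F _); apply: val_inj. Qed.

Lemma E_ber1 i f s : E [set i] f s = (1 - p) * f (upd s i off) + p * f (upd s i on).
Proof.
rewrite (E1_flip ber_gt0) !sum2 !ber_flip.
have b0 : ber1 (s i) != 0 by rewrite gt_eqF // ber1_gt0.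
have -> : ber1 off = 1 - p by [].
have -> : ber1 on = p by rewrite /ber1 eqxx.
have -> : (1 - p) / ber1 (s i) + p / ber1 (s i) = (ber1 (s i))^-1 by field.
by field.
Qed.

Lemma cVar_ber1 i f s : cVar ber (eqoff [set i]) f s =
  p * (1 - p) * (f (upd s i on) - f (upd s i off)) ^+ 2.
Proof. by rewrite /cVar !E_ber1; ring. Qed.

Definition clr F s : conf := [ffun i => if i \in F then off else s i].

Lemma clr0 s : clr set0 s = s.
Proof. by apply/ffunP => i; rewrite ffunE inE. Qed.

Lemma clrU1 i F s : clr (i |: F) s = clr F (upd s i off).
Proof.
apply/ffunP => j; rewrite !ffunE !inE; case: (j \in F); rewrite ?orbT ?orbF //.
Qed.

Lemma E_clr1 i f s S : i \in S ->
  E S (fun t => f (upd t i off)) s = (1 - p)^-1 * E S (fun t : conf => (t i == off)%:R * f t) s.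
Proof.
move=> iS; have sub : subrel (@eqoff V 2 [set i]) (eqoff S) by apply: eqoff_sub; rewrite sub1set.
have p1 : 1 - p != 0 by rewrite gt_eqF // subr_gt0.
rewrite -(cE_tower ber_gt0 (eqv [set i]) (eqv S) _ _ sub).
rewrite -(cE_tower ber_gt0 (eqv [set i]) (eqv S) (fun t : conf => (t i == off)%:R * f t) _ sub) -cEZ.
apply: cE_eq => t _; rewrite !E_ber1 !upd_upd !updE !eqxx /=.
by rewrite mul0r mulr0 addr0 mul1r mulrA mulVf // mul1r -mulrDl subrK mul1r.
Qed.

(** Closing the edges of [F] by force has the law of conditioning on their being closed; this costs
    a factor [(1 - p)^-1] per edge. *)
Lemma E_clr F S f s : F \subset S -> (forall t, 0 <= f t) ->
  E S (fun t => f (clr F t)) s <=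
    (1 - p)^-1 ^+ #|F| * E S (fun t => [forall i in F, t i == off]%:R * f t) s.
Proof.
have [n] := ubnP #|F|; elim: n F f => // n IH F f Fn FS f0.
have [->|/set0Pn[i iF]] := eqVneq F set0.
  rewrite cards0 expr0 mul1r le_eqVlt; apply/orP; left; apply/eqP; apply: cE_eq => t _.
  by rewrite clr0 (_ : [forall i in _, _]) ?mul1r //; apply/forallP => j; rewrite inE.
pose F' := F :\ i.
have FE : F = i |: F' by rewrite setD1K.
have cF : #|F| = #|F'|.+1 by rewrite (cardsD1 i F) iF.
have Fn' : (#|F'| < n)%N by clear -Fn cF; lia.
have F'S : F' \subset S by apply: subset_trans FS; apply: subsetDl.
have iS : i \in S by apply: (subsetP FS).
have p1 : 0 < 1 - p by rewrite subr_gt0.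
rewrite (@cE_eq _ _ _ _ _ (fun t : conf => (fun u : conf => f (clr F' u)) (upd t i off))); last first.
  by move=> t _; rewrite FE clrU1.
rewrite (E_clr1 (fun u : conf => f (clr F' u)) s iS) cF exprS -mulrA ler_wpM2l ?invr_ge0 ?(ltW p1) //.
have iF' : i \notin F' by rewrite !inE eqxx.
rewrite (@cE_eq _ _ _ _ _ (fun t : conf => (fun u : conf => (u i == off)%:R * f u) (clr F' t))); last first.
  by move=> t _; rewrite ffunE (negPf iF').
apply: (le_trans (IH F' (fun u : conf => (u i == off)%:R * f u) Fn' F'S _)); first by move=> t; rewrite mulr_ge0.
rewrite ler_wpM2l ?exprn_ge0 ?invr_ge0 ?(ltW p1) //.
apply: (cE_le ber_gt0 (eqv S)) => t _; rewrite mulrA ler_wpM2r // -natrM ler_nat mulnb.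
case: (boolP (_ && _)) => // /andP[/forallP h ti].
rewrite (_ : [forall j in F, _]) //; apply/forallP => j; apply/implyP; rewrite FE !inE.
move=> /orP[/eqP ->|/andP[ji jF]] //; have := h j; by rewrite !inE ji jF.
Qed.

(** Closing one edge moves [h] in mean square by [(1 - p)^-1] times its one-edge variance. The edges
    are closed successively; the factor 2 is that of [(x + y)^2 <= 2 x^2 + 2 y^2], and after each
    closing [E_clr1] returns to the original law. *)
Lemma clr_variance F S h s : F \subset S ->
  E S (fun t => (h t - h (clr F t)) ^+ 2) s <=
    (2 / (1 - p)) ^+ #|F| * \sum_(i in F) E S (cVar ber (eqoff [set i]) h) s.
Proof.
have [n] := ubnP #|F|; elim: n F => // n IH F Fn FS.
have p1 : 0 < 1 - p by rewrite subr_gt0.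
have c1 : 1 <= 2 / (1 - p) by rewrite ler_pdivlMr // mul1r; move: p_gt0; lra.
have [->|/set0Pn[i iF]] := eqVneq F set0.
  rewrite big_set0 mulr0 (@cE_eq _ _ _ _ _ (fun=> 0)) ?(cE_cst ber_gt0 (eqv S)) //.
  by move=> t _; rewrite clr0 subrr expr0n.
pose F' := F :\ i.
have FE : F = i |: F' by rewrite setD1K.
have cF : #|F| = #|F'|.+1 by rewrite (cardsD1 i F) iF.
have Fn' : (#|F'| < n)%N by clear -Fn cF; lia.
have F'S : F' \subset S by apply: subset_trans FS; apply: subsetDl.
have iS : i \in S by apply: (subsetP FS).
have sub : subrel (@eqoff V 2 [set i]) (eqoff S) by apply: eqoff_sub; rewrite sub1set.
have V0 j : 0 <= E S (cVar ber (eqoff [set j]) h) s.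
  by apply: (cE_ge0 ber_gt0 (eqv S)) => t _; apply: (cVar_ge0 ber_gt0 (eqv _)).
rewrite (big_setD1 i) //= -/F'.
pose psi t := (h t - h (clr F' t)) ^+ 2.
apply: (@le_trans _ _ (E S (fun t => 2 * (h t - h (upd t i off)) ^+ 2 + 2 * psi (upd t i off)) s)).
  apply: (cE_le ber_gt0 (eqv S)) => t _; rewrite FE clrU1 /psi.
  set x := h (upd t i off); set y := h (clr F' _).
  have := sqr_ge0 ((h t - x) - (x - y)); nra.
rewrite cED !cEZ mulrDr; apply: lerD.
  have -> : E S (fun t => (h t - h (upd t i off)) ^+ 2) s =
     (1 - p)^-1 * E S (cVar ber (eqoff [set i]) h) s.
    rewrite -(cE_tower ber_gt0 (eqv [set i]) (eqv S) _ _ sub) -cEZ; apply: cE_eq => t _.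
    rewrite E_ber1 cVar_ber1 !upd_upd subrr expr0n mulr0 add0r; field.
    by rewrite gt_eqF.
  rewrite mulrA ler_wpM2r // cF exprS -[leLHS]mulr1 ler_wpM2l ?exprn_ege1 //.
  exact: le_trans c1.
rewrite cF exprS -mulrA; apply: (@le_trans _ _ (2 / (1 - p) * E S psi s)).
  rewrite (E_clr1 psi s iS) mulrA; apply: ler_wpM2l; first exact: le_trans c1.
  apply: (cE_le ber_gt0 (eqv S)) => t _; rewrite ler_piMl ?sqr_ge0 //.
  by case: (_ == _).
by apply: ler_wpM2l; [exact: le_trans c1 | apply: IH].
Qed.

End Bernoulli.

(** * The joint measure as an image of Potts times percolation *)

Lemma sum_sub_support (R : realType) (T : finType) (P : pred T) (F : T -> R) (Q : pred T) :
  (forall y, ~~ P y -> F y = 0) ->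
  \sum_(y | Q y) F y = \sum_(x : {x | P x} | Q (val x)) F (val x).
Proof.
move=> F0; rewrite (bigID P) /= [X in _ + X]big1 ?addr0; last by move=> y /andP[_ /F0].
rewrite (reindex_omap (val : {x | P x} -> T) insub) /=; last by move=> y /andP[_ Py]; rewrite insubT.
by apply: eq_bigl => x /=; rewrite valK eqxx (valP x) !andbT.
Qed.

Section ConditionalOnSmallClasses.
Variables (R : realType) (X : finType) (w : X -> R).

Lemma cE_two_points (sim : rel X) (H : X -> R) x x0 x1 (c p : R) :
  (forall y, sim x y = (y == x0) || (y == x1)) -> x1 != x0 -> c != 0 ->
  w x0 = c * (1 - p) -> w x1 = c * p ->
  cE w sim H x = (1 - p) * H x0 + p * H x1.
Proof.
move=> simxy x01 c0 w0 w1.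
have sumE (F : X -> R) : \sum_(y | sim x y) F y = F x0 + F x1.
  rewrite (bigD1 x0) ?simxy ?eqxx //= (bigD1 x1) ?simxy ?eqxx ?orbT ?x01 //=.
  rewrite big1 ?addr0 // => y; rewrite simxy.
  by case: (y == x0); case: (y == x1).
rewrite /cE !sumE w0 w1 -mulrDr subrK mulr1 -!mulrA -mulrDr mulrC mulKf //.
Qed.

Lemma cE_orbit (I : finType) (sim : rel X) (phi : I -> X) (psi : X -> I) (H : X -> R) x (c : R) :
  (forall i, sim x (phi i)) -> (forall y, sim x y -> phi (psi y) = y) ->
  (forall i, psi (phi i) = i) -> (forall i, w (phi i) = c) -> c != 0 ->
  cE w sim H x = #|I|%:R^-1 * \sum_i H (phi i).
Proof.
move=> simphi phiK psiK wc c0.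
have sumE (F : X -> R) : \sum_(y | sim x y) F y = \sum_i F (phi i).
  rewrite (reindex_onto phi psi) //=; apply: eq_bigl => i.
  by rewrite simphi psiK eqxx.
rewrite /cE !sumE (eq_bigr (fun i => c * H (phi i))); last by move=> i _; rewrite wc.
rewrite [X in _ / X](eq_bigr (fun=> c)); last by move=> i _; rewrite wc.
rewrite -mulr_sumr sumr_const -[_ *+ _]mulr_natl [_%:R * c]mulrC invfM mulrACA mulfV // mul1r mulrC //.
Qed.

End ConditionalOnSmallClasses.

Section JointMeasure.
Variables (R : realType) (d l q : nat) (beta p : R).
Hypotheses (q_gt0 : (0 < q)%N) (beta_gt0 : 0 < beta) (hp : p = 1 - expR (- beta)).
Local Notation J := (joint_support d l q).
Local Notation Omega := {ffun edge d l -> 'I_2}.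
Local Notation m := #|{: edge d l}|.
Implicit Types (s t : spins d l q) (om : Omega) (e : edge d l) (v : vertex d l) (b : 'I_q).

Lemma p_gt0 : 0 < p.
Proof. by rewrite hp subr_gt0 expR_lt1 oppr_lt0. Qed.

Lemma p_lt1 : p < 1.
Proof. by rewrite hp ltrBlDr ltrDl expR_gt0. Qed.

Let ber0 om : 0 < ber p om. Proof. exact: ber_gt0 p_gt0 p_lt1 om. Qed.
Let p1 : 0 < 1 - p. Proof. by rewrite subr_gt0 p_lt1. Qed.

Definition onset om : {set edge d l} := [set e | om e == on].
Definition mkset s om : {set edge d l} := locked (onset om :&: mono s).

Lemma mksetE s om : mkset s om = onset om :&: mono s.
Proof. by rewrite /mkset -lock. Qed.

Lemma mk_admissible s om : admissible (s, mkset s om).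
Proof. by rewrite /admissible /= mksetE subsetIr. Qed.

Definition mk s om : J := exist (fun x : joint d l q => admissible x) _ (mk_admissible s om).

Lemma in_mkset s om g : (g \in mkset s om) = (om g == on) && (g \in mono s).
Proof. by rewrite mksetE in_setI [g \in onset _]in_set. Qed.

Lemma in_mkset_upd s om e (b : 'I_2) g :
  (g \in mkset s (upd om e b)) = (if g == e then b == on else om g == on) && (g \in mono s).
Proof. by rewrite in_mkset; congr (_ && _); rewrite updE; case: ifP. Qed.

Lemma val_mk1 s om : (val (mk s om)).1 = s. Proof. by []. Qed.
Lemma val_mk2 s om : (val (mk s om)).2 = mkset s om. Proof. by []. Qed.

Lemma J_eq (x y : J) : (val x).1 = (val y).1 -> (val x).2 = (val y).2 -> x = y.
Proof. by move=> h1 h2; apply: val_inj; rewrite [val x]surjective_pairing h1 h2 -surjective_pairing. Qed.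

Lemma sum_ber_prod (F : edge d l -> 'I_2 -> R) :
  \sum_(om : Omega) \prod_e F e (om e) = \prod_e (F e off + F e on).
Proof. by rewrite -bigA_distr_bigA; apply: eq_bigr => e _; rewrite sum2. Qed.

Lemma sum_ber1 : \sum_(om : Omega) ber p om = 1.
Proof.
rewrite /ber (sum_ber_prod (fun _ => ber1 p)) big1 // => e _.
by rewrite /ber1 /= subrK.
Qed.

(** The event is a product of constraints [c e] on single edges: open on [A], closed on the rest of
    [M], arbitrary elsewhere, where the two weights add up to 1. *)
Lemma ber_fiber (A M : {set edge d l}) : A \subset M ->
  \sum_(om : Omega | onset om :&: M == A) ber p om = p ^+ #|A| * (1 - p) ^+ (#|M| - #|A|).
Proof.
move=> AM; pose c e (b : 'I_2) := (e \in M) ==> ((b == on) == (e \in A)).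
rewrite big_mkcond /=.
transitivity (\sum_(om : Omega) \prod_e (if c e (om e) then ber1 p (om e) else 0)).
  apply: eq_bigr => om _; case: ifP => [/eqP/setP h|/negP h].
    apply: eq_bigr => e _; rewrite ifT //; apply/implyP => eM.
    by have := h e; rewrite !inE eM andbT => ->.
  have [/forallP all_c|/forallPn[e ne]] := boolP [forall e, c e (om e)].
    case: h; apply/eqP/setP => e; rewrite !inE; have := all_c e; rewrite /c.
    by case: (boolP (e \in M)) => [_ /eqP ->|eM _]; rewrite ?andbT ?andbF //;
       apply/esym/negbTE; apply: contra eM; apply: (subsetP AM).
  by rewrite (bigD1 e) //= (negPf ne) mul0r.
rewrite (sum_ber_prod (fun e (b : 'I_2) => if c e b then ber1 p b else 0)).
have -> : (#|M| - #|A|)%N = #|M :\: A| by rewrite cardsD (setIidPr AM).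
rewrite -!prodr_const (bigID (mem A)) /=; congr (_ * _).
  apply: eq_bigr => e eA; rewrite /c eA (subsetP AM _ eA) /= /ber1 /=.
  by rewrite add0r.
rewrite (bigID (mem M)) /= mulrC big1 ?mul1r => [|e /andP[eA eM]]; last first.
  by rewrite /c (negPf eM) /= /ber1 /= subrK.
apply: eq_big => [e|e /andP[eA eM]]; first by rewrite !inE.
by rewrite /c eM (negPf eA) /= /ber1 /= addr0.
Qed.

Lemma ber_law (M : {set edge d l}) (H : {set edge d l} -> R) :
  \sum_(om : Omega) ber p om * H (onset om :&: M) =
  \sum_(A : {set edge d l} | A \subset M) p ^+ #|A| * (1 - p) ^+ (#|M| - #|A|) * H A.
Proof.
rewrite (partition_big (fun om => onset om :&: M) (fun A : {set edge d l} => A \subset M)) /=; last first.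
  by move=> om _; apply: subsetIr.
apply: eq_bigr => A AM; rewrite -(ber_fiber AM) mulr_suml; apply: eq_bigr => om /eqP <- //.
Qed.

(** Disagreeing edges are always closed in the joint measure and contribute [(1 - p)] each, which is
    the Potts factor [expR (- beta)]; on the monochromatic edges the joint weight is that of
    percolation. *)
Lemma push_weight (H : joint d l q -> R) :
  \sum_(y : joint d l q) es_weight p y * H y =
  \sum_(s : spins d l q) gw beta s * \sum_(om : Omega) ber p om * H (s, mkset s om).
Proof.
rewrite (eq_bigr (fun y : joint d l q => es_weight p (y.1, y.2) * H (y.1, y.2))); last by case.
rewrite -(pair_bigA _ (fun s (A : {set edge d l}) => es_weight p (s, A) * H (s, A))) /=.
apply: eq_bigr => s _; under [X in _ = _ * X]eq_bigr do rewrite mksetE.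
rewrite (ber_law (mono s) (fun A => H (s, A))) mulr_sumr.
rewrite [RHS]big_mkcond /=; apply: eq_bigr => A _; rewrite /es_weight /admissible /=.
case: ifP => [AM|]; last by rewrite mulr0 mul0r.
have MA := subset_leq_card AM.
have -> : gw beta s = (1 - p) ^+ #|disagree s|.
  by rewrite gwE mulrC expRM_natl hp opprB addrC subrK.
have -> : (m - #|A| = #|disagree s| + (#|mono s| - #|A|))%N.
  by rewrite -(cardsC (disagree s)) addnBA.
rewrite exprD mulr1; set k := (_ - _)%N; by rewrite mulrCA -!mulrA.
Qed.

Let Zw := \sum_(y : joint d l q) es_weight p y.
Let Zg := \sum_(s : spins d l q) gw (q := q) (l := l) (d := d) beta s.

Lemma weight_sum : Zw = Zg.
Proof.
rewrite /Zw (eq_bigr (fun y => es_weight p y * 1)); last by move=> *; rewrite mulr1.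
rewrite (push_weight (fun=> 1)); apply: eq_bigr => s _.
by rewrite -mulr_suml sum_ber1 !mulr1.
Qed.

Lemma Zg_gt0 : 0 < Zg.
Proof.
have [b0] : inhabited 'I_q by case: (q) q_gt0 => // q' _; exists; exact: ord0.
rewrite /Zg (bigD1 ([ffun=> b0] : spins d l q)) //= ltr_pwDl ?gw_gt0 // sumr_ge0 // => s _.
exact/ltW/gw_gt0.
Qed.

Lemma es_support_gt0 (x : J) : 0 < es_support p x.
Proof.
rewrite /es_support /es divr_gt0 //; last by rewrite -/Zw weight_sum Zg_gt0.
by rewrite /es_weight (valP x) mulr1 mulr_gt0 // exprn_gt0 // p_gt0.
Qed.

Lemma es_inadmissible (y : joint d l q) : ~~ admissible y -> es p y = 0.
Proof. by move=> ny; rewrite /es /es_weight (negPf ny) mulr0 mul0r. Qed.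

Lemma sum_support (H : J -> R) :
  \sum_(x : J) es_support p x * H x = \sum_(s : spins d l q) gw beta s / Zg * \sum_(om : Omega) ber p om * H (mk s om).
Proof.
pose H' (y : joint d l q) := if insub y is Some x then H x else 0.
have H'E (x : J) : H' (val x) = H x by rewrite /H' valK.
transitivity (\sum_(y : joint d l q) es_weight p y / Zw * H' y).
  rewrite (@sum_sub_support R _ (@admissible d l q) _ xpredT) /=.
    by apply: eq_bigr => x _; rewrite H'E.
  by move=> y ny; rewrite /H' insubN // mulr0.
rewrite weight_sum; transitivity ((\sum_(y : joint d l q) es_weight p y * H' y) / Zg).
  by rewrite mulr_suml; apply: eq_bigr => y _; rewrite mulrAC.
rewrite push_weight mulr_suml; apply: eq_bigr => s _; rewrite mulrAC; congr (_ * _).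
by apply: eq_bigr => om _; rewrite -(H'E (mk s om)).
Qed.

Local Notation pi := (@es_support R d l q p).
Local Notation EO := (cE (ber p) (eqoff [set: edge d l])).
Local Notation EG := (cE (@gw R d l q beta) (eqoff [set: vertex d l])).

Definition anyrel (T : Type) : rel T := fun _ _ => true.

Lemma anyrel_equiv (T : Type) : equivalence_rel (@anyrel T).
Proof. by []. Qed.

Lemma eqoffT (V : finType) (k : nat) : @eqoff V k [set: V] =2 @anyrel _.
Proof. by move=> s t; apply/eqoffP => v; rewrite inE. Qed.

Lemma EO_E (H : Omega -> R) om0 : EO H om0 = \sum_(om : Omega) ber p om * H om.
Proof.
rewrite /cE; under eq_bigl do rewrite eqoffT; under [X in _ / X]eq_bigl do rewrite eqoffT.
by rewrite sum_ber1 divr1.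
Qed.

Lemma EG_E (H : spins d l q -> R) s0 : EG H s0 = \sum_(s : spins d l q) gw beta s / Zg * H s.
Proof.
rewrite /cE; under eq_bigl do rewrite eqoffT; under [X in _ / X]eq_bigl do rewrite eqoffT.
by rewrite -/Zg mulr_suml; apply: eq_bigr => s _; rewrite mulrAC.
Qed.

Lemma pi_sum1 : \sum_x pi x = 1.
Proof.
rewrite (eq_bigr (fun x => pi x * 1)); last by move=> *; rewrite mulr1.
rewrite (sum_support (fun=> 1)) (eq_bigr (fun s => gw beta s / Zg)) => [|s _].
  by rewrite -mulr_suml mulfV // gt_eqF // Zg_gt0.
by rewrite -mulr_suml sum_ber1 !mulr1.
Qed.

Lemma EJ_E (H : J -> R) x0 : cE pi (@anyrel J) H x0 = \sum_x pi x * H x.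
Proof. by rewrite /cE pi_sum1 divr1. Qed.

Lemma push (H : J -> R) x0 s0 om0 :
  cE pi (@anyrel J) H x0 = EG (fun s => EO (fun om => H (mk s om)) om0) s0.
Proof. by rewrite EJ_E sum_support EG_E; apply: eq_bigr => s _; rewrite EO_E. Qed.

Definition simE e : rel J := fun x y => same_off_edge e (val x) (val y).
Definition simV v : rel J := fun x y => same_off_vertex v (val x) (val y).

Lemma simEP e (x y : J) : reflect ((val x).1 = (val y).1 /\
  forall g, g != e -> (g \in (val x).2) = (g \in (val y).2)) (simE e x y).
Proof.
apply: (iffP andP) => [[/eqP h1 /forallP h2]|[h1 h2]]; split.
- by [].
- by move=> g ge; apply/eqP; apply: (implyP (h2 g)).
- by rewrite h1.
- by apply/forallP => g; apply/implyP => /h2 ->.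
Qed.

Lemma simVP v (x y : J) : reflect ((val x).2 = (val y).2 /\
  forall u, u != v -> (val x).1 u = (val y).1 u) (simV v x y).
Proof.
apply: (iffP andP) => [[/eqP h1 /forallP h2]|[h1 h2]]; split.
- by [].
- by move=> g ge; apply/eqP; apply: (implyP (h2 g)).
- by rewrite h1.
- by apply/forallP => g; apply/implyP => /h2 ->.
Qed.

Lemma simE_equiv e : equivalence_rel (simE e).
Proof.
move=> x y z; split; first by apply/simEP.
move=> /simEP[h1 h2]; apply/simEP/simEP => -[k1 k2]; split.
- by rewrite -h1.
- by move=> g ge; rewrite -h2 // k2.
- by rewrite h1.
- by move=> g ge; rewrite h2 // k2.
Qed.

Lemma simV_equiv v : equivalence_rel (simV v).
Proof.
move=> x y z; split; first by apply/simVP.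
move=> /simVP[h1 h2]; apply/simVP/simVP => -[k1 k2]; split.
- by rewrite -h1.
- by move=> g ge; rewrite -h2 // k2.
- by rewrite h1.
- by move=> g ge; rewrite h2 // k2.
Qed.

Lemma pi_val (x : J) : pi x = p ^+ #|(val x).2| * (1 - p) ^+ (m - #|(val x).2|) / Zw.
Proof. by rewrite /es_support /es /es_weight (valP x) mulr1. Qed.

Lemma mk_upd_disagree e s om (b : 'I_2) : e \notin mono s -> mk s (upd om e b) = mk s om.
Proof.
move=> eM; apply: J_eq; rewrite ?val_mk1 // !val_mk2; apply/setP => g; rewrite in_mkset_upd in_mkset.
by case: eqP => [->|//]; rewrite (negPf eM) !andbF.
Qed.

Lemma simE_single e s om y : e \notin mono s -> simE e (mk s om) y -> y = mk s om.
Proof.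
move=> eM /simEP[]; rewrite val_mk1 val_mk2 => h1 h2.
apply: J_eq; rewrite ?val_mk1 ?val_mk2 //; apply/setP => g.
have [->|ge] := eqVneq g e; last by rewrite h2.
have yA : e \notin (val y).2.
  by apply: contra eM => /(subsetP (valP y)); rewrite -h1.
by rewrite (negPf yA) in_mkset (negPf eM) andbF.
Qed.

Lemma mkset_on e s om : e \in mono s -> mkset s (upd om e on) = e |: mkset s (upd om e off).
Proof.
move=> eM; apply/setP => g; rewrite [RHS]in_setU1 [X in _ = _ || X]in_mkset_upd [LHS]in_mkset_upd.
by case: eqP => [->|//]; rewrite eM.
Qed.

Lemma mkset_off e s om : e \notin mkset s (upd om e off).
Proof. by rewrite in_mkset_upd eqxx. Qed.

Lemma edge_cE_pair e (A : {set edge d l}) (x x0 x1 : J) (H : J -> R) :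
  e \notin A -> (val x0).1 = (val x).1 -> (val x1).1 = (val x).1 ->
  (val x0).2 = A -> (val x1).2 = e |: A ->
  (forall g, g != e -> (g \in (val x).2) = (g \in A)) ->
  cE pi (simE e) H x = (1 - p) * H x0 + p * H x1.
Proof.
move=> eA s0 s1 A0 A1 xA.
have cA : #|e |: A| = #|A|.+1 by rewrite cardsU1 eA.
have Am : (#|A| < m)%N by rewrite -cA max_card.
pose c := p ^+ #|A| * (1 - p) ^+ (m - #|A|).-1 / Zw.
have Z0 : 0 < Zw by rewrite weight_sum Zg_gt0.
apply: (@cE_two_points _ _ pi _ H _ _ _ c).
- move=> y; apply/simEP/orP => [[h1 h2]|[]/eqP ->]; last 2 first.
  + by split=> [//|g ge]; rewrite A0 xA.
  + by split=> [//|g ge]; rewrite A1 xA // in_setU1 (negPf ge).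
  have [ye|ye] := boolP (e \in (val y).2).
    right; apply/eqP/J_eq; first by rewrite s1.
    apply/setP => g; rewrite A1 in_setU1.
    by have [->|ge] := eqVneq g e; [rewrite ye | rewrite -h2 // xA].
  left; apply/eqP/J_eq; first by rewrite s0.
  apply/setP => g; rewrite A0.
  by have [->|ge] := eqVneq g e; [rewrite (negPf eA) (negPf ye) | rewrite -h2 // xA].
- by apply: contraNneq eA => e10; rewrite -A0 -e10 A1 setU11.
- by rewrite gt_eqF // divr_gt0 // mulr_gt0 // exprn_gt0 // p_gt0.
- rewrite pi_val A0 /c -{1}(prednK (n := m - #|A|)) ?subn_gt0 //.
  by rewrite exprSr !mulrA; rewrite mulrAC.
- by rewrite pi_val A1 cA subnS exprSr /c -!mulrA; congr (_ * _); rewrite mulrC -!mulrA.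
Qed.

(** For a monochromatic edge the class consists of two states with weights in ratio [1 - p] to [p].
    For any other edge the class is a single state and [mk] does not see [om e], so both sides
    reduce to [H]. *)
Lemma edge_cE e (H : J -> R) s om :
  cE pi (simE e) H (mk s om) = cE (ber p) (eqoff [set e]) (fun om' => H (mk s om')) om.
Proof.
have -> : cE (ber p) (eqoff [set e]) (fun om' => H (mk s om')) om =
    (1 - p) * H (mk s (upd om e off)) + p * H (mk s (upd om e on)).
  exact: (E_ber1 p_gt0 p_lt1).
have [eM|eM] := boolP (e \in mono s).
  apply: (edge_cE_pair (A := mkset s (upd om e off))) => //.
  - exact: mkset_off.
  - exact: mkset_on.
  - by move=> g ge; rewrite val_mk2 [RHS]in_mkset_upd (negPf ge) in_mkset.
have mkE (b : 'I_2) : H (mk s (upd om e b)) = H (mk s om) by congr H; apply: mk_upd_disagree.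
have mix (x y h : R) : x = h -> y = h -> (1 - p) * x + p * y = h.
  by move=> -> ->; rewrite -mulrDl subrK mul1r.
rewrite (mix _ _ _ (mkE off) (mkE on)).
by apply: (cE_inv es_support_gt0 (simE_equiv e)) => y /(simE_single eM) ->.
Qed.

Definition star v : {set edge d l} := [set e : edge d l | v \in val e].

Lemma mkset_clear s om v b : (forall e, e \in star v -> om e = off) ->
  mkset (upd s v b) om = mkset s om.
Proof.
move=> cl; apply/setP => e; rewrite !in_mkset; case: (boolP (om e == on)) => //= ome.
have ve : v \notin val e.
  by apply/negP => ve; move: ome; rewrite cl ?inE.
rewrite !inE; congr negb; apply: eq_existsb => u; case: (boolP (u \in val e)) => //= ue.
apply: eq_existsb => u'; case: (boolP (u' \in val e)) => //= u'e; rewrite !updE.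
have uv : u != v by apply: contraNneq ve => <-.
have u'v : u' != v by apply: contraNneq ve => <-.
by rewrite (negPf uv) (negPf u'v).
Qed.

(** With all edges at [v] closed, every recolouring of [v] keeps the edge set, and the joint weight
    of an admissible state depends on the edge set alone. *)
Lemma vertex_cE v (H : J -> R) s om : (forall e, e \in star v -> om e = off) ->
  cE pi (simV v) H (mk s om) = q%:R^-1 * \sum_b H (mk (upd s v b) om).
Proof.
move=> cl; have mkE b := mkset_clear s b cl.
rewrite -[q in q%:R]card_ord.
apply: (@cE_orbit _ _ pi _ _ _ (fun y : J => (val y).1 v) H _ (pi (mk s om))).
- move=> b; apply/simVP; rewrite !val_mk1 !val_mk2 mkE; split=> // u uv.
  by rewrite updE (negPf uv).
- move=> y /simVP[]; rewrite val_mk1 val_mk2 => h1 h2.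
  apply: J_eq; rewrite ?val_mk1 ?val_mk2 ?mkE //; apply/ffunP => u; rewrite updE.
  by case: eqP => [->//|/eqP uv]; rewrite h2.
- by move=> b; rewrite val_mk1 updE eqxx.
- by move=> b; rewrite !pi_val !val_mk2 mkE.
- by rewrite gt_eqF // es_support_gt0.
Qed.

End JointMeasure.

(** * Approximate tensorization for the joint measure *)

Section JointTensorization.
Variables (R : realType) (d l q : nat) (beta p : R).
Hypotheses (q_gt0 : (0 < q)%N) (beta_gt0 : 0 < beta) (hp : p = 1 - expR (- beta)).
Local Notation J := (joint_support d l q).
Local Notation Omega := {ffun edge d l -> 'I_2}.
Local Notation pi := (@es_support R d l q p).
Local Notation EO := (cE (ber p) (eqoff [set: edge d l])).
Local Notation EG := (cE (@gw R d l q beta) (eqoff [set: vertex d l])).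
Local Notation EJ := (cE pi (@anyrel J)).
Local Notation M := (@flip_bound R d beta).

Let p0 : 0 < p. Proof. exact: p_gt0 beta_gt0 hp. Qed.
Let pl1 : p < 1. Proof. exact: p_lt1 hp. Qed.
Let ber0 := @ber_gt0 R (edge d l) p p0 pl1.
Let gw0 := @gw_gt0 R d l q beta.
Let pi0 : forall x, 0 < pi x. Proof. exact: es_support_gt0 q_gt0 beta_gt0 hp. Qed.
Let eqO := @eqoff_equiv (edge d l) 2.
Let eqG := @eqoff_equiv (vertex d l) q.
Let eqJ := @anyrel_equiv J.
Let p1 : 0 < 1 - p. Proof. by rewrite subr_gt0. Qed.

Lemma card_star (v : vertex d l) : (#|star v| <= 3 ^ d)%N.
Proof.
pose f (w : vertex d l) : {set vertex d l} := [set v; w].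
apply: leq_trans (card_adj v).
apply: (@leq_trans #|f @: [set w | adj v w]|); last exact: leq_imset_card.
rewrite -(card_imset _ val_inj); apply: subset_leq_card; apply/subsetP => A /imsetP[e].
rewrite inE => ve ->; have /is_edgeP[a [b [ab eE]]] := valP e.
move: ve; rewrite eE !inE => /orP[]/eqP vE.
  by apply/imsetP; exists b; [rewrite inE vE | rewrite /f vE -eE].
by apply/imsetP; exists a; [rewrite inE vE adj_sym | rewrite /f vE setUC].
Qed.

Lemma sum_star (F : edge d l -> R) :
  \sum_(v : vertex d l) \sum_(e in star v) F e = 2 * \sum_e F e.
Proof.
rewrite (exchange_big_dep xpredT) //= mulr_sumr; apply: eq_bigr => e _.
have /is_edgeP[a [b [ab eE]]] := valP e.
rewrite (eq_bigl (fun v => v \in [set a; b])); last by move=> v; rewrite !inE eE !inE.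
rewrite sumr_const cards2 (_ : a != b) ?mulr_natl //.
by apply: contraTneq ab => ->; rewrite adj_irr.
Qed.

Variables (f : J -> R) (f_ge0 : forall x, 0 <= f x).
Variables (s0 : spins d l q) (om0 : Omega) (x0 : J).
Let h (x : J) : R := Num.sqrt (f x).

Definition proj_spins (s : spins d l q) : R := EO (fun om => f (mk s om)) om0.

Lemma proj_spins_ge0 s : 0 <= proj_spins s.
Proof. exact: (cE_ge0 ber0 (eqO _)). Qed.

Lemma cEnt_edge e s om :
  cEnt pi (simE e) f (mk s om) = cEnt (ber p) (eqoff [set e]) (fun om' => f (mk s om')) om.
Proof.
by rewrite /cEnt (edge_cE q_gt0 beta_gt0 hp e f) (edge_cE q_gt0 beta_gt0 hp e (fun x => f x * ln (f x))).
Qed.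

Lemma cVar_edge e (g : J -> R) s om :
  cVar pi (simE e) g (mk s om) = cVar (ber p) (eqoff [set e]) (fun om' => g (mk s om')) om.
Proof.
by rewrite /cVar (edge_cE q_gt0 beta_gt0 hp e g) (edge_cE q_gt0 beta_gt0 hp e (fun x => g x ^+ 2)).
Qed.

(** Chain rule for the product of Potts and percolation: the percolation entropy at fixed spins, and
    the entropy of the conditional expectation given the spins. *)
Lemma entropy_split :
  cEnt pi (@anyrel J) f x0 =
  EG (fun s => cEnt (ber p) (eqoff [set: edge d l]) (fun om => f (mk s om)) om0) s0
  + cEnt (@gw R d l q beta) (eqoff [set: vertex d l]) proj_spins s0.
Proof.
rewrite {1 2}/cEnt !(push q_gt0 hp _ x0 s0 om0) cEB /cEnt -/proj_spins.
rewrite -/(EG _ s0) /proj_spins; ring.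
Qed.

Lemma edges_part :
  EG (fun s => cEnt (ber p) (eqoff [set: edge d l]) (fun om => f (mk s om)) om0) s0
   <= \sum_e EJ (cEnt pi (simE e) f) x0.
Proof.
have -> : \sum_e EJ (cEnt pi (simE e) f) x0 =
   EG (fun s => \sum_(e in [set: edge d l]) EO (cEnt (ber p) (eqoff [set e]) (fun om => f (mk s om))) om0) s0.
  rewrite (cE_sum gw0 (eqG _)); rewrite [RHS](eq_bigl xpredT); last by move=> e; rewrite inE.
  apply: eq_bigr => e _; rewrite (push q_gt0 hp _ x0 s0 om0).
  apply: cE_eq => s _; apply: cE_eq => om _; exact: cEnt_edge.
apply: (cE_le gw0 (eqG _)) => s _.
by apply: (entropy_tensorization ber0) => //; apply: ber_prod.
Qed.

Definition T1 (v : vertex d l) (s : spins d l q) : R :=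
  EO (fun om => (h (mk s om) - h (mk s (clr (star v) om))) ^+ 2) om0.

Definition clear (v : vertex d l) (om : Omega) : bool := [forall e in star v, om e == off].

Definition T2 (v : vertex d l) b (s : spins d l q) : R :=
  EO (fun om => (clear v om)%:R * (h (mk (upd s v b) om) - h (mk s om)) ^+ 2) om0.

Local Notation c1 := ((2 / (1 - p)) ^+ (3 ^ d)).
Local Notation c2 := ((1 - p)^-1 ^+ (3 ^ d)).

Lemma T1_ge0 v s : 0 <= T1 v s.
Proof. by apply: (cE_ge0 ber0 (eqO _)) => om _; apply: sqr_ge0. Qed.

(** The flip at [v] follows a path of three steps: close the edges at [v], flip, reopen them. The
    middle step takes place where [v] is isolated, and [E_clr] reduces it to [T2] at the cost
    [c2]. *)
Lemma proj_spins_diff v b s :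
  (Num.sqrt (proj_spins (upd s v b)) - Num.sqrt (proj_spins s)) ^+ 2
    <= 3 * T1 v (upd s v b) + 3 * c2 * T2 v b s + 3 * T1 v s.
Proof.
have projE t : proj_spins t = EO (fun om => h (mk t om) ^+ 2) om0.
  by apply: cE_eq => om _; rewrite /h sqr_sqrtr.
rewrite !projE; apply: (le_trans (cE_sqrt_dist ber0 (eqO _) _ _ _)).
pose D om := (h (mk (upd s v b) om) - h (mk s om)) ^+ 2.
have key : EO (fun om => D (clr (star v) om)) om0 <= c2 * T2 v b s.
  apply: (le_trans (E_clr p0 pl1 om0 (subsetT (star v)) _)); first by move=> om; apply: sqr_ge0.
  apply: ler_wpM2r; last first.
    rewrite ler_weXn2l ?card_star // invf_ge1 //; move: p0; lra.
  by apply: (cE_ge0 ber0 (eqO _)) => om _; rewrite mulr_ge0 ?sqr_ge0.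
apply: (@le_trans _ _ (EO (fun om => 3 * (h (mk (upd s v b) om) - h (mk (upd s v b) (clr (star v) om))) ^+ 2
    + 3 * D (clr (star v) om) + 3 * (h (mk s om) - h (mk s (clr (star v) om))) ^+ 2) om0)).
  apply: (cE_le ber0 (eqO _)) => om _; rewrite /D.
  have sq3 (x y z w : R) : (x - y) ^+ 2 <= 3 * (x - z) ^+ 2 + 3 * (z - w) ^+ 2 + 3 * (y - w) ^+ 2.
    have := sqr_ge0 ((x - z) - (z - w)); have := sqr_ge0 ((x - z) + (y - w)).
    have := sqr_ge0 ((z - w) + (y - w)); nra.
  exact: sq3.
rewrite !cED !cEZ -/(T1 v (upd s v b)) -/(T1 v s) lerD2r lerD2l -mulrA.
by apply: ler_wpM2l.
Qed.

Definition AE : R := \sum_e EJ (cVar pi (simE e) h) x0.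

Lemma sum_T1 : \sum_v EG (T1 v) s0 <= 2 * c1 * AE.
Proof.
have V0 e : 0 <= EJ (cVar pi (simE e) h) x0.
  by apply: (cE_ge0 pi0 eqJ) => x _; apply: (cVar_ge0 pi0 (simE_equiv e)).
have c10 : 0 <= c1 by rewrite exprn_ge0 // divr_ge0 // ltW.
have T1_le v : EG (T1 v) s0 <= c1 * \sum_(e in star v) EJ (cVar pi (simE e) h) x0.
  apply: (@le_trans _ _ (EG (fun s => c1 * \sum_(e in star v)
      EO (cVar (ber p) (eqoff [set e]) (fun om => h (mk s om))) om0) s0)).
    apply: (cE_le gw0 (eqG _)) => s _.
    apply: (le_trans (clr_variance p0 pl1 (fun om => h (mk s om)) om0 (subsetT (star v)))).
    apply: ler_wpM2r.
      apply: sumr_ge0 => e _; apply: (cE_ge0 ber0 (eqO _)) => om _.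
      exact: (cVar_ge0 ber0 (eqO _)).
    rewrite ler_weXn2l ?card_star // ler_pdivlMr // mul1r; move: p0; lra.
  rewrite cEZ ler_wpM2l // (cE_sum gw0 (eqG _)); apply: ler_sum => e _.
  rewrite (push q_gt0 hp _ x0 s0 om0) le_eqVlt; apply/orP; left; apply/eqP.
  by apply: cE_eq => s _; apply: cE_eq => om _; rewrite cVar_edge.
apply: (@le_trans _ _ (\sum_v c1 * \sum_(e in star v) EJ (cVar pi (simE e) h) x0)).
  by apply: ler_sum => v _.
by rewrite -mulr_sumr sum_star mulrCA mulrA.
Qed.

(** Each value of the spin at [v] has conditional probability at least [(q M)^-1], by [cell_weight]
    for one site. *)
Lemma sum_flips (G : spins d l q -> R) v : (forall s, 0 <= G s) ->
  EG (fun s => \sum_b G (upd s v b)) s0 <= q%:R * M * EG G s0.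
Proof.
move=> G0; have qM : 0 < q%:R * M by rewrite mulr_gt0 ?ltr0n // (lt_le_trans _ (flip_bound_ge1 d beta_gt0)).
rewrite -(cE_tower gw0 (eqG [set v]) (eqG _) G); last by apply: eqoff_sub; apply: subsetT.
rewrite -cEZ; apply: (cE_le gw0 (eqG _)) => s _.
have cw b : (q%:R * M)^-1 * (\sum_(u | eqoff [set v] s u) gw beta u) <= gw beta (upd s v b).
  have := @cell_weight R d q beta q_gt0 beta_gt0 l [set v] 1 s (upd s v b).
  by rewrite /cell expr1; apply; rewrite ?cards1 // eqoff_upd // set11.
rewrite /cE sum_eqoff1 -ler_pdivrMl // mulr_sumr ler_pdivlMr ?(sim_weight_gt0 gw0 (eqG _)) //.
rewrite mulr_suml; apply: ler_sum => b _.
by rewrite mulrAC ler_wpM2r.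
Qed.

(** On the clear event the vertex update is uniform over the [q] spins. Comparing both values of [h]
    with the mean [mV] gives [2 q] times the variance plus [2 q (h - mV)^2], and the latter has the
    same average. *)
Lemma T2_le v : EG (fun s => \sum_b T2 v b s) s0 <= 4 * q%:R * EJ (cVar pi (simV v) h) x0.
Proof.
have sV : equivalence_rel (@simV d l q v) by exact: simV_equiv.
pose mV := cE pi (simV v) h.
pose G x := 2 * q%:R * cVar pi (simV v) h x + 2 * q%:R * (h x - mV x) ^+ 2.
have -> : 4 * q%:R * EJ (cVar pi (simV v) h) x0 = EJ G x0.
  have e2 : EJ (fun x => (h x - mV x) ^+ 2) x0 = EJ (cVar pi (simV v) h) x0.
    rewrite -(cE_tower pi0 sV eqJ) //; apply: cE_eq => x _; rewrite (cVarE pi0 sV).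
    by apply: cE_eq => y xy; rewrite /mV (cE_class _ sV _ xy).
  rewrite /G [RHS]cED (cEZ pi (@anyrel J) (2 * q%:R) (cVar pi (simV v) h)).
  by rewrite (cEZ pi (@anyrel J) (2 * q%:R) (fun x => (h x - mV x) ^+ 2)) e2; ring.
rewrite (push q_gt0 hp _ x0 s0 om0); apply: (cE_le gw0 (eqG _)) => s _.
rewrite /T2 -(cE_sum ber0 (eqO _)); apply: (cE_le ber0 (eqO _)) => om _.
have G0 x : 0 <= G x.
  apply: addr_ge0; apply: mulr_ge0 => //; first exact: (cVar_ge0 pi0 sV).
  exact: sqr_ge0.
case: (boolP (clear v om)) => [cl|_]; last first.
  by rewrite big1 // => b _; rewrite mul0r.
have cl' e : e \in star v -> om e = off.
  by move=> ev; have /forallP/(_ e) := cl; rewrite ev => /eqP.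
have varE : cVar pi (simV v) h (mk s om) = q%:R^-1 * \sum_b (h (mk (upd s v b) om) - mV (mk s om)) ^+ 2.
  by rewrite (cVarE pi0 sV) (vertex_cE q_gt0 beta_gt0 hp _ s cl').
have q0 : q%:R != 0 :> R by rewrite pnatr_eq0 -lt0n.
apply: (@le_trans _ _ (\sum_b (2 * (h (mk (upd s v b) om) - mV (mk s om)) ^+ 2
    + 2 * (h (mk s om) - mV (mk s om)) ^+ 2))).
  apply: ler_sum => b _; rewrite mul1r.
  have sq2 (x y z : R) : (x - y) ^+ 2 <= 2 * (x - z) ^+ 2 + 2 * (y - z) ^+ 2.
    have := sqr_ge0 ((x - z) + (y - z)); nra.
  exact: sq2.
rewrite big_split /= -mulr_sumr sumr_const card_ord -[_ *+ q]mulr_natl /G varE.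
rewrite le_eqVlt; apply/orP; left; apply/eqP; congr (_ + _).
  by rewrite [RHS]mulrA mulfK.
by rewrite mulrCA mulrA.
Qed.

Variable CL : R.
Hypothesis CL0 : 0 <= CL.
Hypothesis lsi : forall (F : spins d l q -> R) s, (forall t, 0 <= F t) ->
  cEnt (@gw R d l q beta) (eqoff [set: vertex d l]) F s <=
    CL * \sum_(i in [set: vertex d l]) EG (Gam i (fun t => Num.sqrt (F t))) s.

(** The 1 is the percolation entropy. With the factor 3 of [proj_spins_diff], [6] comes from
    [2 * c1] in [sum_T1] and [12 * q] from [4 * q] in [T2_le]; [q * M] and [q] belong to the two
    ends of the path. *)
Definition AT_const : R := 1 + CL * (6 * (q%:R * M + q%:R) * c1 + 12 * q%:R * c2).

(** The Potts log-Sobolev inequality leaves gradients of the square root of [proj_spins]. These are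
    bounded by single-update variances of [sqrt f], which [cVar_sqrt_le_cEnt] turns back into
    entropies. *)
Lemma joint_tensorization :
  cEnt pi (@anyrel J) f x0 <=
   AT_const * (\sum_v EJ (cEnt pi (simV v) f) x0 + \sum_e EJ (cEnt pi (simE e) f) x0).
Proof.
rewrite entropy_split.
set SV := \sum_v EJ (cEnt pi (simV v) f) x0; set SE := \sum_e _.
have entV0 v x : 0 <= cEnt pi (simV v) f x by apply: (cEnt_ge0 pi0 (simV_equiv v)).
have entE0 e x : 0 <= cEnt pi (simE e) f x by apply: (cEnt_ge0 pi0 (simE_equiv e)).
have SV0 : 0 <= SV by apply: sumr_ge0 => v _; apply: (cE_ge0 pi0 eqJ).
have SE0 : 0 <= SE by apply: sumr_ge0 => e _; apply: (cE_ge0 pi0 eqJ).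
have AE_le : AE <= SE.
  apply: ler_sum => e _; apply: (cE_le pi0 eqJ) => x _.
  exact: (cVar_sqrt_le_cEnt pi0 (simE_equiv e)).
have M1 := flip_bound_ge1 d beta_gt0.
have M0 : 0 <= M by apply: le_trans M1.
have c10 : 0 <= c1 by rewrite exprn_ge0 // divr_ge0 // ltW.
have c20 : 0 <= c2 by rewrite exprn_ge0 // invr_ge0 ltW.
have T10 : 0 <= \sum_v EG (T1 v) s0.
  by apply: sumr_ge0 => v _; apply: (cE_ge0 gw0 (eqG _)) => s _; apply: T1_ge0.
have gam : \sum_(v in [set: vertex d l]) EG (Gam v (fun t => Num.sqrt (proj_spins t))) s0 <=
    6 * (q%:R * M + q%:R) * c1 * SE + 12 * q%:R * c2 * SV.
  rewrite (eq_bigl xpredT); last by move=> v; rewrite inE.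
  apply: (@le_trans _ _ (\sum_v (3 * (q%:R * M + q%:R) * EG (T1 v) s0
      + 12 * q%:R * c2 * EJ (cEnt pi (simV v) f) x0))).
    apply: ler_sum => v _.
    apply: (@le_trans _ _ (EG (fun s => 3 * (\sum_b T1 v (upd s v b)) + 3 * c2 * (\sum_b T2 v b s)
        + 3 * q%:R * T1 v s) s0)).
      apply: (cE_le gw0 (eqG _)) => s _.
      apply: (@le_trans _ _ (\sum_b (3 * T1 v (upd s v b) + 3 * c2 * T2 v b s + 3 * T1 v s))).
        by apply: ler_sum => b _; apply: proj_spins_diff.
      have split3 (A B : 'I_q -> R) k k' c : \sum_b (k * A b + k' * B b + c) =
          k * (\sum_b A b) + k' * (\sum_b B b) + q%:R * c.
        by rewrite !big_split /= -!mulr_sumr sumr_const card_ord -[_ *+ q]mulr_natl.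
      by rewrite split3 [q%:R * _]mulrCA [3 * (q%:R * _)]mulrA.
    have lin (A B C : spins d l q -> R) k1 k2 k3 :
        EG (fun s => k1 * A s + k2 * B s + k3 * C s) s0 = k1 * EG A s0 + k2 * EG B s0 + k3 * EG C s0.
      by rewrite !cED !cEZ.
    rewrite lin.
    have h1 := sum_flips v (T1_ge0 v).
    have h2 := T2_le v.
    have h3 : EJ (cVar pi (simV v) h) x0 <= EJ (cEnt pi (simV v) f) x0.
      apply: (cE_le pi0 eqJ) => x _; exact: (cVar_sqrt_le_cEnt pi0 (simV_equiv v)).
    have q0 : 0 <= 4 * q%:R :> R by [].
    have {}h2 := le_trans h2 (ler_wpM2l q0 h3).
    have {}h2 := ler_wpM2l c20 h2.
    apply: (@le_trans _ _ (3 * (q%:R * M * EG (T1 v) s0)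
       + 3 * (c2 * (4 * q%:R * EJ (cEnt pi (simV v) f) x0)) + 3 * q%:R * EG (T1 v) s0)).
      rewrite lerD2r; apply: lerD; first exact: ler_wpM2l.
      by rewrite -[leLHS]mulrA; apply: ler_wpM2l.
    have fin (X Y k r c : R) : 3 * (r * k * X) + 3 * (c * (4 * r * Y)) + 3 * r * X =
        3 * (r * k + r) * X + 12 * r * c * Y by ring.
    by rewrite fin.
  rewrite big_split /= -!mulr_sumr lerD2r.
  have C0 : 0 <= 3 * (q%:R * M + q%:R) by rewrite mulr_ge0 // addr_ge0 // mulr_ge0.
  apply: (le_trans (ler_wpM2l C0 (le_trans sum_T1 (ler_wpM2l _ AE_le)))).
    by rewrite mulr_ge0.
  have fin (k c r : R) : 3 * k * (2 * c * r) = 6 * k * c * r by ring.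
  rewrite fin; exact: lexx.
apply: (le_trans (lerD edges_part (le_trans (lsi s0 proj_spins_ge0) (ler_wpM2l CL0 gam)))).
rewrite -/SE /AT_const.
set k1 := 6 * _ * c1; set k2 := 12 * _ * c2.
have k10 : 0 <= k1 by rewrite !mulr_ge0 // addr_ge0 // mulr_ge0.
have k20 : 0 <= k2 by rewrite !mulr_ge0.
have := mulr_ge0 (mulr_ge0 CL0 k10) SV0; have := mulr_ge0 (mulr_ge0 CL0 k20) SE0.
rewrite !mulrDl !mulrDr !mulrA; lra.
Qed.

End JointTensorization.

(** * Entropy decay of the local dynamics *)

Section LocalChain.
Variables (R : realType) (d l q : nat) (beta p : R).
Hypotheses (d_gt0 : (0 < d)%N) (l_gt0 : (0 < l)%N) (q_gt0 : (0 < q)%N).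
Hypotheses (beta_gt0 : 0 < beta) (hp : p = 1 - expR (- beta)).
Local Notation J := (joint_support d l q).
Local Notation pi := (@es_support R d l q p).
Local Notation EJ := (cE pi (@anyrel J)).
Local Notation n := #|{: vertex d l}|.
Local Notation m := #|{: edge d l}|.
Local Notation P := (@local_chain R d l q p).

Let p0 : 0 < p. Proof. exact: p_gt0 beta_gt0 hp. Qed.
Let pl1 : p < 1. Proof. exact: p_lt1 hp. Qed.
Let pi0 : forall x, 0 < pi x. Proof. exact: es_support_gt0 q_gt0 beta_gt0 hp. Qed.
Let eqJ := @anyrel_equiv J.

Lemma card_vertex : n = (l.+1 ^ d)%N.
Proof. by rewrite card_ffun !card_ord. Qed.

Lemma card_vertex_ge2 : (2 <= n)%N.
Proof.
rewrite card_vertex; apply: (@leq_trans (2 ^ d)%N); last by rewrite leq_exp2r.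
by rewrite -{1}(expn1 2) leq_exp2l.
Qed.

Lemma card_edge_gt0 : (0 < m)%N.
Proof.
pose k0 : 'I_d := Ordinal d_gt0.
pose v0 : vertex d l := [ffun=> ord0].
pose v1 : vertex d l := [ffun k => if k == k0 then inord 1 else ord0].
have e01 : is_edge [set v0; v1].
  apply/is_edgeP; exists v0, v1; split=> //; rewrite /adj vdistE (bigD1 k0) //= !ffunE eqxx.
  rewrite inordK // big1 // => k /negPf kk; by rewrite !ffunE kk.
apply/card_gt0P; exists (exist (fun e : {set vertex d l} => is_edge e) _ e01 : edge d l).
by rewrite inE.
Qed.

(** Inadmissible states have measure zero, so the kernel on all joint configurations acts as a
    conditional expectation on the support. *)
Lemma sum_heat_bath (sim : rel (joint d l q)) (F : joint d l q -> R) (x : J) :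
  \sum_(y : joint d l q) heat_bath (es p) sim (val x) y * F y =
  cE pi (fun y z : J => sim (val y) (val z)) (fun y => F (val y)) x.
Proof.
rewrite /cE.
have den : \sum_(z | sim (val x) z) es p z = \sum_(z : J | sim (val x) (val z)) pi z.
  exact: (sum_sub_support _ (@es_inadmissible R d l q p)).
rewrite -den mulr_suml.
rewrite (@sum_sub_support R _ (@admissible d l q) _ xpredT); last first.
  move=> y ny; rewrite /heat_bath; case: ifP => _; last by rewrite mul0r.
  by rewrite es_inadmissible // !mul0r.
rewrite [RHS]big_mkcond /=; apply: eq_bigr => y _; rewrite /heat_bath.
by case: ifP => _; [rewrite mulrAC | rewrite mul0r].
Qed.

Lemma local_dynamics_app (F : joint d l q -> R) (x : J) :
  kernel_app (local_dynamics p) F (val x) =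
  (2 * n%:R)^-1 * (\sum_v cE pi (simV v) (fun y => F (val y)) x)
  + (2 * m%:R)^-1 * (\sum_e cE pi (simE e) (fun y => F (val y)) x).
Proof.
rewrite /kernel_app /local_dynamics.
under eq_bigr do rewrite mulrDl -!mulrA !mulr_suml.
rewrite big_split /= -!mulr_sumr; congr (_ * _ + _ * _); rewrite exchange_big /=.
  by apply: eq_bigr => v _; apply: sum_heat_bath.
by apply: eq_bigr => e _; apply: sum_heat_bath.
Qed.

Lemma local_chain_app (F : joint d l q -> R) (x : J) :
  kernel_app P (fun y => F (val y)) x = kernel_app (local_dynamics p) F (val x).
Proof.
rewrite /kernel_app; apply/esym.
rewrite (@sum_sub_support R _ (@admissible d l q) _ xpredT) // => y ny.
rewrite /local_dynamics /vertex_update /edge_update.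
have hb0 sim : heat_bath (es p) sim (val x) y = 0 :> R.
  by rewrite /heat_bath; case: ifP => // _; rewrite es_inadmissible // mul0r.
by rewrite !big1 ?mulr0 ?addr0 ?mul0r // => *; apply: hb0.
Qed.

Definition extend (g : J -> R) (y : joint d l q) : R := if insub y is Some x then g x else 0.

Lemma extendE g : (fun x : J => extend g (val x)) =1 g.
Proof. by move=> x; rewrite /extend valK. Qed.

Lemma chain_app (g : J -> R) (x : J) :
  kernel_app P g x = (2 * n%:R)^-1 * (\sum_v cE pi (simV v) g x)
    + (2 * m%:R)^-1 * (\sum_e cE pi (simE e) g x).
Proof.
have -> : kernel_app P g x = kernel_app P (fun y => extend g (val y)) x.
  by apply: eq_bigr => y _; rewrite -(extendE g y).
rewrite local_chain_app local_dynamics_app.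
by congr (_ * _ + _ * _); apply: eq_bigr => i _; apply: cE_eq => y _; apply: extendE.
Qed.

Lemma entropy_joint (F : joint d l q -> R) x0 : (forall y, 0 <= F y) ->
  entropy (es p) F = cEnt pi (@anyrel J) (fun x => F (val x)) x0.
Proof.
move=> F0; pose f (x : J) := F (val x).
have exE (H : joint d l q -> R) : expect (es p) H = EJ (fun x => H (val x)) x0.
  rewrite (EJ_E q_gt0 hp) /expect (@sum_sub_support R _ (@admissible d l q) _ xpredT) // => y ny.
  by rewrite es_inadmissible // mul0r.
rewrite /entropy !exE /cEnt -/f; set mu := EJ f x0.
have f0 x : 0 <= f x by apply: F0.
have [m0|mN0] := eqVneq mu 0.
  have fz := cE_eq0 pi0 eqJ (fun x _ => f0 x) m0.
  rewrite m0 mul0r subr0; apply: cE_eq => x _.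
  by rewrite -/(f x) (fz x isT) !mul0r.
have mp : 0 < mu by rewrite lt_def mN0 (cE_ge0 pi0 eqJ).
rewrite [mu * _]mulrC -cEZ -cEB; apply: cE_eq => x _; rewrite -/(f x).
have [->|fN0] := eqVneq (f x) 0; first by rewrite !(mulr0, mul0r) subrr.
have fp : 0 < f x by rewrite lt_def fN0 f0.
by rewrite (ln_div fp mp) mulrBr [ln mu * _]mulrC.
Qed.

Lemma EJ_chain g x0 : EJ (kernel_app P g) x0 = EJ g x0.
Proof.
have n0 : n%:R != 0 :> R by rewrite pnatr_eq0 -lt0n (leq_trans _ card_vertex_ge2).
have m0 : m%:R != 0 :> R by rewrite pnatr_eq0 -lt0n card_edge_gt0.
rewrite (@cE_eq _ _ pi _ _ (fun x => (2 * n%:R)^-1 * (\sum_v cE pi (simV v) g x)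
    + (2 * m%:R)^-1 * (\sum_e cE pi (simE e) g x))); last by move=> x _; apply: chain_app.
rewrite cED !cEZ !(cE_sum pi0 eqJ).
rewrite (eq_bigr (fun=> EJ g x0)); last first.
  by move=> v _; apply: (cE_tower pi0 _ eqJ) => //; apply: simV_equiv.
rewrite [X in _ + _ * X](eq_bigr (fun=> EJ g x0)); last first.
  by move=> e _; apply: (cE_tower pi0 _ eqJ) => //; apply: simE_equiv.
rewrite !sumr_const -[_ *+ n]mulr_natl -[_ *+ m]mulr_natl.
set a := EJ g x0; set N := n%:R in n0 *; set MM := m%:R in m0 *.
by field; rewrite n0 m0.
Qed.

Lemma chain_ge0 g : (forall x, 0 <= g x) -> forall x, 0 <= kernel_app P g x.
Proof.
move=> g0 x; rewrite chain_app addr_ge0 // mulr_ge0 ?invr_ge0 ?mulr_ge0 // sumr_ge0 // => i _.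
  by apply: (cE_ge0 pi0 (@simV_equiv d l q i)).
by apply: (cE_ge0 pi0 (@simE_equiv d l q i)).
Qed.

Lemma chain_selfadjoint f g x0 :
  EJ (fun x => f x * kernel_app P g x) x0 = EJ (fun x => kernel_app P f x * g x) x0.
Proof.
have sa (sim : rel J) : equivalence_rel sim ->
    EJ (fun x => f x * cE pi sim g x) x0 = EJ (fun x => g x * cE pi sim f x) x0.
  move=> simE'; rewrite [LHS](cE_selfadjoint pi0 simE' eqJ) // [RHS](cE_selfadjoint pi0 simE' eqJ) //.
  by apply: cE_eq => x _; exact: mulrC.
have expand (u v : J -> R) : EJ (fun x => u x * kernel_app P v x) x0 =
    (2 * n%:R)^-1 * (\sum_w EJ (fun x => u x * cE pi (simV w) v x) x0)
    + (2 * m%:R)^-1 * (\sum_e EJ (fun x => u x * cE pi (simE e) v x) x0).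
  rewrite -!(cE_sum pi0 eqJ) -!cEZ -cED; apply: cE_eq => x _.
  rewrite chain_app mulrDr -!mulr_sumr; congr (_ + _); exact: mulrCA.
rewrite expand [RHS](@cE_eq _ _ _ _ _ (fun x => g x * kernel_app P f x)); last by move=> *; rewrite mulrC.
rewrite expand; congr (_ * _ + _ * _); apply: eq_bigr => i _; apply: sa.
  exact: simV_equiv.
exact: simE_equiv.
Qed.

Variable C : R.
Hypothesis C_ge1 : 1 <= C.
Hypothesis tensor : forall (f : J -> R) x0, (forall x, 0 <= f x) ->
  cEnt pi (@anyrel J) f x0 <=
   C * (\sum_v EJ (cEnt pi (simV v) f) x0 + \sum_e EJ (cEnt pi (simE e) f) x0).

(** The 2 reflects that vertex and edge updates each occur with probability one half; [3 ^ d] bounds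
    the number of edges per vertex, and [C] is the tensorization constant. *)
Definition rate : R := (2 * (3 ^ d)%:R * C)^-1.

Let C0 : 0 < C. Proof. exact: lt_le_trans C_ge1. Qed.
Let nR : 0 < n%:R :> R. Proof. by rewrite ltr0n (leq_trans _ card_vertex_ge2). Qed.
Let mR : 0 < m%:R :> R. Proof. by rewrite ltr0n card_edge_gt0. Qed.

(** The chain is a convex combination of conditional expectations, so [cEnt_sum_le] bounds the
    entropy by that of the separate updates. By the chain rule each update removes exactly the mean
    of its conditional entropy, and tensorization bounds the sum of these from below. *)
Lemma entropy_decay g x0 : (forall x, 0 <= g x) ->
  cEnt pi (@anyrel J) (kernel_app P g) x0 <= (1 - rate / n%:R) * cEnt pi (@anyrel J) g x0.
Proof.
move=> g0; set H := cEnt pi (@anyrel J) g x0.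
pose F (i : vertex d l + edge d l) (x : J) : R := match i with
  | inl v => (2 * n%:R)^-1 * cE pi (simV v) g x
  | inr e => (2 * m%:R)^-1 * cE pi (simE e) g x end.
have gv0 v x : 0 <= cE pi (simV v) g x by apply: (cE_ge0 pi0 (@simV_equiv d l q v)).
have ge0 e x : 0 <= cE pi (simE e) g x by apply: (cE_ge0 pi0 (@simE_equiv d l q e)).
have cn : 0 <= (2 * n%:R)^-1 :> R by rewrite invr_ge0 mulr_ge0.
have cm : 0 <= (2 * m%:R)^-1 :> R by rewrite invr_ge0 mulr_ge0.
have F0 i x : 0 <= F i x by case: i => i; rewrite mulr_ge0.
have -> : cEnt pi (@anyrel J) (kernel_app P g) x0 = cEnt pi (@anyrel J) (fun x => \sum_i F i x) x0.
  by apply: cEnt_eq => x _; rewrite chain_app big_sumType /= -!mulr_sumr.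
apply: (le_trans (cEnt_sum_le pi0 eqJ x0 F0)).
rewrite big_sumType /=.
rewrite (eq_bigr (fun v => (2 * n%:R)^-1 * (H - EJ (cEnt pi (simV v) g) x0))); last first.
  move=> v _; rewrite (cEntZ pi0 eqJ) // /H (cEnt_chain pi0 (@simV_equiv d l q v) eqJ g) //.
  by congr (_ * _); rewrite addrAC subrr add0r.
rewrite [X in _ + X](eq_bigr (fun e => (2 * m%:R)^-1 * (H - EJ (cEnt pi (simE e) g) x0))); last first.
  move=> e _; rewrite (cEntZ pi0 eqJ) // /H (cEnt_chain pi0 (@simE_equiv d l q e) eqJ g) //.
  by congr (_ * _); rewrite addrAC subrr add0r.
have fin (I : finType) (c u : R) (G : I -> R) :
    \sum_i c * (u - G i) = c * (#|I|%:R * u - \sum_i G i).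
  by rewrite -mulr_sumr sumrB sumr_const mulr_natl.
rewrite !fin.
have := tensor x0 g0; rewrite -/H.
set SV := \sum_v EJ _ x0; set SE := \sum_e EJ _ x0 => tens.
have SV0 : 0 <= SV.
  apply: sumr_ge0 => v _; apply: (cE_ge0 pi0 eqJ) => x _.
  exact: (cEnt_ge0 pi0 (@simV_equiv d l q v)).
have SE0 : 0 <= SE.
  apply: sumr_ge0 => e _; apply: (cE_ge0 pi0 eqJ) => x _.
  exact: (cEnt_ge0 pi0 (@simE_equiv d l q e)).
have three : 1 <= (3 ^ d)%:R :> R by rewrite ler1n expn_gt0.
have mn : m%:R <= (3 ^ d)%:R * n%:R :> R by rewrite -natrM ler_nat card_edge.
set D := (3 ^ d)%:R in three mn *.
have D0 : 0 < D by apply: lt_le_trans three.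
have r1 : (2 * (D * n%:R))^-1 <= (2 * n%:R)^-1 :> R.
  by rewrite lef_pV2 ?posrE ?mulr_gt0 // ler_pM2l // ler_peMl // ltW.
have r2 : (2 * (D * n%:R))^-1 <= (2 * m%:R)^-1 :> R.
  by rewrite lef_pV2 ?posrE ?mulr_gt0 // ler_pM2l.
have -> : (2 * n%:R)^-1 * (n%:R * H - SV) + (2 * m%:R)^-1 * (m%:R * H - SE) =
   H - ((2 * n%:R)^-1 * SV + (2 * m%:R)^-1 * SE).
  by move: nR mR; set N := n%:R; set MM := m%:R => N0 M0; field; rewrite !gt_eqF.
rewrite mulrBl mul1r lerD2l lerN2.
apply: (@le_trans _ _ ((2 * (D * n%:R))^-1 * (SV + SE))).
  have -> : rate / n%:R * H = (2 * (D * n%:R))^-1 * (H / C).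
    by rewrite /rate -/D; move: nR; set N := n%:R => N0; field; rewrite !gt_eqF.
  rewrite ler_wpM2l ?invr_ge0 ?mulr_ge0 ?(ltW D0) ?(ltW nR) // ler_pdivrMr //.
  by rewrite mulrC.
by rewrite mulrDr; apply: lerD; apply: ler_wpM2r.
Qed.

End LocalChain.

(** * Mixing time *)

(** Through the Hellinger distance: with [r = sqrt f] of mean [s], Cauchy-Schwarz for
    [|f - 1| = |r - 1| (r + 1)] gives [(2 - 2 s) (2 + 2 s) = 4 Var r], which is at most four times
    the entropy. *)
Lemma pinsker (R : realType) (X : finType) (w : X -> R) (sim : rel X) (f : X -> R) x :
  (forall y, 0 < w y) -> equivalence_rel sim -> (forall y, sim x y -> 0 <= f y) -> cE w sim f x = 1 ->
  cE w sim (fun y => `|f y - 1|) x ^+ 2 <= 8 * cEnt w sim f x.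
Proof.
move=> w0 simE f0 f1; pose r y := Num.sqrt (f y); pose s := cE w sim r x.
have rr y : sim x y -> r y ^+ 2 = f y by move=> /f0 ?; rewrite sqr_sqrtr.
have varE : cVar w sim r x = 1 - s ^+ 2.
  by rewrite /cVar -/s (@cE_eq _ _ w sim _ f) // f1.
have s0 : 0 <= s by apply: (cE_ge0 w0 simE) => y _; apply: sqrtr_ge0.
have s1 : s <= 1.
  by have := cVar_ge0 w0 simE r x; rewrite varE subr_ge0 -{1}(expr1n R 2) ler_sqr ?nnegrE.
have quad (c : R) : cE w sim (fun y => (r y + c) ^+ 2) x = 1 + 2 * c * s + c ^+ 2.
  rewrite (@cE_eq _ _ w sim _ (fun y => f y + 2 * c * r y + c ^+ 2)); last by move=> y /rr <-; ring.
  by rewrite !cED cEZ (cE_cst w0 simE) f1.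
have := cE_cauchy w0 simE (fun y => `|r y - 1|) (fun y => r y + 1) x.
rewrite (@cE_eq _ _ w sim _ (fun y => `|f y - 1|)); last first.
  move=> y xy; rewrite -(rr y xy).
  have -> : r y ^+ 2 - 1 = (r y - 1) * (r y + 1) by ring.
  rewrite normrM; congr (_ * _).
  by rewrite [RHS]ger0_norm // addr_ge0 // sqrtr_ge0.
rewrite [X in _ <= X * _](@cE_eq _ _ w sim _ (fun y => (r y + (-1)) ^+ 2)); last first.
  by move=> y _; rewrite real_normK ?num_real.
rewrite !quad => /le_trans; apply.
have := cVar_sqrt_le_cEnt w0 simE f0; rewrite -/r varE; set E := cEnt _ _ _ _ => le_E.
nra.
Qed.

Section Mixing.
Variables (R : realType) (d l q : nat) (beta p : R).
Hypotheses (d_gt0 : (0 < d)%N) (l_gt0 : (0 < l)%N) (q_gt0 : (0 < q)%N).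
Hypotheses (beta_gt0 : 0 < beta) (hp : p = 1 - expR (- beta)).
Local Notation J := (joint_support d l q).
Local Notation pi := (@es_support R d l q p).
Local Notation EJ := (cE pi (@anyrel J)).
Local Notation n := #|{: vertex d l}|.
Local Notation m := #|{: edge d l}|.
Local Notation P := (@local_chain R d l q p).

Let p0 : 0 < p. Proof. exact: p_gt0 beta_gt0 hp. Qed.
Let pl1 : p < 1. Proof. exact: p_lt1 hp. Qed.
Let pi0 : forall x, 0 < pi x. Proof. exact: es_support_gt0 q_gt0 beta_gt0 hp. Qed.
Let eqJ := @anyrel_equiv J.
Let EJE (H : J -> R) x0 : EJ H x0 = \sum_x pi x * H x. Proof. exact: EJ_E q_gt0 hp H x0. Qed.

(** A column of the kernel, with [y] as starting point, so that one more step is an application of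
    [P]. By reversibility it is also the density at [y] of the chain started at [x]. *)
Definition kernel_density t (x y : J) : R := kernel_pow P t y x / pi x.

Lemma kernel_densityS t x y : kernel_density t.+1 x y = kernel_app P (kernel_density t x) y.
Proof. by rewrite /kernel_density /= mulr_suml; apply: eq_bigr => z _; rewrite mulrA. Qed.

Lemma EJ_delta x (H : J -> R) x0 : EJ (fun y => (y == x)%:R * H y) x0 = pi x * H x.
Proof.
rewrite EJE (bigD1 x) //= eqxx mul1r big1 ?addr0 // => y /negPf ->.
by rewrite mul0r mulr0.
Qed.

Lemma kernel_density_ge0 t x y : 0 <= kernel_density t x y.
Proof.
elim: t y => [|t IHt] y; first by rewrite /kernel_density divr_ge0 // ltW.
by rewrite kernel_densityS (chain_ge0 q_gt0 beta_gt0 hp).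
Qed.

Lemma EJ_kernel_density t x x0 : EJ (kernel_density t x) x0 = 1.
Proof.
elim: t => [|t IHt]; first by rewrite EJ_delta mulfV // gt_eqF.
rewrite -{}IHt -(EJ_chain d_gt0 l_gt0 q_gt0 beta_gt0 hp (kernel_density t x)).
by apply: cE_eq => y _; apply: kernel_densityS.
Qed.

Lemma kernel_density0_entropy x x0 : cEnt pi (@anyrel J) (kernel_density 0 x) x0 = - ln (pi x).
Proof.
rewrite /cEnt EJ_kernel_density ln1 mulr0 subr0.
rewrite (@cE_eq _ _ pi _ _ (fun y => (y == x)%:R * ((pi x)^-1 * ln (kernel_density 0 x y)))); last first.
  by move=> y _; rewrite mulrA.
by rewrite EJ_delta mulrA mulfV ?gt_eqF // mul1r /kernel_density /= eqxx mul1r lnV ?posrE.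
Qed.

Lemma iter_selfadjoint t f g x0 :
  EJ (fun x => f x * iter t (kernel_app P) g x) x0 = EJ (fun x => iter t (kernel_app P) f x * g x) x0.
Proof.
elim: t f => [//|t IHt] f; rewrite iterS (chain_selfadjoint q_gt0 beta_gt0 hp) IHt.
by apply: cE_eq => x _; rewrite iterSr.
Qed.

Lemma kernel_pow_iter t z y : kernel_pow P t z y = iter t (kernel_app P) (fun u => (u == y)%:R) z.
Proof. by elim: t z => [//|t IHt] z; apply: eq_bigr => u _; congr (_ * _); exact: IHt. Qed.

Lemma reversible t x y : pi x * kernel_pow P t x y = pi y * kernel_pow P t y x.
Proof.
rewrite !kernel_pow_iter -(EJ_delta x _ x) iter_selfadjoint -(EJ_delta y _ x).
by apply: cE_eq => z _; exact: mulrC.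
Qed.

Lemma tv_kernel_density t x : tv_dist (kernel_pow P t x) pi = 2^-1 * EJ (fun y => `|kernel_density t x y - 1|) x.
Proof.
rewrite /tv_dist EJE; congr (_ * _); apply: eq_bigr => y _.
rewrite -{2}(gtr0_norm (pi0 y)) -normrM mulrBr mulr1; congr (`|_ - _|).
by rewrite /kernel_density mulrA -reversible mulrAC mulfV ?mul1r // gt_eqF.
Qed.

(** With the constant 8 of [pinsker], entropy [1 / 32] means an [L^1] distance of at most [1 / 2],
    and total variation is half of that. *)
Lemma tv_entropy t x : cEnt pi (@anyrel J) (kernel_density t x) x <= 32^-1 ->
  tv_dist (kernel_pow P t x) pi <= 4^-1.
Proof.
move=> ent; rewrite tv_kernel_density.
have := pinsker pi0 eqJ (fun y _ => kernel_density_ge0 t x y) (EJ_kernel_density t x x).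
have : 0 <= EJ (fun y => `|kernel_density t x y - 1|) x by apply: (cE_ge0 pi0 eqJ).
set D := EJ _ x; move: ent; set E := cEnt _ _ _ _ => ent D0 pin.
nra.
Qed.

(** A state has mass at least [(p (1 - p))^m / q^n] with [m <= 3^d n]. The final 1 makes [info] at
    least 1, so that the logarithms taken later are nonnegative. *)
Definition info : R := (3 ^ d)%:R * (- ln p - ln (1 - p)) + ln q%:R + 1.

Lemma ln_pi_ge x : - ln (pi x) <= info * n%:R.
Proof.
have p1 : 0 < 1 - p by rewrite subr_gt0.
have lp : 0 <= - ln p by rewrite oppr_ge0 ln_le0 // ltW.
have lp1 : 0 <= - ln (1 - p) by rewrite oppr_ge0 ln_le0 // gerBl ltW.
have Z0 := Zg_gt0 d l beta q_gt0.
rewrite pi_val -/(es_weight p) (weight_sum d l q hp).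
have : \sum_(s : spins d l q) gw beta s <= q%:R ^+ n.
  have -> : q%:R ^+ n = \sum_(s : spins d l q) 1 :> R.
    by rewrite sumr_const -natrX -[q in LHS]card_ord -card_ffun.
  apply: ler_sum => s _; rewrite gwE -[leRHS]expR0 ler_expR.
  by rewrite mulNr oppr_le0 mulr_ge0 // ltW.
move: Z0; set Z := \sum_s _ => Z0 Zq.
have lnZ : ln Z <= ln q%:R * n%:R.
  rewrite mulr_natr -lnXn ?ltr0n // ler_ln ?posrE // exprn_gt0 // ltr0n.
  done.
set A := (val x).2; rewrite ln_div ?posrE ?mulr_gt0 ?exprn_gt0 //.
rewrite lnM ?posrE ?exprn_gt0 // !lnXn //.
have mn : m%:R <= (3 ^ d)%:R * n%:R :> R by rewrite -natrM ler_nat card_edge.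
have am : (#|A| <= m)%N by apply: max_card.
rewrite -[ln p *+ _]mulr_natr -[ln (1 - p) *+ _]mulr_natr.
have a1 : - ln p * #|A|%:R <= - ln p * m%:R by apply: ler_wpM2l; rewrite ?ler_nat.
have a2 : - ln (1 - p) * (m - #|A|)%:R <= - ln (1 - p) * m%:R.
  by apply: ler_wpM2l; rewrite ?ler_nat ?leq_subr.
have a3 : (- ln p - ln (1 - p)) * m%:R <= (- ln p - ln (1 - p)) * ((3 ^ d)%:R * n%:R).
  by apply: ler_wpM2l => //; rewrite addr_ge0.
have n0 : 0 <= n%:R :> R by [].
have -> : info * n%:R = (- ln p - ln (1 - p)) * ((3 ^ d)%:R * n%:R) + ln q%:R * n%:R + n%:R.
  by rewrite /info; ring.
move: a1 a2 a3; rewrite [X in _ -> _ -> X <= _ -> _]mulrDl !mulNr => a1 a2 a3.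
have comb (u v z X Y N A' B' : R) : - u <= A' -> - v <= B' -> A' + B' <= X -> z <= Y -> 0 <= N ->
    - (u + v - z) <= X + Y + N.
  by move=> h1 h2 h3 h4 h5; rewrite opprB opprD; move: (lerD (lerD (le_trans (lerD h1 h2) h3) h4) h5); rewrite addr0 addrC.
exact: comb a1 a2 a3 lnZ n0.
Qed.

Lemma info_ge1 : 1 <= info.
Proof.
rewrite /info lerDr addr_ge0 ?ln_ge0 ?ler1n // mulr_ge0 // addr_ge0 // oppr_ge0 ln_le0 //.
  exact: ltW.
by rewrite gerBl ltW.
Qed.

Variable C : R.
Hypothesis C_ge1 : 1 <= C.
Hypothesis tensor : forall (f : J -> R) x0, (forall x, 0 <= f x) ->
  cEnt pi (@anyrel J) f x0 <=
   C * (\sum_v EJ (cEnt pi (simV v) f) x0 + \sum_e EJ (cEnt pi (simE e) f) x0).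
Local Notation delta := (rate d C).

Lemma rate_gt0 : 0 < delta.
Proof. by rewrite invr_gt0 !mulr_gt0 ?ltr0n ?expn_gt0 //; move: C_ge1; lra. Qed.

Lemma rate_le1 : delta <= 1.
Proof.
rewrite invf_le1; last by rewrite -invr_gt0 -/(rate d C) rate_gt0.
have : 1 <= (3 ^ d)%:R :> R by rewrite ler1n expn_gt0.
move: C_ge1; nra.
Qed.

Let n2 : (2 <= n)%N. Proof. exact: card_vertex_ge2. Qed.
Let nR : 0 < n%:R :> R. Proof. by rewrite ltr0n (leq_trans _ n2). Qed.

Lemma kernel_density_entropy t x x0 :
  cEnt pi (@anyrel J) (kernel_density t x) x0 <= expR (- (delta / n%:R) * t%:R) * (info * n%:R).
Proof.
have le1 : 0 <= 1 - delta / n%:R.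
  rewrite subr_ge0 ler_pdivrMr // mul1r (le_trans rate_le1) // ler1n.
  exact: leq_trans n2.
have step : 1 - delta / n%:R <= expR (- (delta / n%:R)) by apply: expR_ge1Dx.
elim: t => [|t IHt].
  by rewrite mulr0 expR0 mul1r kernel_density0_entropy ln_pi_ge.
rewrite (@cEnt_eq _ _ pi _ _ (kernel_app P (kernel_density t x))); last by move=> y _; apply: kernel_densityS.
apply: (le_trans (entropy_decay d_gt0 l_gt0 q_gt0 beta_gt0 hp C_ge1 tensor x0 (kernel_density_ge0 t x))).
have -> : - (delta / n%:R) * t.+1%:R = - (delta / n%:R) + - (delta / n%:R) * t%:R.
  by rewrite -[t.+1]add1n natrD mulrDr mulr1.
rewrite expRD -mulrA.
apply: ler_pM => //; apply: (cEnt_ge0 pi0 eqJ) => y _; exact: kernel_density_ge0.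
Qed.

(** Additive constants are absorbed through [1 <= ln n / ln 2], valid because there are at least two
    vertices; the last term accounts for rounding the time up to an integer. *)
Definition mixing_const : R := (ln (32 * info) / ln 2 + 1) / delta + (ln 2)^-1.

Lemma mixing_const_gt0 : 0 < mixing_const.
Proof.
have l2 : 0 < ln 2 :> R by rewrite ln_gt0 // ltr1n.
have i0 : 0 <= ln (32 * info) by apply: ln_ge0; have := info_ge1; lra.
apply: addr_gt0; last by rewrite invr_gt0.
by apply: divr_gt0 rate_gt0; rewrite ltr_wpDl // divr_ge0 // ltW.
Qed.

Lemma mixing_bound :
  (mixing_time P pi <= (mixing_const * n%:R * ln n%:R)%:E)%E.
Proof.
have l2 : 0 < ln 2 :> R by rewrite ln_gt0 // ltr1n.
have d0 := rate_gt0; have i1 := info_ge1.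
have i0 : 0 < 32 * info by move: i1; lra.
(* At this time the bound of [kernel_density_entropy] equals [1 / 32]. *)
pose T := n%:R / delta * ln (32 * info * n%:R).
have n1 : 1 <= n%:R :> R by rewrite ler1n (leq_trans _ n2).
have T0 : 0 <= T.
  apply: mulr_ge0; [apply: divr_ge0; exact: ltW | apply: ln_ge0].
  by move: n1 i1; set N := n%:R; nra.
have [t tT Tt] : exists2 t : nat, t%:R <= T + 1 & T <= t%:R.
  have /andP[lo /ltW hi] := truncn_itv T0; exists (Num.trunc T).+1 => //.
  by rewrite -addn1 natrD lerD2r.
apply: ge_ereal_sup => _ [x _ <-].
apply: (@le_trans _ _ (t%:R)%:E).
  apply: ereal_inf_lbound; exists t => //.
  apply: tv_entropy; apply: (le_trans (kernel_density_entropy t x x)).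
  apply: (@le_trans _ _ (expR (- (delta / n%:R) * T) * (info * n%:R))).
    apply: ler_wpM2r; first by rewrite mulr_ge0 // (le_trans ler01).
    by rewrite ler_expR !mulNr lerN2 ler_wpM2l // divr_ge0 // ltW.
  have -> : - (delta / n%:R) * T = - ln (32 * info * n%:R).
    by rewrite /T; set L := ln _; move: nR d0; set N := n%:R => N0 d0; field; rewrite !gt_eqF.
  rewrite expRN lnK ?posrE ?mulr_gt0 //.
  have -> : (32 * info * n%:R)^-1 * (info * n%:R) = 32^-1 :> R => //.
  by move: nR i1; set N := n%:R => N0 i1; field; rewrite !gt_eqF // (lt_le_trans ltr01).
  exact: lt_le_trans i1.
rewrite lee_fin; apply: (le_trans tT).
have ln2n : ln 2 <= ln n%:R :> R by rewrite ler_ln ?posrE ?ler_nat.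
have -> : mixing_const * n%:R * ln n%:R =
   n%:R / delta * (ln (32 * info) * (ln n%:R / ln 2) + ln n%:R) + n%:R * (ln n%:R / ln 2).
  by rewrite /mixing_const; set L := ln 2 in l2 *; field; rewrite !gt_eqF.
have r1 : 1 <= ln n%:R / ln 2 :> R by rewrite ler_pdivlMr // mul1r.
rewrite /T lnM ?posrE //; apply: lerD.
  apply: ler_wpM2l; first by rewrite divr_ge0 ?ltW.
  by rewrite lerD2r ler_peMr //; apply: ln_ge0; move: i1; lra.
exact: mulr_ege1.
Qed.

End Mixing.

Lemma AT_const_ge1 (R : realType) d q (beta p CL : R) :
  0 < beta -> p = 1 - expR (- beta) -> 0 <= CL -> 1 <= AT_const d q beta p CL.
Proof.
move=> beta_gt0 hp CL0; have p0 := p_gt0 beta_gt0 hp; have pl1 := p_lt1 hp.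
have M0 : 0 <= @flip_bound R d beta by apply: le_trans (flip_bound_ge1 d beta_gt0).
have p1 : 0 < 1 - p by rewrite subr_gt0.
rewrite /AT_const lerDl mulr_ge0 // addr_ge0 ?mulr_ge0 ?addr_ge0 ?mulr_ge0 ?exprn_ge0 //.
  by rewrite divr_ge0 // ltW.
by rewrite invr_ge0 ltW.
Qed.

Lemma local_dynamics_ge0 (R : realType) d l q (p : R) (x y : joint d l q) :
  0 < p -> p < 1 -> 0 <= local_dynamics p x y.
Proof.
move=> p0 p1.
have w0 z : 0 <= es_weight p z :> R by rewrite !mulr_ge0 // exprn_ge0 // ?subr_ge0 ltW.
have es0 z : 0 <= es p z :> R by rewrite divr_ge0 // sumr_ge0.
have hb0 sim : 0 <= heat_bath (es p) sim x y :> R.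
  by rewrite /heat_bath; case: ifP => // _; rewrite divr_ge0 // sumr_ge0.
by rewrite addr_ge0 // mulr_ge0 ?invr_ge0 ?mulr_ge0 // sumr_ge0 // => i _; apply: hb0.
Qed.

Theorem theorem6p3 (R : realType) (d q : nat) (beta p : R)
    (hd : (1 <= d)%N) (hq : (2 <= q)%N) (hbeta : 0 < beta)
    (hp : p = 1 - expR (- beta)) (hSSM : SSM d q beta) :
  (exists delta : R, 0 < delta /\
     forall (l : nat), (1 <= l)%N ->
     forall f : joint d l q -> R, (forall x, 0 <= f x) ->
       entropy (es p) (kernel_app (local_dynamics p) f)
         <= (1 - delta / #|{: vertex d l}|%:R) * entropy (es p) f)
  /\
  (exists C : R, 0 < C /\
     forall (l : nat), (1 <= l)%N ->
       (mixing_time (@local_chain R d l q p) (@es_support R d l q p)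
         <= (C * #|{: vertex d l}|%:R * ln #|{: vertex d l}|%:R)%:E)%E).
Proof.
have q0 : (0 < q)%N by apply: leq_trans hq.
have [a [b [a0 b0 mixing]]] := hSSM.
have [CL CL0 lsi] := uniform_lsi hd q0 hbeta a0 b0 mixing.
have C1 := AT_const_ge1 d q hbeta hp CL0; set C := AT_const _ _ _ _ _ in C1.
(* Base points at which the conditional expectations are evaluated; for total relations the value
   does not depend on them. *)
pose s0 l : spins d l q := [ffun=> Ordinal q0].
pose om0 l : {ffun edge d l -> 'I_2} := [ffun=> off].
have tensor l (f : joint_support d l q -> R) x0 : (forall x, 0 <= f x) ->
    cEnt (es_support p) (@anyrel _) f x0 <=
      C * (\sum_v cE (es_support p) (@anyrel _) (cEnt (es_support p) (simV v) f) x0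
           + \sum_e cE (es_support p) (@anyrel _) (cEnt (es_support p) (simE e) f) x0).
  by move=> f0; apply: (joint_tensorization q0 hbeta hp f0 (s0 l) (om0 l) x0 CL0 (lsi l)).
split.
  exists (rate d C); split=> [|l l0 f f0]; first exact: rate_gt0 C1.
  pose x0 := mk (s0 l) (om0 l).
  have Pf0 y : 0 <= kernel_app (local_dynamics p) f y.
    apply: sumr_ge0 => z _; apply: mulr_ge0 => //; exact: local_dynamics_ge0 (p_gt0 hbeta hp) (p_lt1 hp).
  rewrite (entropy_joint q0 hbeta hp x0 f0) (entropy_joint q0 hbeta hp x0 Pf0).
  rewrite (cEnt_eq _ (fun x _ => esym (local_chain_app p f x))).
  by apply: (entropy_decay hd l0 q0 hbeta hp C1 (tensor l) x0).
exists (mixing_const d q p C); split=> [|l l0]; first exact: (mixing_const_gt0 d q0 hbeta hp C1).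
exact: (mixing_bound hd l0 q0 hbeta hp C1 (tensor l)).
Qed.
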